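(* Let $(\mathbf{G}_N)_{N\ge1}$ be any sequence of complex Ginibre matrices defined on a common probability space: for each $N$, $\mathbf{G}_N$ is an $N\times N$ matrix whose entries are independent centred complex Gaussian variables satisfying $$\mathbb{E}\big[|(\mathbf{G}_N)_{ij}|^2\big]=\frac1N,\qquad \mathbb{E}\big[(\mathbf{G}_N)_{ij}^2\big]=0$$ (no assumption is made on the joint law for different $N$). Set $$p_N(z):=\det(z\mathbf{I}-\mathbf{G}_N),\qquad q_N(z):=\exp\Big(-\frac1{2N}\partial_z^2\Big)p_N(z).$$ Then, almost surely, $\nu_{q_N}\to\mathfrak{sc}_1$ weakly as $N\to\infty$.
   Context: For a polynomial $P$ and $t\in\mathbb{C}$, the heat operator is the terminating series $$\exp\Big(\frac{t}{2N}\partial_z^2\Big)P:=\sum_{k=0}^{\lfloor \deg(P)/2\rfloor}\frac1{k!}\Big(\frac{t}{2N}\Big)^k\partial_z^{2k}P .$$ For a monic polynomial $P$ of degree $N$, $\nu_P:=\frac1N\sum_{P(\zeta)=0}\delta_\zeta$ is its empirical zero measure on $\mathbb{C}$, counting multiplicities. Weak convergence of probability measures on $\mathbb{C}$ is convergence against bounded continuous functions. The semicircle law of variance one is $d\mathfrak{sc}_1(x)=\frac{\sqrt{4-x^2}}{2\pi}\mathbf{1}_{[-2,2]}(x)\,dx$, regarded as a measure on $\mathbb{C}$ supported on the real line. *)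

(* Defs.v *)
From HB Require Import structures.
From mathcomp Require Import all_boot all_order all_algebra complex.
From mathcomp Require Import all_classical all_reals all_analysis.
From mathcomp Require Import measurable_realfun.

Set Implicit Arguments.
Unset Strict Implicit.
Unset Printing Implicit Defensive.

Import Order.TTheory GRing.Theory Num.Theory.
Import numFieldNormedType.Exports.

Local Open Scope classical_set_scope.
Local Open Scope ring_scope.
Local Open Scope complex_scope.

(* The library puts the topology of the modulus on the regular module R[i]^o
   and not on R[i] itself; R[i] carries no sigma-algebra, so C is given the
   Borel one. *)
Definition measurableTypeC (R : realType) : Type :=
  g_sigma_algebraType (@open R[i]^o).

HB.instance Definition _ (R : realType) :=
  Measurable.on (measurableTypeC R).

Section random_variables.
Context {d : measure_display} {T : measurableType d} {R : realType}.
Variable P : probability T R.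

(* Meaningful only when Re Z and Im Z are integrable, since fine sends
   infinite values to 0. *)
Definition cexpectation (Z : T -> R[i]) : R[i] :=
  fine 'E_P[fun w => complex.Re (Z w)] +i* fine 'E_P[fun w => complex.Im (Z w)].

(* Real Gaussian variables include the constants (s = 0), for which
   normal_prob is not the Dirac mass. *)
Definition gaussian (X : T -> R) : Prop :=
  measurable_fun setT X /\
  exists m s : R, 0 <= s /\
    forall A : set (measurableTypeR R), measurable A ->
      P (X @^-1` A) = if s == 0 then \d_m A else normal_prob m s A.

(* Z is complex Gaussian when (Re Z, Im Z) is a Gaussian vector of R^2, i.e.
   when every real linear form of this vector is Gaussian. *)
Definition complex_gaussian (Z : T -> R[i]) : Prop :=
  measurable_fun setT (Z : T -> measurableTypeC R) /\
  forall a b : R,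
    gaussian (fun w => a * complex.Re (Z w) + b * complex.Im (Z w)).

Definition mutually_independent (I : finType) (d' : measure_display)
    (U : measurableType d') (X : I -> T -> U) : Prop :=
  forall (J : {set I}) (B : I -> set U), (forall i, measurable (B i)) ->
    P (\bigcap_(i in [set` J]) X i @^-1` B i)
    = (\prod_(i in J) P (X i @^-1` B i))%E.

Record ginibre (N : nat) (G : T -> 'M[R[i]]_N) : Prop := Ginibre {
  ginibre_gaussian : forall i j, complex_gaussian (fun w => G w i j) ;
  ginibre_independent :
    mutually_independent
      (fun ij : 'I_N * 'I_N => fun w => G w ij.1 ij.2 : measurableTypeC R) ;
  ginibre_centred : forall i j, cexpectation (fun w => G w i j) = 0 ;
  ginibre_variance : forall i j,
    cexpectation (fun w => `|G w i j| ^+ 2) = N%:R^-1 ;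
  ginibre_pseudovariance : forall i j,
    cexpectation (fun w => G w i j ^+ 2) = 0 }.

End random_variables.

(* As deg Q = (size Q).-1, the index k runs over 0, ..., floor (deg Q / 2). *)
Definition heat (R : realType) (N : nat) (t : R[i]) (Q : {poly R[i]}) :
    {poly R[i]} :=
  \sum_(k < (size Q).-1./2.+1)
    (k`!%:R^-1 * (t / (2 * N%:R)) ^+ k) *: Q^`(2 * k).

(* The roots of Q, repeated according to their multiplicities. *)
Definition zeros (R : realType) (Q : {poly R[i]}) : seq R[i] :=
  sval (closed_field_poly_normal Q).

Definition zero_measure (R : realType) (Q : {poly R[i]}) :
    {measure set (measurableTypeC R) -> \bar R} :=
  mscale ((size Q).-1%:R^-1)%:nng
    (msum (fun k => \d_((zeros Q)`_k : measurableTypeC R)) (size (zeros Q))).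

Section semicircle.
Context {R : realType}.

Definition semicircle_pdf (x : R) : R :=
  Num.sqrt (4 - x ^+ 2) / (2 * pi) * \1_(`[-2, 2]%classic : set R) x.

Lemma semicircle_pdf_ge0 x : 0 <= semicircle_pdf x.
Proof.
by rewrite /semicircle_pdf !mulr_ge0// ?sqrtr_ge0// invr_ge0 mulr_ge0// pi_ge0.
Qed.

Lemma measurable_semicircle_pdf : measurable_fun setT semicircle_pdf.
Proof.
apply: measurable_funM; last exact: measurable_indic.
apply: measurable_funM => //.
apply: (measurableT_comp (f := @Num.sqrt R)).
  by apply: continuous_measurable_fun; exact: sqrt_continuous.
by apply: measurable_funB => //; exact: measurable_funX.
Qed.

Definition semicircle (A : set (measurableTypeR R)) : \bar R :=
  (\int[lebesgue_measure]_(x in A) (semicircle_pdf x)%:E)%E.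

Let semicircle0 : semicircle set0 = 0%E.
Proof. by rewrite /semicircle integral_set0. Qed.

Let semicircle_ge0 A : (0 <= semicircle A)%E.
Proof.
by apply: integral_ge0 => x _; rewrite lee_fin semicircle_pdf_ge0.
Qed.

Let semicircle_sigma_additive : semi_sigma_additive semicircle.
Proof.
move=> F mF tF mUF; rewrite /semicircle ge0_integral_bigcup//=.
- apply: is_cvg_ereal_nneg_natsum_cond => n _ _.
  exact: semicircle_ge0.
- apply/measurable_EFinP; apply: measurable_funTS.
  exact: measurable_semicircle_pdf.
- by move=> x _; rewrite lee_fin semicircle_pdf_ge0.
Qed.

HB.instance Definition _ := isMeasure.Build _ (measurableTypeR R) R
  semicircle semicircle0 semicircle_ge0 semicircle_sigma_additive.

Definition real_to_C (x : measurableTypeR R) : measurableTypeC R := x%:C.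

Lemma measurable_real_to_C : measurable_fun setT real_to_C.
Proof.
apply: (@measurability _ _ _ _ setT real_to_C (@open R[i]^o)) => //.
move=> _ [A oA <-]; rewrite setTI; apply: open_measurable.
rewrite openE => x /= Ax.
move: oA; rewrite openE => /(_ _ Ax) /nbhs_ballP[e /= e0 eA].
have ee : e = (complex.Re e)%:C.
  by move: e0; rewrite ltcE /=; case: (e) => a b /= /andP[/eqP -> _].
have Re0 : 0 < complex.Re e by rewrite -ltcR -ee.
exists (complex.Re e) => //= y /= xy.
apply: eA; rewrite -ball_normE /=.
rewrite ee -rmorphB normc_def /= expr0n addr0 sqrtr_sqr ltcR.
exact: xy.
Qed.

Definition semicircleC : set (measurableTypeC R) -> \bar R :=
  pushforward semicircle real_to_C.

Let measurable_preimage_real_to_C (A : set (measurableTypeC R)) :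
  measurable A -> measurable (real_to_C @^-1` A).
Proof.
by move=> mA; rewrite -[X in measurable X]setTI; exact: measurable_real_to_C.
Qed.

Let semicircleC0 : semicircleC set0 = 0%E.
Proof. by rewrite /semicircleC /pushforward preimage_set0 measure0. Qed.

Let semicircleC_ge0 A : (0 <= semicircleC A)%E.
Proof. exact: semicircle_ge0. Qed.

Let semicircleC_sigma_additive : semi_sigma_additive semicircleC.
Proof.
move=> F mF tF mUF; rewrite /semicircleC /pushforward preimage_bigcup.
apply: measure_semi_sigma_additive.
- by move=> n; exact: measurable_preimage_real_to_C.
- apply/trivIsetP => /= i j _ _ ij; rewrite -preimage_setI.
  by move/trivIsetP : tF => /(_ _ _ _ _ ij) ->//; rewrite preimage_set0.
- by rewrite -preimage_bigcup; exact: measurable_preimage_real_to_C.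
Qed.

HB.instance Definition _ := isMeasure.Build _ (measurableTypeC R) R
  semicircleC semicircleC0 semicircleC_ge0 semicircleC_sigma_additive.

End semicircle.

Definition weak_cvg (R : realType)
    (mu_ : nat -> {measure set (measurableTypeC R) -> \bar R})
    (mu : {measure set (measurableTypeC R) -> \bar R}) : Prop :=
  forall f : R[i]^o -> R, continuous f -> (exists M : R, forall z, `|f z| <= M) ->
    (\int[mu_ n]_z (f z)%:E)%E @[n --> \oo] --> (\int[mu]_z (f z)%:E)%E.

(* Main.v *)
Require Import Defs.
From mathcomp Require Import all_boot all_order all_fingroup all_algebra complex ring lra zify.
From mathcomp Require Import all_classical all_reals all_analysis.
From mathcomp Require Import measurable_realfun.
Set Implicit Arguments.
Unset Strict Implicit.
Unset Printing Implicit Defensive.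
Import Order.TTheory GRing.Theory Num.Theory.
Import numFieldNormedType.Exports.
Local Open Scope classical_set_scope.
Local Open Scope ring_scope.

(** Applying the heat operator to det (z - G_N) term by term gives
    q_N = h_N + sum_(j < N) c_j h_j, where c_j is the coefficient of z ^ j in the
    characteristic polynomial of G_N and h_m, the image of z ^ m, is a rescaled
    Hermite polynomial: h_(m+1) = z h_m - (m / N) h_(m-1) (heat_hermite, hermiteS).
    Two facts give the result: the zeros of h_N are close to the semicircle law,
    and the c_j are too small to move them much.

    Perturbation. In the basis (h_m), multiplication by z modulo q_N has a
    tridiagonal matrix whose last row is perturbed by the c_j, and q_N is its
    characteristic polynomial (char_poly_comrade). Dividing h_m by its norm
    rho_m = (m! / N ^ m) ^ (1/2) turns the unperturbed matrix into the Hermitian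
    Jacobi matrix J of h_N. For the perturbed matrix the basis is rescaled
    moreover by the slowly varying weights 1 / (1 + s (N - 1 - m)), which damp
    the coefficients of low degree; the result B satisfies
    |B - J|^2 <= 2 (2 (s^2 + s) + last_row_norm) for the Frobenius norm, where
    s^2 + s is the price of the weights. By an inequality of Hoffman-Wielandt
    type for a Hermitian J and an arbitrary B (hermitian_perturbation_coupling),
    a doubly stochastic matrix couples the zeros of q_N with those of h_N at
    quadratic cost 6 |B - J|^2 (hermite_coupling).

    Probability. Distinct monomials in the expansion of c_j are orthogonal, so
    that E |c_j|^2 = N! / (j! N ^ (N - j)) (ginibre_char_poly_coef). This is
    exactly rho_(N-1)^2 / rho_j^2, so that the part of last_row_norm with
    j < N - 1 has expectation sum_(l >= 1) (1 + s l) ^ -2 <= 1 / s. The last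
    coefficient is minus the trace, whose fourth moment is bounded
    (ginibre_trace_fourth_moment). With s = N ^ (1/4), the cost of the weights is
    o(N), and the expectations of the first part divided by N and of
    (|tr G_N|^2 / N)^2 are O(N ^ (-5/4)), hence summable. So the cost divided by
    N tends to 0 almost surely whatever the joint law of the G_N
    (ginibre_last_row_ae).

    Limit. The Hermite equation says that the zeros x_i of h_N are in
    electrostatic equilibrium: N x_i = sum_(j != i) 2 / (x_i - x_j). Testing this
    against the Chebyshev polynomials U_n(x / 2), whose divided differences
    factor, gives a closed recursion for their averages over the zeros; in the
    limit they vanish for n > 0 (cvg_zero_avg_chebU), as they do under the
    semicircle law (semicircle_mean_chebU). Bernstein approximation passes to
    continuous functions on [-2, 2], which contains the x_i, and the coupling
    transfers the limit to the zeros of q_N (cvg_coupled_zeros). *)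

(** * Spectrum of a matrix close to a Hermitian one *)

Section Frobenius.
Import sesquilinear.
Local Open Scope sesquilinear_scope.
Variables (C : numClosedFieldType) (n : nat).
Implicit Types (A B J U T : 'M[C]_n).

Definition sqnormF A : C := \sum_i \sum_j `|A i j| ^+ 2.

Lemma sqnormF_tr A : sqnormF A = \tr (A *m A ^t*).
Proof.
apply: eq_bigr => i _; rewrite mxE; apply: eq_bigr => j _.
by rewrite !mxE normCK.
Qed.

Lemma sqnormF_tC A : sqnormF (A ^t*) = sqnormF A.
Proof.
rewrite /sqnormF exchange_big; apply: eq_bigr => i _; apply: eq_bigr => j _.
by rewrite !mxE norm_conjC.
Qed.

Lemma sqnormF_unitaryl U A : U \is unitarymx -> sqnormF (U *m A) = sqnormF A.
Proof.
move=> Uu; rewrite !sqnormF_tr trmx_mul map_mxM mulmxA mxtrace_mulC.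
by rewrite !mulmxA -(invmx_unitary Uu) mulVmx ?unitarymx_unit// mul1mx.
Qed.

Lemma sqnormF_unitaryr U A : U \is unitarymx -> sqnormF (A *m U) = sqnormF A.
Proof.
move=> Uu; rewrite -sqnormF_tC trmx_mul map_mxM sqnormF_unitaryl ?sqnormF_tC//.
by rewrite trmxC_unitary.
Qed.

Lemma sqnormFD A B : sqnormF (A + B) <= 2 * (sqnormF A + sqnormF B).
Proof.
rewrite /sqnormF -big_split mulr_sumr; apply: ler_sum => i _.
rewrite -big_split mulr_sumr; apply: ler_sum => j _.
rewrite mxE /=; set a := A i j; set b := B i j.
have -> : 2 * (`|a| ^+ 2 + `|b| ^+ 2) = `|a + b| ^+ 2 + `|a - b| ^+ 2.
  rewrite !normCK !rmorphD !rmorphN /=.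
  by ring.
by rewrite lerDl exprn_ge0.
Qed.

Lemma sqnormFN A : sqnormF (- A) = sqnormF A.
Proof.
by apply: eq_bigr => i _; apply: eq_bigr => j _; rewrite mxE normrN.
Qed.

(** Each strictly lower entry of a triangular [T] reappears in [T - T ^t*] at
    its own place and, conjugated, at the transposed one, where [T] vanishes. *)
Lemma sqnormF_lower_trig T : is_trig_mx T ->
  2 * sqnormF (T - diag_mx (\row_i T i i)) <= sqnormF (T - T ^t*).
Proof.
move=> /is_trig_mxP Ttrig.
set S := T - diag_mx _.
have SE i j : S i j = T i j *+ (i != j).
  rewrite !mxE; case: eqVneq => [->|ij]; first by rewrite mulr1n mulr0n subrr.
  by rewrite mulr0n subr0 mulr1n.
rewrite mulrDl mul1r -{2}sqnormF_tC /sqnormF -big_split; apply: ler_sum => i _.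
rewrite -big_split; apply: ler_sum => j _.
have STE : (S ^t*) i j = (T j i)^* *+ (i != j).
  by rewrite 2!mxE SE eq_sym rmorphMn.
have -> : (T - T ^t*) i j = T i j - (T j i)^* by rewrite !mxE.
rewrite STE SE; case: (ltngtP i j) => [ij|ji|/val_inj ->].
- have -> : i != j by apply: contraTneq ij => ->; rewrite ltnn.
  by rewrite !mulr1n Ttrig// sub0r normrN normr0 expr0n /= add0r.
- have -> : i != j by apply: contraTneq ji => ->; rewrite ltnn.
  by rewrite !mulr1n (Ttrig _ _ ji) conjC0 subr0 normr0 expr0n /= addr0.
- by rewrite eqxx !mulr0n normr0 expr0n /= addr0 exprn_ge0.
Qed.

(** Expresses the transport cost of the weights [`|W i j| ^+ 2] between two
    spectra as a norm, which unitary changes of basis preserve. *)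
Lemma sqnormF_diag_intertwine (z x : 'rV[C]_n) (W : 'M[C]_n) :
  sqnormF (diag_mx z *m W - W *m diag_mx x) =
  \sum_i \sum_j `|W i j| ^+ 2 * `|z 0 i - x 0 j| ^+ 2.
Proof.
apply: eq_bigr => i _; apply: eq_bigr => j _.
rewrite -exprMn -normrM mul_diag_mx mul_mx_diag !mxE.
by congr (`|_| ^+ _); ring.
Qed.

Lemma unitarymx_row_sum (W : 'M[C]_n) i : W \is unitarymx -> \sum_j `|W i j| ^+ 2 = 1.
Proof.
move=> /unitarymxP/matrixP/(_ i i); rewrite !mxE eqxx mulr1n => <-.
by apply: eq_bigr => j _; rewrite !mxE normCK.
Qed.

Lemma unitarymx_col_sum (W : 'M[C]_n) j : W \is unitarymx -> \sum_i `|W i j| ^+ 2 = 1.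
Proof.
rewrite -trmx_unitary => /unitarymx_row_sum => /(_ j) <-.
by apply: eq_bigr => i _; rewrite mxE.
Qed.

Lemma char_poly_unitary_conj U A : U \is unitarymx ->
  char_poly (U *m A *m U ^t*) = char_poly A.
Proof.
move=> Uu; rewrite -(invmx_unitary Uu) /char_poly /char_poly_mx.
have Uun := unitarymx_unit Uu.
set f := @map_mx _ _ _ n n.
have -> : 'X%:M - f (U *m A *m invmx U) =
    f U *m ('X%:M - f A) *m f (invmx U).
  rewrite /f mulmxBr mulmxBl scalar_mxC !map_mxM/=; congr (_ - _).
  by rewrite -mulmxA -map_mxM mulmxV// map_mx1 mulmx1.
rewrite !det_mulmx mulrAC -det_mulmx -map_mxM mulmxV// map_mx1 det1.
by rewrite mul1r.
Qed.

(** Put [B] in Schur form [T = U B U^*] and diagonalise [J] by [V]: the squared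
    moduli of the entries of the unitary matrix [W = U V^*] are doubly stochastic,
    and [diag z W - W diag x] is, up to unitary factors, [B - J] minus the
    off-diagonal part of [T]. That part is controlled by [T - T^*], to which the
    Hermitian [J] does not contribute, hence again by [B - J]. *)
Lemma hermitian_perturbation_coupling (B J : 'M[C]_n) : (0 < n)%N ->
    J = J ^t* ->
  exists z x : 'I_n -> C, exists w : 'I_n -> 'I_n -> C,
   [/\ [/\ char_poly B = \prod_i ('X - (z i)%:P),
        char_poly J = \prod_i ('X - (x i)%:P) &
        forall i, x i \is Num.real],
      [/\ forall i j, 0 <= w i j, forall i, \sum_j w i j = 1 &
        forall j, \sum_i w i j = 1] &
      \sum_i \sum_j w i j * `|z i - x j| ^+ 2 <= 6 * sqnormF (B - J)].
Proof.
move=> n0 Jherm.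
have [U Uu] := Schur B n0.
rewrite /similar_to /= conjymx// => Ttrig; set T := U *m B *m U ^t* in Ttrig.
have Jh : J \is hermsymmx by apply/is_hermitianmxP; rewrite expr0 scale1r.
have /orthomx_spectralP JE := hermitian_normalmx Jh.
set V := spectralmx J in JE; set x := spectral_diag J in JE.
have Vu : V \is unitarymx by exact: spectral_unitarymx.
rewrite invmx_unitary// in JE.
have xr j : x 0 j \is Num.real.
  by have /mxOverP := hermitian_spectral_diag_real Jh; exact.
set z := \row_i T i i; pose W := U *m V ^t*.
have Wu : W \is unitarymx.
  by rewrite /W mul_unitarymx// trmxC_unitary.
exists (z 0), (x 0), (fun i j => `|W i j| ^+ 2); split.
- split=> //.
    rewrite -(char_poly_unitary_conj B Uu) char_poly_trig//.
    by apply: eq_bigr => i _; rewrite [z 0 i]mxE.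
  have -> : J = V ^t* *m diag_mx x *m (V ^t*) ^t* by rewrite trmxCK.
  rewrite char_poly_unitary_conj ?trmxC_unitary// char_poly_trig; last first.
    exact: diag_mx_is_trig.
  by apply: eq_bigr => i _; rewrite !mxE eqxx mulr1n.
- split=> [i j|i|j]; first by rewrite exprn_ge0.
    exact: unitarymx_row_sum.
  exact: unitarymx_col_sum.
rewrite -sqnormF_diag_intertwine.
set E := B - J; set S := T - diag_mx z.
have UU : U ^t* *m U = 1%:M by rewrite -invmx_unitary// mulVmx// unitarymx_unit.
have UU' : U *m U ^t* = 1%:M by exact/unitarymxP.
have VV' : V *m V ^t* = 1%:M by exact/unitarymxP.
(* The off-diagonal part S of T sees only the anti-Hermitian part of E. *)
have Sle : sqnormF S <= 2 * sqnormF E.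
  have : 2 * sqnormF S <= 4 * sqnormF E.
    apply: le_trans (sqnormF_lower_trig Ttrig) _.
    have -> : T - T ^t* = U *m (E - E ^t*) *m U ^t*.
      have -> : E - E ^t* = B - B ^t*.
        rewrite /E linearB /= rmorphB /= -Jherm opprB.
        by rewrite addrA addrNK.
      rewrite mulmxBr mulmxBl /T; congr (_ - _).
      by rewrite !trmx_mul !map_mxM trmxCK mulmxA.
    rewrite sqnormF_unitaryr ?trmxC_unitary// sqnormF_unitaryl//.
    apply: le_trans (sqnormFD _ _) _.
    by rewrite sqnormFN sqnormF_tC; rewrite le_eqVlt; apply/orP; left; apply/eqP; ring.
  by move=> h; rewrite -(ler_pM2l (_ : 0 < 2 :> C))// mulrA -natrM.
have -> : diag_mx z *m W - W *m diag_mx x = (U *m E *m U ^t* - S) *m W.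
  have -> : U *m E *m U ^t* - S = diag_mx z - U *m J *m U ^t*.
    rewrite /E /S mulmxBr mulmxBl -/T.
    by rewrite opprB addrC addrA addrNK.
  rewrite mulmxBl; congr (_ - _).
  rewrite JE /W !mulmxA -(mulmxA _ (U ^t*) U) UU mulmx1.
  by rewrite -(mulmxA _ V) VV' mulmx1.
rewrite sqnormF_unitaryr//; apply: le_trans (sqnormFD _ _) _.
rewrite sqnormFN sqnormF_unitaryr ?trmxC_unitary// sqnormF_unitaryl//.
have -> : 6 * sqnormF E = 2 * (sqnormF E + 2 * sqnormF E) by ring.
by rewrite ler_pM2l// lerD2l.
Qed.

End Frobenius.

(** * Squared modulus and topology of the complex plane *)

Section complex_topology.
Variable R : realType.
Local Notation C := R[i].
Local Notation reC := (@complex.Re R).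
Local Notation imC := (@complex.Im R).

(** The squared modulus as a real number; the norm of the field of complex
    numbers takes its values in the complex numbers. *)
Definition sqnormC (z : C) : R := reC z ^+ 2 + imC z ^+ 2.

Lemma sqnormC_ge0 z : 0 <= sqnormC z.
Proof. by rewrite addr_ge0 ?sqr_ge0. Qed.

Lemma sqnormCE z : `|z| ^+ 2 = (sqnormC z)%:C%C.
Proof.
by rewrite normc_def -rmorphXn /= sqr_sqrtr// sqnormC_ge0.
Qed.

Lemma nbhsC_sqnormP (z : C^o) (A : set C) :
  nbhs z A <-> exists2 e : R, 0 < e & forall y, sqnormC (z - y) < e ^+ 2 -> A y.
Proof.
have normE (y : C) : `|z - y| = (Num.sqrt (sqnormC (z - y)))%:C%C.
  by rewrite normc_def.
split.
  move=> /nbhs_ballP[e /= e0 eA].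
  have ee : e = (reC e)%:C%C.
    by move: e0; rewrite ltcE /=; case: (e) => a b /= /andP[/eqP -> _].
  have Re0 : 0 < reC e by rewrite -ltcR -ee.
  exists (reC e) => // y zy; apply: eA; rewrite -ball_normE /= normE ee ltcR.
  by rewrite -[ltRHS](ger0_norm (ltW Re0)) -sqrtr_sqr ltr_sqrt// exprn_gt0.
move=> [e e0 eA]; apply/nbhs_ballP; exists e%:C%C => /=; first by rewrite ltcR.
move=> y; rewrite -ball_normE /= normE ltcR => zy; apply: eA.
rewrite -(sqr_sqrtr (sqnormC_ge0 _)) ltr_pXn2r ?nnegrE ?sqrtr_ge0//.
exact: ltW.
Qed.

Lemma continuous_reC : continuous (reC : C^o -> R).
Proof.
move=> z A /nbhs_ballP[e /= e0 eA]; apply/nbhsC_sqnormP; exists e => // y zy.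
apply: eA; rewrite /ball /=; move: zy.
case: z => a b; case: y => a' b'; rewrite /sqnormC /= => h.
rewrite -(ltr_pXn2r (n := 2)) ?nnegrE ?normr_ge0// ?ltW// real_normK ?num_real//.
by apply: le_lt_trans h; rewrite lerDl sqr_ge0.
Qed.

Lemma continuous_imC : continuous (imC : C^o -> R).
Proof.
move=> z A /nbhs_ballP[e /= e0 eA]; apply/nbhsC_sqnormP; exists e => // y zy.
apply: eA; rewrite /ball /=; move: zy.
case: z => a b; case: y => a' b'; rewrite /sqnormC /= => h.
rewrite -(ltr_pXn2r (n := 2)) ?nnegrE ?normr_ge0// ?ltW// real_normK ?num_real//.
by apply: le_lt_trans h; rewrite lerDr sqr_ge0.
Qed.

Lemma continuous_comp_real (f : C^o -> R) : continuous f ->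
  continuous (fun x : R => f x%:C%C).
Proof.
move=> cf x0 A /cf /nbhsC_sqnormP[e e0 eA].
apply/nbhs_ballP; exists e => //= y; rewrite /ball /= => xy; apply: eA.
rewrite -rmorphB /sqnormC /= expr0n /= addr0 -real_normK ?num_real//.
by rewrite ltr_pXn2r ?nnegrE// ltW.
Qed.

Lemma continuous_measurable_funC (g : C^o -> R) : continuous g ->
  measurable_fun setT (g : measurableTypeC R -> R).
Proof.
move=> /continuousP cg; apply: (measurability _ (RGenOpens.measurableE R)).
move=> _ [_ [a [b ->] <-]]; rewrite setTI; apply: sub_sigma_algebra.
exact/cg/interval_open.
Qed.

Lemma measurable_reC : measurable_fun setT (reC : measurableTypeC R -> R).
Proof. exact: (continuous_measurable_funC continuous_reC). Qed.

Lemma measurable_imC : measurable_fun setT (imC : measurableTypeC R -> R).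
Proof. exact: (continuous_measurable_funC continuous_imC). Qed.

End complex_topology.

(** * Matrix of multiplication by the variable in a three-term basis *)

Section comrade.
Variables (F : fieldType) (N : nat) (b tau c : nat -> F) (h : nat -> {poly F}).
Hypotheses (N0 : (0 < N)%N) (tau0 : forall m, tau m != 0) (b0 : b 0 = 0).
Hypothesis h0 : h 0 = 1.
Hypothesis hS : forall m, h m.+1 = 'X * h m - b m *: h m.-1.
Hypothesis hsize : forall m, size (h m) = m.+1 /\ h m \is monic.

(** The entries say that [z h_i = h_(i+1) + b_i h_(i-1)], where for the last
    index [h_N] is replaced by [- sum_j c_j h_j]; [tau] rescales the basis. *)
Definition comrade : 'M[F]_N := \matrix_(i, j) (tau j / tau i *
  ((j == i.+1 :> nat)%:R + (j.+1 == i :> nat)%:R * b i - (i.+1 == N :> nat)%:R * c j)).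

Let q := h N + \sum_(j < N) c j *: h j.

Let comrade_row (i : 'I_N) :
  \sum_(j < N) ((j == i.+1 :> nat)%:R + (j.+1 == i :> nat)%:R * b i
     - (i.+1 == N :> nat)%:R * c j) *: h j
  = 'X * h i - (i.+1 == N :> nat)%:R *: q.
Proof.
have e1 (j : 'I_N) : ((j == i.+1 :> nat)%:R + (j.+1 == i :> nat)%:R * b i
     - (i.+1 == N :> nat)%:R * c j) *: h j =
   (if j == i.+1 :> nat then h i.+1 else 0) +
   (if j.+1 == i :> nat then b i *: h i.-1 else 0) -
    (i.+1 == N :> nat)%:R *: (c j *: h j).
  rewrite scalerBl scalerDl scalerA; congr (_ + _ - _).
    by case: eqP => [->|_]; rewrite ?scale1r ?scale0r.
  by case: eqP => [<-|_]; rewrite ?mul1r ?mul0r ?scale0r.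
rewrite (eq_bigr _ (fun j _ => e1 j)) sumrB big_split /= -scaler_sumr.
have -> : \sum_(j < N) (if j.+1 == i :> nat then b i *: h i.-1 else 0) =
    b i *: h i.-1.
  case: i {e1} => -[|i] iN /=; first by rewrite b0 scale0r big1.
  by rewrite -big_mkcond (big_pred1 (Ordinal (ltnW iN))).
have -> : 'X * h i = h i.+1 + b i *: h i.-1 by rewrite hS subrK.
have [iN|iN] := eqVneq i.+1 N.
  rewrite !scale1r big1 => [|j _]; last first.
    by rewrite iN; case: eqP => // jN; have := ltn_ord j; rewrite jN ltnn.
  by rewrite add0r /q {1}iN; move: (b i *: h i.-1) (h N) => u w; ring.
rewrite !scale0r !subr0; congr (_ + _).
have iN' : (i.+1 < N)%N by rewrite ltn_neqAle iN ltn_ord.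
by rewrite -big_mkcond (big_pred1 (Ordinal iN')).
Qed.

Lemma comrade_monic : size q = N.+1 /\ q \is monic.
Proof.
have [sN mN] := hsize N.
have sq : (size (\sum_(j < N) c j *: h j)%R < size (h N))%N.
  rewrite sN ltnS; apply: leq_trans (size_sum _ _ _) _.
  apply/bigmax_leqP => j _; apply: leq_trans (size_scale_leq _ _) _.
  by have [-> _] := hsize j.
by rewrite /q size_polyDl// sN; split=> //; rewrite monicE lead_coefDl// -monicE.
Qed.

(** The vector [v] of the rescaled [h_j] is an eigenvector for the eigenvalue
    'X up to a multiple of [q] in the last coordinate. Multiplying by the adjugate
    of the characteristic matrix and reading the coordinate of [h_0 = 1] shows that
    [q] divides the characteristic polynomial; both are monic of degree [N]. *)
Lemma char_poly_comrade : char_poly comrade = q.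
Proof.
have [sq mq] := comrade_monic.
pose v : 'cV[{poly F}]_N := \col_j ((tau j)^-1 *: h j).
have iN : (N.-1 < N)%N by rewrite prednK.
have Mv : char_poly_mx comrade *m v =
    \col_i (((i.+1 == N :> nat)%:R / tau i) *: q).
  apply/colP => i; rewrite !mxE.
  rewrite (eq_bigr (fun j => (i == j)%:R * ('X * v i 0) - (tau i)^-1 *:
     (((j == i.+1 :> nat)%:R + (j.+1 == i :> nat)%:R * b i
     - (i.+1 == N :> nat)%:R * c j) *: h j))).
    rewrite sumrB -scaler_sumr comrade_row.
    have -> : \sum_j (i == j)%:R * ('X * v i 0) = 'X * v i 0.
      rewrite (bigD1 i)//= eqxx mul1r big1 ?addr0// => j.
      by rewrite eq_sym => /negbTE ->; rewrite mul0r.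
    rewrite !mxE scalerBr scalerA -scalerAr opprB addrCA subrr addr0.
    by rewrite mulrC.
  move=> j _; rewrite !mxE mulrBl; congr (_ - _).
    by case: eqP => [->|_]; rewrite ?mulr1n ?mul1r// mulr0n !mul0r.
  rewrite mul_polyC !scalerA; congr (_ *: _).
  set K := _ + _ - _; have := tau0 j; have := tau0 i.
  by move: (tau i) (tau j) K => x y K x0 y0; field; rewrite x0 y0.
have : char_poly comrade *: v = \adj (char_poly_mx comrade) *m
    (\col_i (((i.+1 == N :> nat)%:R / tau i) *: q)).
  by rewrite -Mv mulmxA mul_adj_mx mul_scalar_mx.
move=> /matrixP/(_ (Ordinal N0) 0); rewrite !mxE h0.
rewrite (bigD1 (Ordinal iN))//= big1 ?addr0; last first.
  move=> j jN; rewrite [X in _ * X]mxE; have -> : (j.+1 == N :> nat) = false.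
    apply/negP => /eqP jN'; move/eqP: jN; apply; apply/val_inj => /=.
    by rewrite -[LHS]/(j.+1.-1) jN'.
  by rewrite mul0r scale0r mulr0.
rewrite [X in _ = _ * X]mxE /= prednK// eqxx mul1r -scalerAr => E.
have dq : q %| char_poly comrade.
  have -> : char_poly comrade = tau 0 *: ((tau 0)^-1 *: (char_poly comrade * 1)).
    by rewrite mulr1 scalerA divff// scale1r.
  by rewrite E dvdpZr// dvdp_mull// dvdpZr// invr_eq0.
have : q %= char_poly comrade by rewrite -dvdp_size_eqp// sq size_char_poly.
by rewrite eqp_monic ?char_poly_monic// => /eqP.
Qed.

End comrade.

(** * The heat operator and Hermite polynomials *)

Section heat_flow.
Variables (R : realType) (N : nat) (t : R[i]).
Local Notation C := R[i].
Implicit Types Q : {poly C}.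

Let c (k : nat) : C := k`!%:R^-1 * (t / (2 * N%:R)) ^+ k.

(** Derivatives beyond the degree vanish, so one truncation serves several
    polynomials at once. *)
Lemma heat_widen Q K : (size Q <= K)%N ->
  heat N t Q = \sum_(k < K.+1) c k *: Q^`(2 * k).
Proof.
move=> QK; set m := (size Q).-1./2.+1.
have mK : (m <= K.+1)%N by rewrite /m; lia.
rewrite /heat -/m -!(big_mkord xpredT (fun k => c k *: Q^`(2 * k))).
rewrite (big_cat_nat _ mK)//= [X in _ + X]big1_seq ?addr0// => k.
rewrite mem_index_iota => /andP[_ /andP[mk _]].
by rewrite derivn_poly0 ?scaler0//; move: mk; rewrite /m; lia.
Qed.

Lemma heatD Q1 Q2 : heat N t (Q1 + Q2) = heat N t Q1 + heat N t Q2.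
Proof.
pose K := maxn (size Q1) (size Q2).
rewrite !(@heat_widen _ K) ?leq_maxl ?leq_maxr ?size_polyD//.
by rewrite -big_split; apply: eq_bigr => k _; rewrite derivnD scalerDr.
Qed.

Lemma heatZ a Q : heat N t (a *: Q) = a *: heat N t Q.
Proof.
rewrite !(@heat_widen _ (size Q)) ?size_scale_leq// scaler_sumr.
by apply: eq_bigr => k _; rewrite derivnZ !scalerA mulrC.
Qed.

Lemma heat0 : heat N t 0 = 0.
Proof. by have := heatZ 0 0; rewrite !scale0r. Qed.

Lemma heat1 : heat N t 1 = 1.
Proof.
rewrite /heat size_poly1 big_ord_recl big_ord0 addr0 /=.
by rewrite invr1 mul1r expr0 scale1r.
Qed.

Lemma heat_sum (I : Type) (r : seq I) (F : I -> {poly C}) :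
  heat N t (\sum_(i <- r) F i) = \sum_(i <- r) heat N t (F i).
Proof. exact: (big_morph _ heatD heat0). Qed.

Lemma heat_deriv Q : (heat N t Q)^`() = heat N t Q^`().
Proof.
have dQ : (size Q^`() <= size Q)%N.
  by have [->|/lt_size_deriv/ltnW//] := eqVneq Q 0; rewrite deriv0.
rewrite !(@heat_widen _ (size Q))// raddf_sum; apply: eq_bigr => k _ /=.
by rewrite derivZ -derivnS derivSn.
Qed.

Lemma derivnMX Q n : ('X * Q)^`(n) = 'X * Q^`(n) + Q^`(n.-1) *+ n.
Proof.
elim: n => [|n IH]; first by rewrite !derivn0 mulr0n addr0.
rewrite derivnS IH derivD derivM derivX mul1r derivMn -!derivnS /=.
case: n {IH} => [|n]; first by rewrite !mulr0n addr0 addrC mulr1n.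
by rewrite -?derivnS /= [in RHS]mulrS addrCA addrA.
Qed.

(** The commutator of the 2k-th derivative with multiplication by 'X is 2k
    times the derivative of order 2k - 1, so that of [exp ((t / 2N) D^2)] with 'X
    is [(t / N) D exp ((t / 2N) D^2)]. *)
Lemma heat_mulX Q :
  heat N t ('X * Q) = 'X * heat N t Q + (t / N%:R) *: (heat N t Q)^`().
Proof.
pose K := (size Q).+1.
have sXQ : (size ('X * Q)%R <= K)%N.
  by rewrite mulrC; have [->|Q0] := eqVneq Q 0; rewrite ?mul0r ?size_poly0// size_mulX.
have dQ : (size Q^`() <= size Q)%N.
  by have [->|/lt_size_deriv/ltnW//] := eqVneq Q 0; rewrite deriv0.
rewrite heat_deriv (heat_widen sXQ) (@heat_widen Q K) ?leqnSn//.
rewrite (@heat_widen Q^`() (size Q))//.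
rewrite mulr_sumr scaler_sumr.
under eq_bigr do rewrite derivnMX scalerDr scalerAr.
rewrite big_split /=; congr (_ + _).
rewrite big_ord_recl muln0 mulr0n scaler0 add0r; apply: eq_bigr => k _.
rewrite lift0; have -> : (2 * k.+1)%N = (2 * k).+2 by lia.
rewrite -derivSn -scaler_nat !scalerA; congr (_ *: _).
rewrite /c factS natrM exprS invfM.
have [->|N0] := eqVneq (N%:R : C) 0; first by rewrite mulr0 invr0 !mulr0 !mul0r mulr0 !mul0r.
have k0 : (k.+1%:R : C) != 0 by rewrite pnatr_eq0.
have -> : ((2 * k).+2%:R : C) = 2 * k.+1%:R by rewrite -natrM mulnS.
have fk0 : (k`!%:R : C) != 0 by rewrite pnatr_eq0 -lt0n fact_gt0.
move: (k.+1%:R) (k`!%:R) (N%:R : C) k0 fk0 N0 => u v n u0 v0 n0.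
by field; rewrite u0 v0 n0.
Qed.

End heat_flow.

Section hermite.
Variables (R : realType) (N : nat).
Local Notation C := R[i].

Definition hermite m : {poly C} := heat N (- 1) 'X^m.

Lemma hermite0 : hermite 0 = 1.
Proof. by rewrite /hermite expr0 heat1. Qed.

Lemma hermite_deriv m : (hermite m.+1)^`() = m.+1%:R *: hermite m.
Proof. by rewrite /hermite heat_deriv derivXn /= -scaler_nat heatZ. Qed.

Lemma hermiteS m :
  hermite m.+1 = 'X * hermite m - (m%:R / N%:R) *: hermite m.-1.
Proof.
rewrite /hermite exprS heat_mulX -/(hermite m); congr (_ + _).
case: m => [|m]; first by rewrite hermite0 derivC scaler0 mul0r scale0r oppr0.
by rewrite hermite_deriv scalerA mulNr mul1r mulNr scaleNr mulrC.
Qed.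

Lemma size_hermite m : size (hermite m) = m.+1 /\ hermite m \is monic.
Proof.
elim/ltn_ind: m => -[|m] IH; first by rewrite hermite0 size_poly1 monic1.
have [sm mm] := IH m (ltnSn _).
have m0 : hermite m != 0 by rewrite -size_poly_eq0 sm.
have sX : size ('X * hermite m)%R = m.+2 by rewrite mulrC size_mulX// sm.
have sZ : (size (- ((m%:R / N%:R) *: hermite m.-1))%R < size ('X * hermite m)%R)%N.
  rewrite sX size_polyN (leq_ltn_trans (size_scale_leq _ _))//.
  case: m IH {sm mm m0 sX} => [|m] IH; first by rewrite hermite0 size_poly1.
  by have [-> _] := IH m (leqW (ltnSn _)).
rewrite hermiteS size_polyDl// sX; split=> //.
by rewrite monicE lead_coefDl// lead_coefM lead_coefX mul1r -monicE.
Qed.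

Lemma heat_hermite (Q : {poly C}) :
  heat N (- 1) Q = \sum_(m < size Q) Q`_m *: hermite m.
Proof.
rewrite -{1}[Q]coefK poly_def heat_sum; apply: eq_bigr => m _.
by rewrite heatZ.
Qed.

(** Two differentiations lower the degree by two, and at a zero of [h_m] the
    recurrence expresses [h_(m-2)] through [h_(m-1)]. *)
Lemma hermite_ode (x : C) m : (0 < N)%N -> root (hermite m) x ->
  ((hermite m)^`()^`()).[x] = N%:R * x * ((hermite m)^`()).[x].
Proof.
move=> N0; have NC : (N%:R : C) != 0 by rewrite pnatr_eq0 -lt0n.
case: m => [|m]; first by rewrite hermite0 (negbTE (root1 _)).
move=> /rootP rx.
have hx : x * (hermite m).[x] = m%:R / N%:R * (hermite m.-1).[x].
  by apply/eqP; rewrite -subr_eq0 -rx hermiteS !hornerE.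
rewrite hermite_deriv.
rewrite derivZ !hornerZ mulrCA; congr (_ * _).
rewrite -mulrA hx mulrA mulrCA divff// mulr1.
case: m {rx hx} => [|m]; first by rewrite hermite0 derivC horner0 mul0r.
by rewrite hermite_deriv hornerZ.
Qed.

(** A common zero of two consecutive polynomials would descend along the
    recurrence to a zero of [h_0 = 1]. Since [h_(m+1)'] is a multiple of [h_m],
    the zeros are simple. *)
Lemma hermite_simple_root (x : C) m : (0 < N)%N ->
  root (hermite m.+1) x -> ~~ root (hermite m) x.
Proof.
move=> N0; have NC : (N%:R : C) != 0 by rewrite pnatr_eq0 -lt0n.
elim: m => [|m IH] r1; first by rewrite hermite0 root1.
apply/negP => r2; move: (r1); rewrite hermiteS /root !hornerE.
rewrite (rootP r2) mulr0 sub0r oppr_eq0 !mulf_eq0 invr_eq0 (negbTE NC).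
by rewrite pnatr_eq0 /= -/(root _ _) (negbTE (IH r2)).
Qed.

(** For [m <= N] and [|x| >= 2], the recurrence gives
    [|h_(m+1)| >= 2 |h_m| - |h_(m-1)|], so the moduli increase from [h_0 = 1]. *)
Lemma hermite_root_norm (x : C) : (0 < N)%N -> 2 <= `|x| ->
  ~~ root (hermite N) x.
Proof.
move=> N0 x2; have NC : (0 : C) < N%:R by rewrite ltr0n.
have grow m : (m <= N)%N ->
    `|(hermite m.-1).[x]| <= `|(hermite m).[x]| /\ 1 <= `|(hermite m).[x]|.
  elim: m => [|m IH] mN; first by rewrite hermite0 hornerC normr1.
  have [h1 h2] := IH (ltnW mN).
  suff h : `|(hermite m).[x]| <= `|(hermite m.+1).[x]|.
    by split => //; exact: le_trans h2 h.
  rewrite hermiteS !hornerE.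
  apply: le_trans (lerB_normD _ _); rewrite normrN !normrM.
  have {h1} h1 : `|m%:R / N%:R : C| * `|(hermite m.-1).[x]| <= `|(hermite m).[x]|.
    apply: le_trans h1; rewrite ler_piMl// ger0_norm ?divr_ge0 ?ler0n//.
    by rewrite ler_pdivrMr// mul1r ler_nat ltnW.
  rewrite lerBrDr -(normrM m%:R); apply: le_trans (lerD (lexx _) h1) _.
  by rewrite -mulr2n -mulr_natl ler_wpM2r.
have [_ h] := grow N (leqnn N).
apply/negP => /rootP r0; move: h; rewrite r0 normr0.
by rewrite real_leNgt ?real0 ?real1// ltr01.
Qed.

End hermite.

(** * Coupling the zeros with the Hermite zeros *)

Section weights.
Variable R : realType.

(** The term of index [l.+1] is at most the telescoping difference
    [s / (1 + s l) - s / (1 + s (l + 1))]. *)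
Lemma sum_sqr_slope_le (s : R) n : 0 <= s ->
  \sum_(l < n) (s / (1 + s * l%:R)) ^+ 2 <= s ^+ 2 + s.
Proof.
move=> s0; case: n => [|n].
  by rewrite big_ord0 addr_ge0 ?sqr_ge0.
suff : \sum_(l < n.+1) (s / (1 + s * l%:R)) ^+ 2 <= s ^+ 2 + s - s / (1 + s * n%:R).
  move/le_trans; apply; rewrite gerBl divr_ge0// addr_ge0// mulr_ge0//.
elim: n => [|n IH].
  by rewrite big_ord1 /= mulr0 addr0 divr1 addrK.
rewrite big_ord_recr /=; apply: le_trans (lerD IH (lexx _)) _.
rewrite -lerBrDl.
have -> : s ^+ 2 + s - s / (1 + s * n.+1%:R) - (s ^+ 2 + s - s / (1 + s * n%:R)) =
    s / (1 + s * n%:R) - s / (1 + s * n.+1%:R) by ring.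
have a0 : 0 < 1 + s * n%:R by rewrite ltr_pwDl// mulr_ge0.
have ab : 1 + s * n.+1%:R = (1 + s * n%:R) + s by rewrite -natr1; ring.
have b0 : 0 < 1 + s * n.+1%:R by rewrite ltr_pwDl// mulr_ge0.
move: (1 + s * n%:R) (1 + s * n.+1%:R) a0 b0 ab => a b a0 b0 ->.
have b0' : 0 < a + s by rewrite ltr_wpDr.
have -> : s / a - s / (a + s) = s ^+ 2 / (a * (a + s)).
  by field; rewrite !gt_eqF.
rewrite expr_div_n ler_wpM2l ?sqr_ge0// lef_pV2 ?posrE ?mulr_gt0 ?exprn_gt0//.
by rewrite expr2 ler_wpM2r ?(ltW b0')// lerDl.
Qed.

End weights.

Section hermite_coupling.
Variables (R : realType) (N : nat) (s : R) (c : nat -> R[i]).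
Hypotheses (N0 : (0 < N)%N) (s0 : 0 <= s).
Local Notation C := R[i].

(* rho m is the norm of h_m, which makes J symmetric; w m damps the entry of the
   last row in column m, and changes slowly enough to keep B close to J. *)
Let rho (m : nat) : R := Num.sqrt (m`!%:R / N%:R ^+ m).
Let w (m : nat) : R := (1 + s * (N.-1 - m)%:R)^-1.
Let b (m : nat) : C := m%:R / N%:R.

Let NR : (0 : R) < N%:R. Proof. by rewrite ltr0n. Qed.

Let rho_gt0 m : 0 < rho m.
Proof. by rewrite sqrtr_gt0 divr_gt0 ?exprn_gt0// ltr0n fact_gt0. Qed.

Let rhoS m : rho m.+1 ^+ 2 = rho m ^+ 2 * (m.+1%:R / N%:R).
Proof.
rewrite !sqr_sqrtr ?divr_ge0 ?exprn_ge0 ?ler0n// factS natrM exprS.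
by rewrite invfM; ring.
Qed.

Let w_gt0 m : 0 < w m.
Proof. by rewrite invr_gt0 ltr_pwDl// mulr_ge0. Qed.

(** The squared norm of the perturbation [c] in the last row of [B]. *)
Definition last_row_norm : R :=
  \sum_(j < N) sqnormC (c j) *
    ((j`!%:R / N%:R ^+ j) / (N.-1`!%:R / N%:R ^+ N.-1) *
     (1 + s * (N.-1 - j)%:R) ^- 2).

Let tauJ m : C := (rho m)%:C%C.
Let tauB m : C := (rho m * w m)%:C%C.
Let J := comrade N b tauJ (fun=> 0).
Let B := comrade N b tauB c.

Let entry (i j : nat) : R := (j == i.+1)%:R + (j.+1 == i)%:R * (i%:R / N%:R).

Let JE i j : J i j = (rho j / rho i * entry i j)%:C%C.
Proof.
rewrite mxE mulr0 subr0 /entry /tauJ /b !(rmorphM, rmorphD, fmorphV, rmorph_nat)//.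
Qed.

Let BE i j : B i j = (rho j / rho i * entry i j)%:C%C * (w j / w i)%:C%C
  - (i.+1 == N :> nat)%:R * c j * (rho j / rho i * (w j / w i))%:C%C.
Proof.
rewrite mxE /entry /tauB /b !(rmorphM, rmorphD, fmorphV, rmorph_nat).
by rewrite invfM; ring.
Qed.

Let entry_sym i j : rho j / rho i * entry i j = rho i / rho j * entry j i.
Proof.
wlog ij : i j / (i <= j)%N => [h|].
  by case: (leqP i j) => [/h//|/ltnW/h].
rewrite /entry.
have -> : (j.+1 == i) = false by lia.
have -> : (i == j.+1) = false by lia.
rewrite mul0r addr0 add0r [i.+1 == j]eq_sym; case: eqP => [->|_]; last by rewrite mul0r !mulr0.
rewrite mulr1 mul1r; have := rhoS i; have := rho_gt0 i; have := rho_gt0 i.+1.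
move=> r1 r0 e.
by apply: (mulIf (lt0r_neq0 r1)); rewrite mulrAC -expr2 e; field; rewrite !gt_eqF.
Qed.

Let g l := (s / (1 + s * l%:R)) ^+ 2.

(* This is where m <= N enters: the Jacobi matrix has entries at most 1. *)
Let sqr_entry_super i : (i.+1 < N)%N ->
  (rho i.+1 / rho i * entry i i.+1) ^+ 2 <= 1.
Proof.
move=> iN; rewrite /entry eqxx (_ : (i.+2 == i) = false); last by lia.
rewrite mul0r addr0 mulr1 expr_div_n rhoS mulrC mulrA mulVf ?mul1r.
  by rewrite ler_pdivrMr// mul1r ler_nat ltnW.
by rewrite sqrf_eq0 gt_eqF.
Qed.

Let tri_le (i j : 'I_N) :
  (rho j / rho i * entry i j * (w j / w i - 1)) ^+ 2 <=
  ((j == i.+1 :> nat)%:R + (j.+1 == i :> nat)%:R) * g (N.-1 - j).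
Proof.
have iN := ltn_ord i; have jN := ltn_ord j.
have g0 l : 0 <= g l by exact: sqr_ge0.
have pos l : 0 < 1 + s * l%:R by rewrite ltr_pwDl// mulr_ge0.
case: (eqVneq (j : nat) i.+1) => [ji|ji].
  rewrite (_ : (j.+1 == i :> nat) = false); last by lia.
  rewrite addr0 mul1r exprMn ji.
  apply: le_trans (ler_wpM2r (sqr_ge0 _) (sqr_entry_super _)) _; first by lia.
  rewrite mul1r /g /w invrK; have -> : (N.-1 - i = (N.-1 - i.+1).+1)%N by lia.
  move: (N.-1 - i.+1)%N => l; have l0 := pos l.
  rewrite le_eqVlt; apply/orP; left; apply/eqP; congr (_ ^+ 2).
  by rewrite -natr1; field; rewrite gt_eqF.
case: (eqVneq j.+1 (i : nat)) => [ji'|ji'].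
  rewrite add0r mul1r exprMn entry_sym -ji'.
  apply: le_trans (ler_wpM2r (sqr_ge0 _) (sqr_entry_super _)) _; first by lia.
  rewrite mul1r /g /w invrK; have -> : (N.-1 - j = (N.-1 - j.+1).+1)%N by lia.
  move: (N.-1 - j.+1)%N => l; have l0 := pos l.+1.
  rewrite le_eqVlt; apply/orP; left; apply/eqP.
  rewrite -[RHS]sqrrN; congr (_ ^+ 2).
  move: l0; rewrite -natr1 => l0.
  by field; rewrite gt_eqF.
rewrite addr0 mul0r /entry (negbTE ji) (negbTE ji') mul0r addr0 mulr0 mul0r.
by rewrite expr0n.
Qed.

Let tri_norm_le : \sum_i \sum_j
  (rho (j : 'I_N) / rho (i : 'I_N) * entry i j * (w j / w i - 1)) ^+ 2 <= 2 * (s ^+ 2 + s).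
Proof.
apply: le_trans (ler_sum _ (fun i _ => ler_sum _ (fun j _ => tri_le i j))) _.
rewrite exchange_big /=.
apply: (@le_trans _ _ (\sum_(j < N) 2 * g (N.-1 - j))).
  apply: ler_sum => j _; rewrite -mulr_suml ler_wpM2r ?sqr_ge0//.
  rewrite big_split /= (_ : 2 = 1 + 1 :> R)//; apply: lerD.
    rewrite (eq_bigr (fun i : 'I_N => if j == i.+1 :> nat then 1 else 0)); last first.
      by move=> i _; case: eqP.
    rewrite -big_mkcond sumr_const -[leRHS]/(1%:R) ler_nat.
    apply/card_le1P => i1 i1P i2; rewrite !unfold_in in i1P *.
    by apply/idP/eqP => [i2P|->//]; apply/val_inj; move: i1P i2P => /= /eqP -> /eqP [].
  rewrite (eq_bigr (fun i : 'I_N => if j.+1 == i :> nat then 1 else 0)); last first.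
    by move=> i _; case: eqP.
  rewrite -big_mkcond sumr_const -[leRHS]/(1%:R) ler_nat.
  apply/card_le1P => i1 i1P i2; rewrite !unfold_in in i1P *.
  by apply/idP/eqP => [i2P|->//]; apply/val_inj; move: i1P i2P => /= /eqP -> /eqP [].
rewrite -mulr_sumr ler_wpM2l//.
rewrite (reindex_inj rev_ord_inj) /=.
apply: le_trans (sum_sqr_slope_le N s0).
apply: ler_sum => l _; rewrite (_ : (N.-1 - (N - l.+1) = l)%N)//.
by have := ltn_ord l; lia.
Qed.

(** The matrices [B] and [J] differ by the effect of the weights on the two
    off-diagonals, of squared norm at most [2 (s^2 + s)], and by the last row. The
    constant 12 is the 6 of the perturbation bound times the 2 lost in splitting
    the square of a sum. *)
Lemma hermite_coupling (q := hermite R N N + \sum_(j < N) c j *: hermite R N j) :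
  exists (z : 'I_N -> C) (x : 'I_N -> R) (p : 'I_N -> 'I_N -> R),
   [/\ q = \prod_i ('X - (z i)%:P),
       hermite R N N = \prod_i ('X - (x i)%:C%C%:P),
       [/\ forall i j, 0 <= p i j, forall i, \sum_j p i j = 1 &
           forall j, \sum_i p i j = 1] &
      \sum_i \sum_j p i j * sqnormC (z i - (x j)%:C%C) <=
        12 * (2 * (s ^+ 2 + s) + last_row_norm)].
Proof.
have b00 : b 0 = 0 by rewrite /b mul0r.
have tau0J m : tauJ m != 0.
  by rewrite /tauJ eq_complex /= eqxx andbT gt_eqF.
have tau0B m : tauB m != 0.
  by rewrite /tauB eq_complex /= eqxx andbT gt_eqF// mulr_gt0.
have cB : char_poly B = q.
  exact: (char_poly_comrade c N0 tau0B b00 (hermite0 R N) (@hermiteS R N)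
    (@size_hermite R N)).
have cJ : char_poly J = hermite R N N.
  rewrite (char_poly_comrade (fun=> 0) N0 tau0J b00 (hermite0 R N) (@hermiteS R N)
    (@size_hermite R N)).
  by rewrite big1 ?addr0// => j _; rewrite scale0r.
have realC (y : R) : y%:C%C \is Num.real.
  by rewrite realE !lecE /= eqxx /= le_total.
have Jherm : J = map_mx Num.conj (J^T).
  apply/matrixP => i j; rewrite [RHS]mxE [J^T i j]mxE !JE (conj_Creal (realC _)).
  by rewrite entry_sym.
have [z [x [p [[zP xP xr] [p0 p1 p2] zx]]]] :=
  hermitian_perturbation_coupling B N0 Jherm.
have xE j : x j = (complex.Re (x j))%:C%C by rewrite RRe_real.
have pE i j : p i j = (complex.Re (p i j))%:C%C by rewrite RRe_real// ger0_real.
exists z, (fun j => complex.Re (x j)), (fun i j => complex.Re (p i j)); split.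
- by rewrite -cB.
- by rewrite -cJ xP; apply: eq_bigr => i _; rewrite -xE.
- split=> [i j|i|j].
  + by have := p0 i j; rewrite pE lecR.
  + by have := p1 i; under eq_bigr do rewrite pE; rewrite -rmorph_sum => -[].
  + by have := p2 j; under eq_bigr do rewrite pE; rewrite -rmorph_sum => -[].
have sqF : sqnormF (B - J) = (\sum_i \sum_j sqnormC ((B - J) i j))%:C%C.
  rewrite /sqnormF rmorph_sum; apply: eq_bigr => i _.
  by rewrite rmorph_sum; apply: eq_bigr => j _; rewrite sqnormCE.
move: zx; rewrite sqF (_ : 6 = (6 : R)%:C%C); last by rewrite rmorph_nat.
rewrite -rmorphM /=.
rewrite (eq_bigr (fun i => (\sum_j complex.Re (p i j) *
    sqnormC (z i - (complex.Re (x j))%:C%C))%:C%C)) => [|i _]; last first.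
  rewrite rmorph_sum; apply: eq_bigr => j _.
  by rewrite sqnormCE {1}pE {1}xE -rmorphM.
rewrite -rmorph_sum lecR => /le_trans; apply.
rewrite (_ : 12 = 6 * 2 :> R); last by ring.
rewrite -mulrA ler_wpM2l//.
pose X (i j : 'I_N) : R := rho j / rho i * entry i j * (w j / w i - 1).
pose Y (i j : 'I_N) : R := rho j / rho i * (w j / w i).
apply: (@le_trans _ _ (\sum_i \sum_j 2 * (X i j ^+ 2 +
   (i.+1 == N :> nat)%:R * (sqnormC (c j) * Y i j ^+ 2)))).
  apply: ler_sum => i _; apply: ler_sum => j _.
  have -> : (B - J) i j = (X i j)%:C%C - (i.+1 == N :> nat)%:R * c j * (Y i j)%:C%C.
    have -> : (B - J) i j = B i j - J i j by rewrite !mxE.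
    by rewrite BE JE /X /Y !(rmorphM, rmorphB, rmorph1); ring.
  case: (i.+1 == N); case: (c j) => a a'; rewrite /sqnormC /=.
    by have := sqr_ge0 (X i j + a * Y i j); have := sqr_ge0 (a' * Y i j); nra.
  by have := sqr_ge0 (X i j); nra.
under eq_bigr do rewrite -mulr_sumr.
rewrite -mulr_sumr ler_wpM2l//.
under eq_bigr do rewrite big_split.
rewrite big_split /=; apply: lerD; first exact: tri_norm_le.
have iN : (N.-1 < N)%N by rewrite prednK.
rewrite (bigD1 (Ordinal iN))//= [X in _ + X]big1 ?addr0; last first.
  move=> i iN'; rewrite big1// => j _; rewrite (_ : (i.+1 == N) = false) ?mul0r//.
  apply/negP => /eqP iN2; move/eqP: iN'; apply; apply/val_inj => /=.
  by rewrite -[LHS]/(i.+1.-1) iN2.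
rewrite prednK// eqxx; apply: ler_sum => j _; rewrite mul1r.
rewrite /Y /= [w N.-1]/w subnn mulr0 addr0 invr1 divr1.
rewrite le_eqVlt; apply/orP; left; apply/eqP; congr (_ * _).
rewrite exprMn expr_div_n !sqr_sqrtr ?divr_ge0 ?exprn_ge0 ?ler0n//.
by rewrite exprVn.
Qed.

End hermite_coupling.

(** * Zeros in electrostatic equilibrium *)

Section log_derivative.
Variable F : fieldType.

Lemma deriv_prod_XsubC (I : eqType) (r : seq I) (x : I -> F) (y : F) :
    (forall j, j \in r -> y != x j) ->
  (\prod_(j <- r) ('X - (x j)%:P))^`().[y] =
  (\prod_(j <- r) ('X - (x j)%:P)).[y] * \sum_(j <- r) (y - x j)^-1.
Proof.
elim: r => [|j r IH] xr; first by rewrite !big_nil derivC hornerC mulr0.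
rewrite !big_cons derivM derivXsubC mul1r hornerD !hornerM IH => [|k kr]; last first.
  by apply: xr; rewrite in_cons kr orbT.
rewrite hornerXsubC mulrDr.
have yj : y - x j != 0 by rewrite subr_eq0; apply: xr; rewrite in_cons eqxx.
rewrite [_ * (y - x j)^-1]mulrAC divff// mul1r; congr (_ + _).
by rewrite mulrA.
Qed.

(** With [h = ('X - x_i) g], one has [h'(x_i) = g(x_i)] and
    [h''(x_i) = 2 g'(x_i)], and the logarithmic derivative of [g] is the sum of
    the [(x_i - x_j)^-1]. *)
Lemma ode_equilibrium n (x : 'I_n -> F) (N : F) (h := \prod_j ('X - (x j)%:P)) :
    injective x -> (forall i, h^`()^`().[x i] = N * x i * h^`().[x i]) ->
  forall i, N * x i = \sum_(j | j != i) 2 / (x i - x j).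
Proof.
move=> xinj ode i.
pose g := \prod_(j | j != i) ('X - (x j)%:P).
have hE : h = ('X - (x i)%:P) * g by rewrite /h (bigD1 i).
have := ode i; rewrite hE derivM derivXsubC mul1r derivD derivM derivXsubC mul1r.
rewrite !(hornerD, hornerM, hornerN, hornerX, hornerC) subrr !mul0r !addr0.
have xij j : j != i -> x i != x j by apply: contraNneq => /xinj ->.
have gi : g.[x i] != 0.
  rewrite /g horner_prod prodf_seq_neq0; apply/allP => j _; apply/implyP => ji.
  by rewrite hornerXsubC subr_eq0 xij.
have -> : g^`().[x i] = g.[x i] * \sum_(j | j != i) (x i - x j)^-1.
  rewrite /g -[\prod_(j | j != i) _]big_filter deriv_prod_XsubC ?big_filter// => j.
  by rewrite mem_filter => /andP[ji _]; exact: xij.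
by move=> e; apply: (mulIf gi); rewrite -e -mulr_sumr; ring.
Qed.

(** Multiply the equilibrium equations by [f (x_i)], sum over [i], and
    symmetrise the double sum in [i] and [j]. *)
Lemma equilibrium_divided_difference n (x : 'I_n -> F) (N : F) (f : F -> F) :
    injective x -> 2 != 0 :> F ->
    (forall i, N * x i = \sum_(j | j != i) 2 / (x i - x j)) ->
  N * (\sum_i x i * f (x i)) =
  \sum_i \sum_(j | j != i) (f (x i) - f (x j)) / (x i - x j).
Proof.
move=> xinj two eqx.
have eqf : N * (\sum_i x i * f (x i)) =
    \sum_i \sum_(j | j != i) 2 / (x i - x j) * f (x i).
  rewrite mulr_sumr; apply: eq_bigr => i _.
  by rewrite mulrA eqx mulr_suml.
pose S := \sum_i \sum_(j | j != i) (x i - x j)^-1 * f (x i).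
have SE : \sum_i \sum_(j | j != i) 2 / (x i - x j) * f (x i) = S + S.
  have -> : S + S = 2 * S by ring.
  rewrite /S mulr_sumr; apply: eq_bigr => i _.
  by rewrite mulr_sumr; apply: eq_bigr => j _; rewrite mulrA.
have SN : S = - \sum_i \sum_(j | j != i) (x i - x j)^-1 * f (x j).
  rewrite /S (exchange_big_dep xpredT) //= -sumrN; apply: eq_bigr => i _.
  rewrite -sumrN; apply: eq_big => [j|j _]; first by rewrite eq_sym.
  by rewrite -mulNr -invrN opprB.
rewrite eqf SE {2}SN -sumrB; apply: eq_bigr => i _.
by rewrite -sumrB; apply: eq_bigr => j _; rewrite mulrBl ![_ / _]mulrC.
Qed.

End log_derivative.

(** * Chebyshev averages over equilibrium zeros *)

Section chebyshev.
Variable F : comNzRingType.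

(** The pair of the values at [x / 2] of the Chebyshev polynomials of the second
    kind U_n and U_(n-1), which makes the three-term recurrence structural. The
    argument [x / 2] gives monic polynomials adapted to the interval [-2, 2]. *)
Fixpoint chebU2 (n : nat) (x : F) : F * F :=
  if n is m.+1 then let u := chebU2 m x in (x * u.1 - u.2, u.1) else (1, 0).

Definition chebU n x := (chebU2 n x).1.

Arguments chebU : simpl never.

Lemma chebU0 x : chebU 0 x = 1. Proof. by []. Qed.
Lemma chebU1 x : chebU 1 x = x. Proof. by rewrite /chebU /= mulr1 subr0. Qed.
Lemma chebUSS n x : chebU n.+2 x = x * chebU n.+1 x - chebU n x.
Proof. by []. Qed.

(** The divided difference is a sum of products separating [x] from [y], so
    that its double sum over the zeros factors into averages. *)
Lemma chebU_divided_difference n x y : chebU n x - chebU n y =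
  (x - y) * \sum_(a < n) chebU a x * chebU (n.-1 - a) y.
Proof.
suff [] : chebU n x - chebU n y =
    (x - y) * \sum_(a < n) chebU a x * chebU (n.-1 - a) y /\
  chebU n.+1 x - chebU n.+1 y =
    (x - y) * \sum_(a < n.+1) chebU a x * chebU (n - a) y by [].
elim: n => [|n [IH0 IH1]].
  split; first by rewrite big_ord0 mulr0 subrr.
  by rewrite big_ord1 !chebU1 -[_ * chebU _ y]/(1 * 1) !mulr1.
split; first exact: IH1.
have -> : chebU n.+2 x - chebU n.+2 y = x * (chebU n.+1 x - chebU n.+1 y)
    + (x - y) * chebU n.+1 y - (chebU n x - chebU n y) by rewrite !chebUSS; ring.
rewrite IH1 IH0 mulrCA -mulrDr -mulrBr; congr (_ * _).
rewrite [RHS]big_ord_recl /= chebU0 mul1r subn0 [RHS]addrC.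
rewrite addrAC; congr (_ + _).
rewrite big_ord_recl /= chebU0 mul1r subn0 mulrDr.
rewrite [in RHS]big_ord_recl /= /bump /= addn0 chebU1 subSS subn0.
rewrite -addrA; congr (_ + _).
rewrite mulr_sumr -sumrB; apply: eq_bigr => a _.
rewrite /bump /= !add1n chebUSS.
have -> : (n.+1 - a.+2 = n - a.+1)%N by lia.
have -> : (n.-1 - a = n - a.+1)%N by lia.
by ring.
Qed.

End chebyshev.

Section chebyshev_bounds.
Variable R : realType.
Implicit Type x : R.

Lemma chebU_bound n x : `|x| <= 2 -> `|chebU n x| <= 3 ^+ n.
Proof.
move=> x2; suff [] : `|chebU n x| <= 3 ^+ n /\ `|chebU n.+1 x| <= 3 ^+ n.+1 by [].
elim: n => [|n [IH0 IH1]].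
  rewrite chebU0 chebU1 normr1 expr0 expr1; split=> //.
  by apply: le_trans x2 _; rewrite ler_nat.
split=> //; rewrite chebUSS; apply: le_trans (ler_normB _ _) _; rewrite normrM.
have : `|x| * `|chebU n.+1 x| <= 2 * 3 ^+ n.+1 by rewrite ler_pM.
have p : (0 : R) <= 3 ^+ n by rewrite exprn_ge0.
by move: IH0; rewrite !exprS; move: (3 ^+ n) p => t; lra.
Qed.

(** The moments of [x ^ k * U_n(x / 2)] under the semicircle law: since
    [x U_n = U_(n+1) + U_(n-1)], they follow from the case [k = 0]. *)
Fixpoint sc_moment (k n : nat) : R :=
  if k is k'.+1 then
    sc_moment k' n.+1 + (if n is n'.+1 then sc_moment k' n' else 0)
  else (n == 0)%:R.

Lemma chebU_mulX n x : x * chebU n x =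
  chebU n.+1 x + (if n is n'.+1 then chebU n' x else 0).
Proof.
by case: n => [|n]; rewrite ?chebUSS ?subrK// chebU1 chebU0 mulr1 addr0.
Qed.

End chebyshev_bounds.

Lemma cvg_sumR (R : realType) (K : finType) (f : K -> nat -> R) (l : K -> R) :
  (forall k, f k N @[N --> \oo] --> l k) ->
  \sum_k f k N @[N --> \oo] --> \sum_k l k.
Proof.
move=> fl; apply: (@cvg_big R^o K +%R 0 xpredT) => //.
exact: (@add_continuous R^o).
Qed.

Section equilibrium_limit.
Variables (R : realType) (r : forall N : nat, 'I_N -> R).
Hypothesis rinj : forall N, injective (@r N).
Hypothesis r2 : forall N i, `|@r N i| <= 2.
Hypothesis req : forall N (i : 'I_N),
  N%:R * @r N i = \sum_(j | j != i) 2 / (@r N i - @r N j).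

Definition zero_avg (f : R -> R) (N : nat) : R := N%:R^-1 * \sum_i f (@r N i).

(* The diagonal of the double sum, where the divided difference is U_n'. *)
Let err n N : R := (N%:R ^+ 2)^-1 *
  \sum_(i < N) \sum_(a < n) chebU a (r i) * chebU (n.-1 - a) (r i).

Let cvg_err n : err n N @[N --> \oo] --> (0 : R).
Proof.
(* Each of the N diagonal terms is at most n 3^n, and N^-1 <= 2 / (N + 1). *)
pose c : R := 2 * (n%:R * 3 ^+ n).
have cvgc : (c * harmonic N) @[N --> \oo] --> (0 : R).
  rewrite -(mulr0 c); apply: cvgM; first exact: cvg_cst.
  exact: cvg_harmonic.
apply: norm_cvg0; apply: (squeeze_cvgr _ _ cvgc); last exact: (@cvg_cst R 0).
near=> N; have N0 : (0 < N)%N by near: N; exists 1.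
rewrite normr_ge0 /= /err normrM.
have -> : `|(N%:R ^+ 2)^-1 : R| = N%:R^-1 * N%:R^-1.
  by rewrite ger0_norm ?invr_ge0 ?exprn_ge0// expr2 invfM.
have NR : (0 : R) < N%:R by rewrite ltr0n.
have S : `|\sum_(i < N) \sum_(a < n) chebU a (r i) * chebU (n.-1 - a) (r i)| <=
    N%:R * (n%:R * 3 ^+ n).
  apply: le_trans (ler_norm_sum _ _ _) _.
  rewrite -[N in N%:R]card_ord -sum1_card natr_sum mulr_suml; apply: ler_sum => i _.
  rewrite mul1r; apply: le_trans (ler_norm_sum _ _ _) _.
  rewrite -[n in n%:R]card_ord -sum1_card natr_sum mulr_suml; apply: ler_sum => a _.
  rewrite mul1r normrM; apply: (@le_trans _ _ (3 ^+ a * 3 ^+ (n.-1 - a))).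
    by rewrite ler_pM ?chebU_bound.
  by rewrite -exprD ler_weXn2l ?ler1n//; have := ltn_ord a; lia.
apply: le_trans (ler_wpM2l _ S) _; first by rewrite mulr_ge0 ?invr_ge0 ?ltW.
set K := n%:R * 3 ^+ n; have K0 : 0 <= K by rewrite mulr_ge0 ?exprn_ge0.
have -> : N%:R^-1 * N%:R^-1 * (N%:R * K) = N%:R^-1 * K.
  by field; rewrite gt_eqF.
have -> : c * harmonic N = (2 / N.+1%:R) * K by rewrite /c -/K /harmonic /=; ring.
rewrite ler_wpM2r// ler_pdivlMr ?ltr0n// mulrC ler_pdivrMr//.
by rewrite -natrM ler_nat; lia.
Unshelve. all: by end_near. Qed.

(* The sum over i != j of the divided differences of U_n is the full double sum,
   which factors, minus its diagonal. *)
Let avg_rec n N : (0 < N)%N ->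
  zero_avg (chebU n.+1) N =
  \sum_(a < n) zero_avg (chebU a) N * zero_avg (chebU (n.-1 - a)) N
  - err n N - (if n is n'.+1 then zero_avg (chebU n') N else 0).
Proof.
move=> N0; have NR : N%:R != 0 :> R by rewrite pnatr_eq0 -lt0n.
have /= := equilibrium_divided_difference (chebU n) (@rinj N) _ (@req N).
rewrite pnatr_eq0 => /(_ isT) eqU.
have lhs : \sum_i @r N i * chebU n (@r N i) = \sum_i chebU n.+1 (@r N i) +
    (if n is n'.+1 then \sum_i chebU n' (@r N i) else 0).
  under eq_bigr do rewrite chebU_mulX; rewrite big_split; congr (_ + _).
  by case: (n) => [|n'] //; rewrite big1.
have rhs : \sum_i \sum_(j | j != i) (chebU n (@r N i) - chebU n (r j)) / (r i - r j) =
   \sum_(a < n) (\sum_i chebU a (@r N i)) * (\sum_i chebU (n.-1 - a) (@r N i))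
   - \sum_(i < N) \sum_(a < n) chebU a (r i) * chebU (n.-1 - a) (r i).
  under [X in X - _]eq_bigr do rewrite big_distrlr.
  rewrite exchange_big /=.
  under [X in X - _]eq_bigr do rewrite exchange_big /=.
  rewrite -sumrB; apply: eq_bigr => i _; rewrite [X in _ = X - _](bigD1 i)//= addrAC subrr add0r.
  apply: eq_bigr => j ji; rewrite chebU_divided_difference mulrC mulrA mulVf ?mul1r//.
  by rewrite subr_eq0; apply: contraNneq ji => /rinj ->.
move: eqU; rewrite lhs rhs.
rewrite /zero_avg /err => e.
have -> : \sum_(a < n) N%:R^-1 * (\sum_i chebU a (@r N i)) *
    (N%:R^-1 * \sum_i chebU (n.-1 - a) (@r N i)) = (N%:R ^+ 2)^-1 *
   \sum_(a < n) (\sum_i chebU a (@r N i)) * (\sum_i chebU (n.-1 - a) (@r N i)).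
  by rewrite mulr_sumr; apply: eq_bigr => a _; rewrite expr2 invfM mulrACA.
rewrite -mulrBr -e.
case: (n) => [|n'].
  by rewrite addr0 subr0; field.
by field.
Qed.

(** In the limit the averages satisfy
    [m_(n+1) = sum_(a < n) m_a m_(n-1-a) - m_(n-1)] with [m_0 = 1]. If the earlier
    ones vanish except [m_0], the sum reduces to [m_0 m_(n-1)], which cancels the
    last term. *)
Lemma cvg_zero_avg_chebU n : zero_avg (chebU n) N @[N --> \oo] --> ((n == 0)%:R : R).
Proof.
elim/ltn_ind: n => -[_|n IH].
  apply: (@cvg_trans _ ((fun=> 1 : R) @ \oo)); last exact: cvg_cst.
  apply: near_eq_cvg; near=> N; have N0 : (0 < N)%N by near: N; exists 1.
  rewrite /zero_avg (eq_bigr (fun=> 1)) ?sumr_const ?card_ord//.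
  by rewrite mulVf// pnatr_eq0 -lt0n.
apply: (@cvg_trans _ ((fun N => \sum_(a < n) zero_avg (chebU a) N * zero_avg (chebU (n.-1 - a)) N
  - err n N - (if n is n'.+1 then zero_avg (chebU n') N else 0)) @ \oo)).
  apply: near_eq_cvg; near=> N; have N0 : (0 < N)%N by near: N; exists 1.
  by rewrite avg_rec.
have -> : ((n.+1 == 0)%:R : R) = \sum_(a < n) ((a : nat) == 0)%:R * ((n.-1 - a)%N == 0)%:R
   - 0 - (if n is n'.+1 then (n' == 0)%:R else 0).
  case: n {IH} => [|n]; first by rewrite big_ord0 !subr0.
  rewrite big_ord_recl /= subn0 mul1r big1 ?addr0 ?subr0 ?subrr// => a _.
  by rewrite mul0r.
apply: cvgB; first apply: cvgB.
- apply: cvg_sumR => a; apply: cvgM; apply: IH; have := ltn_ord a; lia.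
- exact: cvg_err.
- case: n IH => [|n] IH; first exact: cvg_cst.
  exact: IH.
Unshelve. all: by end_near. Qed.

Lemma cvg_zero_avg_poly (p : {poly R}) :
  zero_avg (horner p) N @[N --> \oo] --> \sum_(k < size p) p`_k * sc_moment R k 0.
Proof.
have mon k n : zero_avg (fun x => x ^+ k * chebU n x) N @[N --> \oo] --> sc_moment R k n.
  elim: k n => [|k IH] n.
    have -> : (fun x : R => x ^+ 0 * chebU n x) = chebU n.
      by apply/funext => x; rewrite expr0 mul1r.
    exact: cvg_zero_avg_chebU.
  have -> : (fun N => zero_avg (fun x => x ^+ k.+1 * chebU n x) N) =
      (fun N => zero_avg (fun x => x ^+ k * chebU n.+1 x) N +
        (if n is n'.+1 then zero_avg (fun x => x ^+ k * chebU n' x) N else 0)).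
    apply/funext => N; rewrite /zero_avg.
    under eq_bigr do rewrite exprSr -mulrA chebU_mulX mulrDr.
    rewrite big_split mulrDr; congr (_ + _).
    by case: n => [|n'] //; rewrite big1 ?mulr0// => i _; rewrite mulr0.
  apply: cvgD; first exact: IH.
  by case: n => [|n]; [exact: cvg_cst|exact: IH].
have -> : (fun N => zero_avg (horner p) N) =
    (fun N => \sum_(k < size p) p`_k * zero_avg (fun x => x ^+ k * chebU 0 x) N).
  apply/funext => N; rewrite /zero_avg.
  under [RHS]eq_bigr do rewrite mulrCA.
  rewrite -mulr_sumr; congr (_ * _).
  under [RHS]eq_bigr do rewrite mulr_sumr.
  rewrite exchange_big; apply: eq_bigr => i _; rewrite horner_coef.
  by apply: eq_bigr => k _; rewrite chebU0 mulr1.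
by apply: cvg_sumR => k; apply: cvgM; [exact: cvg_cst|exact: mon].
Qed.

End equilibrium_limit.

(** * Chebyshev moments of the semicircle law *)

Section semicircle_moments.
Variable R : realType.
Local Notation mu := (@lebesgue_measure R).

Let y (x : R) : R := Num.sqrt (4 - x ^+ 2).

Let y_cont : continuous y.
Proof.
move=> x; apply: (@continuous_comp _ _ _ (fun x : R => 4 - x ^+ 2) Num.sqrt).
  apply: continuousB; first exact: cvg_cst.
  exact: exprn_continuous.
exact: sqrt_continuous.
Qed.

Let y_gt0 x : x \in `](- 2 : R), 2[ -> 0 < 4 - x ^+ 2.
Proof. by rewrite in_itv/= => /andP[x1 x2]; nra. Qed.

Let y_sqr x : x \in `](- 2 : R), 2[ -> y x ^+ 2 = 4 - x ^+ 2.
Proof. by move=> x2; rewrite sqr_sqrtr// ltW// y_gt0. Qed.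

Let y_derive x : x \in `](- 2 : R), 2[ -> is_derive x (1 : R) y (- x / y x).
Proof.
move=> x2; have y0 : 0 < y x by rewrite sqrtr_gt0 y_gt0.
have d1 := is_derive1_sqrt (y_gt0 x2).
have d2 : is_derive x (1 : R) (fun x => 4 - x ^+ 2) (- (2 * x)).
  have := is_derive_poly (4%:P - 'X^2) x.
  have -> : horner (4%:P - 'X^2) = (fun x : R => 4 - x ^+ 2).
    by apply/funext => z; rewrite !hornerE.
  move=> h; apply: (trigger_derive h).
  by rewrite derivB derivC derivXn !hornerE /= mulr_natl.
have := @is_derive1_comp R Num.sqrt (fun x => 4 - x ^+ 2) x _ _ d1 d2.
move=> h; apply: trigger_derive h _; rewrite -/(y x).
by rewrite /= ; field; rewrite gt_eqF.
Qed.

Let within_of (f : R -> R) (A : set R) : continuous f -> {within A, continuous f}.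
Proof. by move=> cf; apply: continuous_subspaceT. Qed.

Let FTC (f F : R -> R) : continuous f -> continuous F ->
  {in `](- 2 : R), 2[, forall x, is_derive x (1 : R) F (f x)} ->
  (\int[mu]_(x in `[(- 2)%R : R, 2%R]) (f x)%:E = (F 2 - F (- 2))%R%:E)%E.
Proof.
move=> cf cF dF; rewrite (@continuous_FTC2 _ f F)//.
- by rewrite ltr_wpDl.
- exact: within_of.
- split.
  + by move=> x x2; apply: ex_derive; exact: dF.
  + by apply: cvg_at_right_filter; exact: cF.
  + by apply: cvg_at_left_filter; exact: cF.
- by move=> x x2; rewrite derive1E; apply: derive_val; exact: dF.
Qed.

(** The integrand is the derivative of [(4 - x^2)^(3/2) p], which vanishes at
    both ends of the interval. *)
Lemma semicircle_FTC_poly (p : {poly R}) :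
  (\int[mu]_(x in `[(- 2)%R : R, 2%R])
     (Num.sqrt (4 - x ^+ 2) * ((4%:P - 'X^2) * p^`() - 3 *: ('X * p)).[x])%:E = 0)%E.
Proof.
rewrite (@FTC _ (fun x => (y x ^+ 3) * p.[x])).
- by rewrite /y sqrrN -natrX subrr sqrtr0 expr0n /= !mul0r subrr.
- move=> x; apply: cvgM; first exact: y_cont.
  exact: continuous_horner.
- move=> x; apply: cvgM; last exact: continuous_horner.
  apply: (@continuous_comp _ _ _ y (fun z : R => z ^+ 3)); first exact: y_cont.
  exact: exprn_continuous.
- move=> x x2; have dy := y_derive x2; have y0 : 0 < y x by rewrite sqrtr_gt0 y_gt0.
  have -> : (fun x => y x ^+ 3 * p.[x]) = (y ^+ 3) * horner p.
    by apply/funext => z; rewrite !fctE.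
  have h := is_deriveM (is_deriveX 3 dy) (is_derive_poly p x).
  apply: (trigger_derive h).
  rewrite /= -/(y x) !fctE.
  have ys : 4 - x ^+ 2 = y x ^+ 2 by rewrite y_sqr.
  rewrite !(hornerD, hornerN, hornerM, hornerZ, hornerXn, hornerX, hornerC) ys.
  rewrite /GRing.scale /=; move: (y x) y0 (p^`().[x]) p.[x] => a a0 u v.
  by field; rewrite gt_eqF.
Qed.

(** The area of a half disc. The primitive uses [2 atan (x / (2 + y))] instead
    of [arcsin (x / 2)], to which it is equal: it is smooth up to the endpoints. *)
Lemma integral_semicircle_arc :
  (\int[mu]_(x in `[(- 2)%R : R, 2%R]) (Num.sqrt (4 - x ^+ 2))%:E = (2 * pi)%:E)%E.
Proof.
have yp (x : R) : 0 < 2 + y x by rewrite ltr_pwDl// sqrtr_ge0.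
rewrite (@FTC _ (fun x => 2^-1 * (x * y x) + 4 * atan (x / (2 + y x)))).
- have -> : y 2 = 0 by rewrite /y -natrX subrr sqrtr0.
  have -> : y (- 2) = 0 by rewrite /y sqrrN -natrX subrr sqrtr0.
  rewrite !mulr0 !add0r !addr0 mulNr atanN divff// atan1.
  by congr EFin; field.
- exact: y_cont.
- move=> x; apply: cvgD.
    apply: cvgM; first exact: cvg_cst.
    by apply: cvgM; [exact: cvg_id|exact: y_cont].
  apply: cvgM; first exact: cvg_cst.
  apply: continuous_cvg; last first.
    apply: cvgM; first exact: cvg_id.
    apply: cvgV; first by rewrite gt_eqF.
    by apply: cvgD; [exact: cvg_cst|exact: y_cont].
  exact: continuous_atan.
- move=> x x2; have dy := y_derive x2; have y0 : 0 < y x by rewrite sqrtr_gt0 y_gt0.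
  have d1 : is_derive x (1 : R) (fun x => 2 + y x) (- x / y x).
    have -> : (fun x => 2 + y x) = cst 2 + y by apply/funext.
    have h := is_deriveD (is_derive_cst (2 : R) x (1 : R)) dy.
    by apply: (trigger_derive h); rewrite add0r.
  have d2 := @is_deriveV R (fun x => 2 + y x) x _ 1 (lt0r_neq0 (yp x)) d1.
  have d3 := is_deriveM (is_derive_id x 1) d2.
  have d4 := @is_derive1_comp R (@atan R) _ x _ _ (is_derive1_atan _) d3.
  have d5 := is_deriveM (is_derive_id x 1) dy.
  have d6 := is_deriveD (is_deriveZ 2^-1 d5) (is_deriveZ 4 d4).
  apply: (trigger_derive d6).
  rewrite /= !fctE /GRing.scale /= -/(y x).
  have xx : x * x = 4 - y x ^+ 2 by rewrite y_sqr// -expr2; ring.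
  move: (y x) y0 xx => a a0 xx.
  have a20 : 2 + a != 0 by rewrite gt_eqF// ltr_wpDl.
  have e : 1 + (x * (2 + a)^-1) ^+ 2 = 4 / (2 + a).
    rewrite exprMn expr2 xx; field; exact: a20.
  rewrite e mulr1.
  transitivity (2^-1 * (- (x * x) / a + a) +
     4 * ((4 / (2 + a))^-1 * ((x * x) / a * (2 + a) ^- 2 + (2 + a)^-1))).
    by ring.
  by rewrite xx; field; rewrite a20 gt_eqF.
Qed.

(** An integral over the segment, to which the fundamental theorem of calculus
    applies, with the normalising constant outside. *)
Definition semicircle_mean (g : R -> R) : R :=
  (2 * pi)^-1 * \int[mu]_(x in `[(- 2)%R : R, 2%R]) (Num.sqrt (4 - x ^+ 2) * g x).
Local Notation S := semicircle_mean.

Lemma semicircle_arc_integrable (g : R -> R) : continuous g ->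
  mu.-integrable `[(- 2)%R : R, 2%R] (EFin \o (fun x => Num.sqrt (4 - x ^+ 2) * g x)).
Proof.
move=> cg; apply: continuous_compact_integrable; first exact: segment_compact.
by apply: continuous_subspaceT => x; apply: cvgM; [exact: y_cont|exact: cg].
Qed.

Lemma semicircle_meanD (g1 g2 : R -> R) : continuous g1 -> continuous g2 ->
  S (g1 \+ g2) = S g1 + S g2.
Proof.
move=> c1 c2; rewrite /S -mulrDr; congr (_ * _).
rewrite -RintegralD//; [|exact: semicircle_arc_integrable..].
by apply: eq_Rintegral => x _; rewrite mulrDr.
Qed.

Lemma semicircle_meanZ (a : R) (g : R -> R) : continuous g -> S (fun x => a * g x) = a * S g.
Proof.
move=> cg; rewrite /S mulrCA; congr (_ * _).
rewrite -RintegralZl//; last exact: semicircle_arc_integrable.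
by apply: eq_Rintegral => x _; rewrite mulrCA.
Qed.

Lemma semicircle_mean1 : S (fun=> 1) = 1.
Proof.
rewrite /S /Rintegral.
under eq_integral do rewrite mulr1.
by rewrite integral_semicircle_arc /= mulVf// gt_eqF// mulr_gt0// pi_gt0.
Qed.

Lemma semicircle_mean_le (g : R -> R) e : continuous g ->
  (forall x, -2 <= x <= 2 -> `|g x| <= e) -> `|S g| <= e.
Proof.
move=> cg ge; have pi2 : 0 < 2 * pi :> R by rewrite mulr_gt0 ?pi_gt0.
rewrite /S normrM gtr0_norm ?invr_gt0//.
apply: le_trans (_ : (2 * pi)^-1 * (\int[mu]_(x in `[(- 2)%R : R, 2%R]) (y x * e)) <= _).
  rewrite ler_wpM2l ?invr_ge0 ?(ltW pi2)//.
  apply: le_trans (le_normr_Rintegral _ (semicircle_arc_integrable cg)) _ => //.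
  apply: le_Rintegral => //.
  - exact: (integrable_norm (semicircle_arc_integrable cg)).
  - by apply: (semicircle_arc_integrable (g := cst e)) => x; exact: cvg_cst.
  - move=> x /=; rewrite in_itv/= => x2; rewrite normrM ger0_norm ?sqrtr_ge0//.
    by rewrite ler_wpM2l ?sqrtr_ge0// ge.
suff Se : S (fun=> e) = e by rewrite -[leRHS]Se.
have := @semicircle_meanZ e (fun=> 1); rewrite semicircle_mean1 mulr1 => Se.
rewrite -[RHS]Se; first by congr S; apply/funext => x; rewrite mulr1.
by move=> x; exact: cvg_cst.
Qed.

Let Sp (p : {poly R}) := S (horner p).

Let SpD p1 p2 : Sp (p1 + p2) = Sp p1 + Sp p2.
Proof.
rewrite /Sp -semicircle_meanD; [|exact: continuous_horner..].
by congr S; apply/funext => x; rewrite hornerD.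
Qed.

Let SpZ a p : Sp (a *: p) = a * Sp p.
Proof.
rewrite /Sp -semicircle_meanZ; last exact: continuous_horner.
by congr S; apply/funext => x; rewrite hornerZ.
Qed.

Let Sp_FTC (p : {poly R}) : Sp ((4%:P - 'X^2) * p^`() - 3 *: ('X * p)) = 0.
Proof.
by rewrite /Sp /S /Rintegral semicircle_FTC_poly /= mulr0.
Qed.

Let U n : {poly R} := chebU n 'X.

Let horner_U n x : (U n).[x] = chebU n x.
Proof.
suff [] : (U n).[x] = chebU n x /\ (U n.+1).[x] = chebU n.+1 x by [].
elim: n => [|n [IH0 IH1]].
  by rewrite /U !chebU0 !chebU1 hornerC hornerX.
split=> //; rewrite /U !chebUSS -/(U n) -/(U n.+1) hornerD hornerN hornerM hornerX.
by rewrite IH0 IH1.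
Qed.

Let US n : U n.+2 = 'X * U n.+1 - U n.
Proof. by rewrite /U chebUSS. Qed.

(* With this formula, semicircle_FTC_poly for U_n becomes a relation between the
   semicircle means of x U_n and U_(n+1). *)
Let U_deriv n : (4%:P - 'X^2) * (U n)^`() =
  n.+2%:R * ('X * U n) - (2 * n.+1%:R) * U n.+1.
Proof.
suff [] : (4%:P - 'X^2) * (U n)^`() =
    n.+2%:R * ('X * U n) - (2 * n.+1%:R) * U n.+1 /\
  (4%:P - 'X^2) * (U n.+1)^`() =
    n.+3%:R * ('X * U n.+1) - (2 * n.+2%:R) * U n.+2 by [].
elim: n => [|n [IH0 IH1]].
  rewrite US /U chebU0 chebU1 derivC derivX polyC_natr.
  by split; ring.
split=> //; rewrite (US n.+1) {1}US derivB derivM derivX.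
transitivity ((4%:P - 'X^2) * U n.+1 + 'X * ((4%:P - 'X^2) * (U n.+1)^`())
   - (4%:P - 'X^2) * (U n)^`()); first by ring.
rewrite IH0 IH1 US polyC_natr; move: (U n) (U n.+1) => u v.
by ring.
Qed.

(** The relation reads [(n + 4) S(U_(n+2)) = n S(U_n)], where [n] kills the only
    nonzero mean [S(U_0) = 1], and [S(U_1) = 0]. *)
Lemma semicircle_mean_chebU n : S (chebU n) = (n == 0)%:R.
Proof.
have SU k : S (chebU k) = Sp (U k).
  by rewrite /Sp; congr S; apply/funext => x; rewrite horner_U.
have rec k : Sp (k.+2%:R *: ('X * U k) - (2 * k.+1%:R) *: U k.+1 - 3 *: ('X * U k)) = 0.
  have := Sp_FTC (U k); rewrite U_deriv => h; rewrite -[RHS]h; congr Sp.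
  by rewrite -!mul_polyC polyCM !polyC_natr.
have SpB p1 p2 : Sp (p1 - p2) = Sp p1 - Sp p2.
  by rewrite SpD -scaleN1r SpZ mulN1r.
have {}rec k : k.+2%:R * Sp ('X * U k) - (2 * k.+1%:R) * Sp (U k.+1)
    - 3 * Sp ('X * U k) = 0.
  by rewrite -[RHS](rec k) (SpB (_ - _)) (SpB (_ *: _)) !SpZ.
suff [] : S (chebU n) = (n == 0)%:R /\ S (chebU n.+1) = (n.+1 == 0)%:R by [].
rewrite !SU; elim: n => [|n [IH0 IH1]].
  split.
    by rewrite -SU -semicircle_mean1; congr S; apply/funext => x.
  have := rec 0; rewrite (_ : 'X * U 0 = U 1); last first.
    by rewrite /U chebU0 chebU1 mulr1.
  move: (Sp (U 1)) => z h; have : - 3 * z = 0 by rewrite -[RHS]h; ring.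
  by rewrite mulNr => /eqP; rewrite oppr_eq0 mulf_eq0 pnatr_eq0 => /eqP.
split=> //; have := rec n.+1.
have -> : 'X * U n.+1 = U n.+2 + U n by rewrite US subrK.
rewrite (SpD (U n.+2)) IH0 => h.
have n0 : (n%:R : R) * (n == 0)%:R = 0.
  by case: (n) => [|m]; rewrite /= ?mul0r ?mulr0.
have n4 : (n%:R + 4 : R) != 0 by rewrite gt_eqF// ltr_wpDl.
apply: (mulfI n4); rewrite mulr0.
move: h.
move: (Sp _) => z; move: n0; move: ((n == 0)%:R : R) => w n0 h.
have : (n%:R + 4) * z = n%:R * w.
  by apply/eqP; rewrite -subr_eq0; apply/eqP; rewrite -[RHS]oppr0 -[in RHS]h; ring.
by rewrite n0.
Qed.

(** The expansion in the [x ^ k U_n] of the averages over the zeros, now for the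
    semicircle law. *)
Lemma semicircle_mean_poly (p : {poly R}) :
  S (horner p) = \sum_(k < size p) p`_k * sc_moment R k 0.
Proof.
have mon k n : Sp ('X^k * U n) = sc_moment R k n.
  elim: k n => [|k IH] n.
    rewrite expr0 mul1r -[RHS]/((n == 0)%:R) -semicircle_mean_chebU /Sp; congr S.
    by apply/funext => x; rewrite horner_U.
  have -> : 'X ^+ k.+1 * U n = 'X^k * U n.+1 +
      (if n is n'.+1 then 'X^k * U n' else 0)%R.
    rewrite exprSr -mulrA; case: n => [|n].
      by rewrite addr0 /U chebU0 chebU1 mulr1.
    by rewrite -mulrDr US subrK.
  rewrite SpD IH /=; case: n => [|n]; last by rewrite IH.
  by congr (_ + _); have := SpZ 0 0; rewrite scale0r mul0r.
have Sp_sum (I : Type) (r : seq I) (F : I -> {poly R}) :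
    Sp (\sum_(i <- r) F i) = \sum_(i <- r) Sp (F i).
  apply: (big_morph _ SpD); by have := SpZ 0 0; rewrite scale0r mul0r.
rewrite -/(Sp p) -{1}[p]coefK poly_def Sp_sum; apply: eq_bigr => k _.
by rewrite SpZ -mon /U chebU0 mulr1.
Qed.

End semicircle_moments.

(** * Zeros of the Hermite polynomials *)

Section hermite_zeros.
Variables (R : realType) (N : nat) (x : 'I_N -> R).
Local Notation C := R[i].
Hypothesis N0 : (0 < N)%N.
Hypothesis xP : hermite R N N = \prod_i ('X - (x i)%:C%C%:P).

Let root_x i : root (hermite R N N) (x i)%:C%C.
Proof. by rewrite xP (bigD1 i)//= rootM root_XsubC eqxx. Qed.

Lemma hermite_zero_le2 i : `|x i| <= 2.
Proof.
have := root_x i; apply: contraTT; rewrite -ltNge => x2.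
apply: hermite_root_norm => //.
rewrite (_ : `|(x i)%:C%C| = `|x i|%:C%C); last first.
  by rewrite normc_def /= expr0n /= addr0 sqrtr_sqr.
have -> : (2 : C) = (2 : R)%:C%C by rewrite rmorph_nat.
by rewrite lecR ltW.
Qed.

Lemma hermite_zeros_inj : injective x.
Proof.
move=> i j xij; apply/eqP/negPn/negP => ij.
have [n Nn] : exists n, N = n.+1 by exists N.-1; rewrite prednK.
have r1 : root (hermite R N n.+1) (x i)%:C%C by rewrite -[X in hermite _ _ X]Nn.
have := hermite_simple_root N0 r1; apply/negP/negPn.
have : root (hermite R N n.+1)^`() (x i)%:C%C.
  rewrite -[X in hermite _ _ X]Nn xP (bigD1 i)//= (bigD1 j)/=; last by rewrite eq_sym.
  rewrite -xij /root derivM !(hornerD, hornerM) derivM !(hornerD, hornerM).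
  by rewrite !(hornerN, hornerX, hornerC) subrr !(mul0r, mulr0, addr0).
by rewrite hermite_deriv rootZ// pnatr_eq0.
Qed.

(** The equation is real, and the complex field is where the zeros of [h_N]
    were found: it is transported back by injectivity. *)
Lemma hermite_zeros_equilibrium i :
  N%:R * x i = \sum_(j | j != i) 2 / (x i - x j).
Proof.
apply: (@complexI R).
have inj : injective (fun i => (x i)%:C%C).
  by move=> a b /complexI/hermite_zeros_inj.
have := @ode_equilibrium C N _ N%:R inj.
rewrite -xP => /(_ (fun k => hermite_ode N0 (root_x k)))/(_ i) E.
rewrite rmorphM rmorph_nat E rmorph_sum; apply: eq_bigr => j _.
by rewrite rmorphM fmorphV rmorphB rmorph_nat.
Qed.

End hermite_zeros.

(** * From polynomials to continuous functions *)

Section bernstein.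
Variable R : realType.
Implicit Types (f g : nat -> R) (x : R).

Let Y : {poly R} := 4^-1 *: ('X + 2%:P).

(** The mean of [f] under the binomial law of parameters [n] and [(x + 2) / 4],
    defined by conditioning on the first trial, so that positivity, linearity and
    the variance are proved by induction. *)
Fixpoint bernstein (n : nat) f : {poly R} :=
  if n is m.+1 then
    Y * bernstein m (fun k => f k.+1) + (1 - Y) * bernstein m f
  else (f 0)%:P.

Let hornerY x : Y.[x] = (x + 2) / 4.
Proof. by rewrite /Y !hornerE mulrC. Qed.

Let bernsteinS n f x : (bernstein n.+1 f).[x] =
  (x + 2) / 4 * (bernstein n (fun k => f k.+1)).[x] +
  (1 - (x + 2) / 4) * (bernstein n f).[x].
Proof. by rewrite /= !(hornerD, hornerN, hornerM) hornerY hornerC. Qed.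

Let Y01 x : -2 <= x <= 2 -> 0 <= (x + 2) / 4 <= 1.
Proof. by move=> /andP[x1 x2]; apply/andP; split; lra. Qed.

Lemma bernstein_le n f g x : -2 <= x <= 2 -> (forall k, f k <= g k) ->
  (bernstein n f).[x] <= (bernstein n g).[x].
Proof.
move=> /Y01/andP[y0 y1]; elim: n f g => [|n IH] f g fg.
  by rewrite /= !hornerC.
rewrite !bernsteinS; apply: lerD; first by rewrite ler_wpM2l// IH.
by rewrite ler_wpM2l ?subr_ge0// IH.
Qed.

Lemma bernsteinD n f g x :
  (bernstein n (fun k => f k + g k)).[x] = (bernstein n f).[x] + (bernstein n g).[x].
Proof.
elim: n f g => [|n IH] f g; first by rewrite /= !hornerC.
by rewrite !bernsteinS !IH; ring.
Qed.

Lemma bernsteinZ n a f x :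
  (bernstein n (fun k => a * f k)).[x] = a * (bernstein n f).[x].
Proof.
elim: n f => [|n IH] f; first by rewrite /= !hornerC.
by rewrite !bernsteinS !IH; ring.
Qed.

Lemma bernstein_cst n a x : (bernstein n (fun=> a)).[x] = a.
Proof.
elim: n => [|n IH]; first by rewrite /= hornerC.
by rewrite bernsteinS IH; ring.
Qed.

Lemma bernstein_variance n a x (y := (x + 2) / 4) :
  (bernstein n (fun k => (k%:R - a) ^+ 2)).[x] =
    (n%:R * y - a) ^+ 2 + n%:R * (y * (1 - y)).
Proof.
elim: n a => [|n IH] a; first by rewrite /= hornerC !mul0r addr0.
rewrite bernsteinS -/y.
have -> : (fun k => (k.+1%:R - a) ^+ 2) = (fun k => (k%:R - (a - 1)) ^+ 2).
  by apply/funext => k; congr (_ ^+ 2); rewrite -natr1; ring.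
by rewrite !IH -natr1; ring.
Qed.

(** Weierstrass approximation by Bernstein polynomials. The quadratic modulus of
    continuity makes the error at most [e] plus [K] times the variance of the
    random node, which is at most [4 / n]. *)
Lemma poly_approx (g : R -> R) (e K : R) : 0 < e -> 0 <= K ->
    (forall x y, -2 <= x <= 2 -> `|g y - g x| <= e + K * (y - x) ^+ 2) ->
  exists p : {poly R}, forall x, -2 <= x <= 2 -> `|g x - p.[x]| <= 2 * e.
Proof.
move=> e0 K0 gK.
pose n := (Num.truncn (4 * K / e)).+1.
have n0 : (0 : R) < n%:R by rewrite ltr0n.
have ne : 4 * K / n%:R <= e.
  rewrite ler_pdivrMr// [e * _]mulrC -ler_pdivrMr// ltW//.
  exact: truncnS_gt.
pose node (k : nat) : R := 4 * k%:R / n%:R - 2.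
exists (bernstein n (g \o node)) => x x2.
have bE : (bernstein n (g \o node)).[x] - g x =
    (bernstein n (fun k => g (node k) + - g x)).[x].
  by rewrite bernsteinD bernstein_cst.
pose D k := e + K * (node k - x) ^+ 2.
have bD : (bernstein n D).[x] <= 2 * e.
  have -> : D = (fun k => e + K * (16 / n%:R ^+ 2 * (k%:R - n%:R * ((x + 2) / 4)) ^+ 2)).
    by apply/funext => k; rewrite /D /node; congr (_ + _ * _); field; rewrite gt_eqF.
  rewrite bernsteinD bernstein_cst !bernsteinZ bernstein_variance subrr expr0n /= add0r.
  have /andP[y0 y1] := Y01 x2; move: ((x + 2) / 4) y0 y1 => y y0 y1.
  have : y * (1 - y) <= 4^-1.
    by have := sqr_ge0 (y - 2^-1); nra.
  have -> : K * (16 / n%:R ^+ 2 * (n%:R * (y * (1 - y)))) =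
    4 * (4 * K / n%:R) * (y * (1 - y)) by field; rewrite gt_eqF.
  have yy : 0 <= y * (1 - y) by rewrite mulr_ge0 ?subr_ge0.
  move: (4 * K / n%:R) (y * (1 - y)) ne yy => t u tu u0 u1; nra.
rewrite distrC bE ler_norml; apply/andP; split.
  apply: (@le_trans _ _ (- (bernstein n D).[x])); first by rewrite lerN2.
  rewrite -mulN1r -bernsteinZ; apply: bernstein_le => // k.
  by rewrite mulN1r; have := gK x (node k) x2; rewrite ler_norml => /andP[].
apply: le_trans bD; apply: bernstein_le => // k.
by have := gK x (node k) x2; rewrite ler_norml => /andP[].
Qed.

End bernstein.

Section quadratic_modulus.
Variable R : realType.
Local Notation C := R[i].

Lemma sqnormC_triangle (u v : C) : sqnormC (u + v) <= 2 * (sqnormC u + sqnormC v).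
Proof.
case: u => a b; case: v => c d; rewrite /sqnormC /=.
have := sqr_ge0 (a - c); have := sqr_ge0 (b - d); nra.
Qed.

Lemma sqnormCN (u : C) : sqnormC (- u) = sqnormC u.
Proof. by case: u => a b; rewrite /sqnormC /= !sqrrN. Qed.

(** By compactness of the segment, [f] varies by at most [e] within a uniform
    distance [d]; farther away, [2 M <= (2 M / d^2) |z - x|^2]. This form of the
    modulus is what a quadratic transport cost can control. *)
Lemma continuous_quadratic_modulus (f : C^o -> R) (e : R) : continuous f ->
    (exists M : R, forall z, `|f z| <= M) -> 0 < e ->
  exists2 K : R, 0 <= K & forall (x : R) (z : C), -2 <= x <= 2 ->
    `|f z - f x%:C%C| <= e + K * sqnormC (z - x%:C%C).
Proof.
move=> cf [M fM] e0.
have M0 : 0 <= M by apply: le_trans (fM 0).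
have cov : \forall d \near (0 : R)^'+, `[(- 2 : R), 2]%classic `<=`
    (fun x => forall z : C, sqnormC (z - x%:C%C) < d ^+ 2 -> `|f z - f x%:C%C| <= e).
  have /compact_near_coveringP := @segment_compact R (- 2) 2; apply => x0 _.
  have e20 : 0 < e / 2 by rewrite divr_gt0.
  have /cvgrPdist_lt /(_ _ e20) := cf (x0%:C%C : C^o).
  move=> /nbhsC_sqnormP[eta eta0 etaP].
  exists (ball x0 (eta / 2), [set d | 0 < d /\ d < eta / 2]) => /=.
    split; first by apply: nbhsx_ballx; rewrite divr_gt0.
    near=> d; split; first by near: d; exact: nbhs_right_gt.
    by near: d; apply: nbhs_right_lt; rewrite divr_gt0.
  move=> [x d] /= [x0x [d0 deta]] z zx.
  have sq0 : sqnormC (x0%:C%C - x%:C%C) < (eta / 2) ^+ 2.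
    rewrite -rmorphB /sqnormC /= expr0n /= addr0 -real_normK ?num_real//.
    by rewrite ltr_pXn2r ?nnegrE// ltW// divr_gt0.
  have d2 : d ^+ 2 < (eta / 2) ^+ 2.
    by rewrite ltr_pXn2r// ?nnegrE ltW// divr_gt0.
  have h1 : `|f (x0%:C%C) - f x%:C%C| < e / 2.
    apply: etaP; apply: lt_trans sq0 _.
    by rewrite ltr_pXn2r ?nnegrE ?ltW ?divr_gt0// ltr_pdivrMr// ltr_pMr// ltr1n.
  have h2 : `|f (x0%:C%C) - f z| < e / 2.
    apply: etaP.
    have -> : x0%:C%C - z = (x0%:C%C - x%:C%C) + - (z - x%:C%C) by ring.
    apply: le_lt_trans (sqnormC_triangle _ _) _; rewrite sqnormCN.
    have -> : eta ^+ 2 = 2 * ((eta / 2) ^+ 2 + (eta / 2) ^+ 2) by field.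
    rewrite ltr_pM2l// ltrD// (lt_trans zx)//.
  have -> : f z - f x%:C%C = (f x0%:C%C - f x%:C%C) - (f x0%:C%C - f z) by ring.
  by apply: le_trans (ler_normB _ _) _; rewrite [leRHS](splitr e) ltW// ltrD.
have [d /= d0 dP] : exists2 d : R, 0 < d & forall x, -2 <= x <= 2 ->
    forall z : C, sqnormC (z - x%:C%C) < d ^+ 2 -> `|f z - f x%:C%C| <= e.
  near (0 : R)^'+ => d; exists d; first by near: d; exact: nbhs_right_gt.
  have h : `[(- 2 : R), 2]%classic `<=` (fun x => forall z : C,
     sqnormC (z - x%:C%C) < d ^+ 2 -> `|f z - f x%:C%C| <= e) by near: d.
  by move=> x x2; apply: h; rewrite /= in_itv.
have d20 : 0 < d ^+ 2 by rewrite exprn_gt0.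
exists (2 * M / d ^+ 2); first by rewrite divr_ge0 ?mulr_ge0// ltW.
move=> x z x2; have K0 : 0 <= 2 * M / d ^+ 2 by rewrite divr_ge0 ?mulr_ge0// ltW.
have [zd|zd] := ltP (sqnormC (z - x%:C%C)) (d ^+ 2).
  by rewrite (le_trans (dP x x2 z zd))// lerDl mulr_ge0// sqnormC_ge0.
apply: (@le_trans _ _ (2 * M)).
  apply: le_trans (ler_normB _ _) _.
  by rewrite mulr_natl mulr2n lerD.
rewrite -[leLHS]add0r lerD ?(ltW e0)//.
by rewrite -[leLHS](divfK (lt0r_neq0 d20)) ler_wpM2l.
Unshelve. all: by end_near. Qed.

End quadratic_modulus.

Section coupled_zeros.
Variable R : realType.
Local Notation C := R[i].
Variables (z : forall N : nat, 'I_N -> C) (x : forall N : nat, 'I_N -> R).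
Variables (p : forall N : nat, 'I_N -> 'I_N -> R) (eps : nat -> R).
Hypothesis xP : forall N, (0 < N)%N ->
  hermite R N N = \prod_i ('X - (@x N i)%:C%C%:P).
Hypothesis p0 : forall N i j, 0 <= @p N i j.
Hypothesis prow : forall N i, \sum_j @p N i j = 1.
Hypothesis pcol : forall N j, \sum_i @p N i j = 1.
Hypothesis zx : forall N,
  \sum_i \sum_j @p N i j * sqnormC (z i - (x j)%:C%C) <= N%:R * eps N.
Hypothesis eps0 : eps N @[N --> \oo] --> (0 : R).

(** Replace [f] by a polynomial on [-2, 2], where the Hermite zeros lie, use the
    limit of their averages, and move from the Hermite zeros to the [z_i] through
    the coupling, which costs [e / 8 + K eps N]. *)
Lemma cvg_coupled_zeros (f : C^o -> R) : continuous f ->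
    (exists M : R, forall z, `|f z| <= M) ->
  N%:R^-1 * \sum_i f (@z N i) @[N --> \oo] -->
    semicircle_mean (fun x => f x%:C%C).
Proof.
move=> cf bf.
have crf := continuous_comp_real cf.
have xle2 N (i : 'I_N) : `|x i| <= 2.
  by have N0 := leq_ltn_trans (leq0n _) (ltn_ord i); exact: (hermite_zero_le2 N0 (xP N0)).
have xinj N : injective (@x N).
  by move=> i; have N0 := leq_ltn_trans (leq0n _) (ltn_ord i);
   exact: (hermite_zeros_inj N0 (xP N0)).
have xeq N (i : 'I_N) : N%:R * @x N i = \sum_(j | j != i) 2 / (@x N i - @x N j).
  by have N0 := leq_ltn_trans (leq0n _) (ltn_ord i);
   exact: (hermite_zeros_equilibrium N0 (xP N0)).
apply/cvgrPdist_le => e e0.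
pose e' := e / 8; have e'0 : 0 < e' by rewrite divr_gt0.
have [K K0 KP] := continuous_quadratic_modulus cf bf e'0.
have [q qP] : exists q : {poly R}, forall x, -2 <= x <= 2 -> `|f x%:C%C - q.[x]| <= 2 * e'.
  apply: (poly_approx (g := fun x : R => f x%:C%C) e'0 K0) => a b a2.
  apply: le_trans (KP a b%:C%C a2) _.
  by rewrite -rmorphB /sqnormC /= [0 ^+ 2]expr0n /= addr0.
have Sq : `|semicircle_mean (fun x => f x%:C%C) - semicircle_mean (horner q)| <= 2 * e'.
  have -> : semicircle_mean (fun x => f x%:C%C) - semicircle_mean (horner q) =
      semicircle_mean ((fun x => f x%:C%C) \+ (fun x => (-1) * q.[x])).
    rewrite semicircle_meanD//.
      by rewrite semicircle_meanZ ?mulN1r//; exact: continuous_horner.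
    by move=> a; apply: cvgM; [exact: cvg_cst|exact: continuous_horner].
  apply: semicircle_mean_le.
    move=> a; apply: cvgD; first exact: crf.
    by apply: cvgM; [exact: cvg_cst|exact: continuous_horner].
  by move=> a a2 /=; rewrite mulN1r; exact: qP.
have cq := cvg_zero_avg_poly xinj xle2 xeq (p := q).
rewrite -semicircle_mean_poly in cq.
move/cvgrPdist_le : cq => /(_ _ e'0) cq.
have eK : eps N * K @[N --> \oo] --> (0 : R).
  by rewrite -(mul0r K); apply: cvgM; [exact: eps0|exact: cvg_cst].
move/cvgrPdist_le : eK => /(_ _ e'0) eK.
near=> N; have N0 : (0 < N)%N by near: N; exists 1.
have NR : (0 : R) < N%:R by rewrite ltr0n.
have h1 : `|semicircle_mean (horner q) - zero_avg x (horner q) N| <= e' by near: N.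
have h2 : `|0 - eps N * K| <= e' by near: N.
have avg_le (I : finType) (a b : I -> R) c : #|I| = N -> (forall i, `|a i - b i| <= c) ->
    `|N%:R^-1 * \sum_i a i - N%:R^-1 * \sum_i b i| <= c.
  move=> cI abc; rewrite -mulrBr -sumrB normrM gtr0_norm ?invr_gt0// mulrC.
  rewrite ler_pdivrMr//; apply: le_trans (ler_norm_sum _ _ _) _.
  apply: le_trans (ler_sum _ (fun i _ => abc i)) _.
  by rewrite sumr_const cI mulr_natr.
have h3 : `|zero_avg x (horner q) N - N%:R^-1 * \sum_i f (@x N i)%:C%C| <= 2 * e'.
  apply: avg_le; first by rewrite card_ord.
  by move=> i; rewrite distrC; apply: qP; rewrite -ler_norml.
have h4 : `|N%:R^-1 * \sum_i f (@x N i)%:C%C - N%:R^-1 * \sum_i f (@z N i)| <=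
    e' + K * eps N.
  have -> : N%:R^-1 * \sum_i f (@x N i)%:C%C - N%:R^-1 * \sum_i f (@z N i) =
    N%:R^-1 * \sum_i \sum_j @p N i j * (f (x j)%:C%C - f (z i)).
    rewrite -mulrBr; congr (_ * _).
    under [RHS]eq_bigr do under eq_bigr do rewrite mulrBr.
    under [RHS]eq_bigr do rewrite sumrB.
    rewrite sumrB; congr (_ - _).
      by rewrite exchange_big; apply: eq_bigr => j _; rewrite -mulr_suml pcol mul1r.
    by apply: eq_bigr => i _; rewrite -mulr_suml prow mul1r.
  rewrite normrM gtr0_norm ?invr_gt0// mulrC ler_pdivrMr//.
  apply: le_trans (ler_norm_sum _ _ _) _.
  apply: (@le_trans _ _ (\sum_i \sum_j @p N i j * (e' + K * sqnormC (z i - (x j)%:C%C)))).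
    apply: ler_sum => i _; apply: le_trans (ler_norm_sum _ _ _) _.
    apply: ler_sum => j _; rewrite normrM ger0_norm// ler_wpM2l// distrC.
    by apply: KP; rewrite -ler_norml.
  have -> : \sum_i \sum_j @p N i j * (e' + K * sqnormC (z i - (x j)%:C%C)) =
    N%:R * e' + K * \sum_i \sum_j @p N i j * sqnormC (z i - (x j)%:C%C).
    rewrite mulr_sumr.
    have -> : N%:R * e' = \sum_(i < N) e' by rewrite sumr_const card_ord mulr_natl.
    rewrite -big_split; apply: eq_bigr => i _ /=.
    rewrite -[X in X + _]mul1r -(prow i) mulr_suml mulr_sumr -big_split.
    by apply: eq_bigr => j _ /=; ring.
  by rewrite [leRHS]mulrC mulrDr lerD2l mulrCA ler_wpM2l.
move: h1 h2 h3 h4; rewrite sub0r normrN => h1 h2 h3 h4.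
have {}h2 : K * eps N <= e' by rewrite mulrC (le_trans (ler_norm _)).
move: h1 h3 h4 Sq; rewrite /e' in h2 *.
set A := semicircle_mean (fun x0 : R => f x0%:C%C); set B := semicircle_mean (horner q).
set D := zero_avg _ _ _; set E := N%:R^-1 * \sum_i f (@x N i)%:C%C.
set F := N%:R^-1 * \sum_i f (@z N i) => h1 h3 h4 Sq.
have -> : A - F = (A - B) + (B - D) + (D - E) + (E - F) by ring.
apply: le_trans (ler_normD _ _) _; apply: le_trans (lerD (ler_normD _ _) h4) _.
apply: le_trans (lerD (lerD (ler_normD _ _) h3) (lexx _)) _.
lra.
Unshelve. all: by end_near. Qed.

End coupled_zeros.

(** * Coefficients of the characteristic polynomial *)

Section char_poly_coef.
Variables (F : comNzRingType) (N : nat).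
Implicit Types (A : 'M[F]_N) (k : 'S_N * {set 'I_N}).

(** In the Leibniz expansion, a term of degree [m] is a permutation together with
    a set of [m] of its fixed points, at which the diagonal contributes 'X. *)
Definition partial_perm (m : nat) k :=
  (#|k.2| == m) && [forall i in k.2, k.1 i == i].

(** The positions of the matrix entries that occur in the term [k]. *)
Definition pp_cell k (ij : 'I_N * 'I_N) :=
  (ij.1 \notin k.2) && (k.1 ij.1 == ij.2).

Lemma char_poly_coef A m : (char_poly A)`_m =
  \sum_(k | partial_perm m k)
    ((-1) ^+ k.1 * (-1) ^+ (N - m)) *
      \prod_ij (if pp_cell k ij then A ij.1 ij.2 else 1).
Proof.
have prodE k : \prod_ij (if pp_cell k ij then A ij.1 ij.2 else 1) =
    \prod_(i | i \notin k.2) A i (k.1 i).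
  rewrite -(pair_big xpredT xpredT
    (fun i j => if pp_cell k (i, j) then A i j else 1))/=.
  rewrite [RHS]big_mkcond; apply: eq_bigr => i _.
  rewrite /pp_cell /=; case: ifP => ik; last by rewrite big1.
  by rewrite (bigD1 (k.1 i))//= eqxx big1 ?mulr1// => j; rewrite eq_sym => /negbTE ->.
rewrite /char_poly /determinant coef_sum.
rewrite -(pair_big_dep xpredT (fun s S => partial_perm m (s, S))
  (fun s S => ((-1) ^+ s * (-1) ^+ (N - m)) *
    \prod_ij (if pp_cell (s, S) ij then A ij.1 ij.2 else 1))) /=.
apply: eq_bigr => s _.
pose t (S : {set 'I_N}) : {poly F} := \prod_i (if i \in S then 'X *+ (i == s i)
                                 else - (A i (s i))%:P).
have -> : \prod_i char_poly_mx A i (s i) = \sum_(S in {set 'I_N}) t S.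
  rewrite -bigA_distr; apply: eq_bigr => i _.
  by rewrite /char_poly_mx !mxE.
have -> (p : {poly F}) : ((-1) ^+ s * p)`_m = (-1) ^+ s * p`_m.
  by case: (odd_perm s); rewrite ?(expr0, expr1, mul1r, mulN1r, coefN).
rewrite coef_sum mulr_sumr [RHS]big_mkcond; apply: eq_bigr => S _.
rewrite -mulrA prodE /=.
have [Sfix|nSfix] := boolP [forall i in S, s i == i]; last first.
  rewrite /partial_perm /= (negbTE nSfix) andbF.
  have [i iS si] : exists2 i, i \in S & s i != i.
    by move: nSfix; rewrite negb_forall_in => /exists_inP.
  by rewrite /t (bigD1 i)//= iS eq_sym (negbTE si) mulr0n mul0r coef0 mulr0.
have -> : t S = ((-1) ^+ (N - #|S|) * \prod_(i | i \notin S) A i (s i)) *: 'X^#|S|.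
  rewrite /t (bigID (mem S)) /= mulrC -mul_polyC; congr (_ * _).
    have -> : (N - #|S|)%N = #|[predC S]|.
      by apply/eqP; rewrite -(eqn_add2l #|S|) cardC card_ord subnKC// -[leqRHS]card_ord max_card.
    rewrite rmorphM rmorph_prod rmorphXn rmorphN1 -prodrN.
    by apply: eq_big => // i iS; rewrite (negbTE iS).
  rewrite -prodr_const; apply: eq_bigr => i iS; rewrite iS.
  by move/forall_inP : Sfix => /(_ i iS)/eqP ->; rewrite eqxx.
rewrite coefZ coefXn /partial_perm /= Sfix andbT eq_sym.
by case: eqP => [->|_]; rewrite ?mulr1// !mulr0.
Qed.

(** Distinct terms have distinct square-free monomials, so for independent centred
    entries they are orthogonal. *)
Lemma pp_cell_inj m k k' : partial_perm m k -> partial_perm m k' ->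
  pp_cell k =1 pp_cell k' -> k = k'.
Proof.
case: k => s S; case: k' => s' S' /andP[_ /forall_inP/= Sfix].
move=> /andP[_ /forall_inP/= Sfix'] cellE.
have SE : S = S'.
  apply/setP => i; apply/idP/idP => iS; apply/negPn/negP => niS.
    by have := cellE (i, s' i); rewrite /pp_cell /= iS niS eqxx.
  by have := cellE (i, s i); rewrite /pp_cell /= iS niS eqxx.
rewrite -{}SE in Sfix' cellE *; congr pair; apply/permP => i.
have [iS|niS] := boolP (i \in S).
  by rewrite (eqP (Sfix i iS)) (eqP (Sfix' i iS)).
by have := cellE (i, s i); rewrite /pp_cell /= niS eqxx/= => /esym/eqP.
Qed.

Lemma card_pp_cell m k : partial_perm m k -> #|pp_cell k| = (N - m)%N.
Proof.
case: k => s S /andP[/= /eqP <- _].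
have -> : (N - #|S|)%N = #|[predC S]|.
  by apply/eqP; rewrite -(eqn_add2l #|S|) cardC card_ord subnKC// -[leqRHS]card_ord max_card.
have finj : injective (fun i : 'I_N => (i, s i)) by move=> i j [].
rewrite -(fintype.card_image finj); apply: eq_card => -[i j].
apply/idP/idP => [/andP[/= iS /eqP <-]|].
  exact: (fintype.image_f (fun i : 'I_N => (i, s i))).
case/fintype.imageP => i' i'S [-> ->]; apply/andP; split => //=.
Qed.

(** Choose the [m] points, then permute the others arbitrarily. *)
Lemma card_partial_perm m : #|partial_perm m| = ('C(N, m) * (N - m)`!)%N.
Proof.
rewrite -sum1_card.
rewrite (eq_bigl (fun k => (#|k.2| == m) && perm_on (~: k.2)%SET k.1)); last first.
  move=> [s S]; rewrite unfold_in /partial_perm /=; congr (_ && _).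
  apply/forall_inP/fintype.subsetP => /= [h i|h i iS].
    by rewrite inE => /negP si; rewrite inE; apply/negP => /h.
  apply/negPn/negP => /h; rewrite inE iS//.
rewrite -(pair_big_dep xpredT
  (fun s (S : {set 'I_N}) => (#|S| == m) && perm_on (~: S)%SET s) (fun _ _ => 1%N)) /=.
rewrite (exchange_big_dep (fun S : {set 'I_N} => #|S| == m)) /=; last first.
  by move=> s S _ /andP[].
rewrite (eq_bigr (fun=> (N - m)`!)) => [|S /eqP cS].
  rewrite sum_nat_const; congr (_ * _)%N; rewrite -[N in RHS]card_ord.
  by rewrite -card_draws cardsE.
rewrite (eq_bigl (fun s => perm_on (~: S)%SET s)) => [|s]; last by rewrite cS eqxx.
by rewrite sum1_card card_perm cardsCs finset.setCK card_ord cS.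
Qed.

End char_poly_coef.

(** * Integrals of products of independent variables *)

Section weighted_integrals.
Import HBNNSimple.
Context {R : realType} {d : measure_display} {U : measurableType d}.

Section layer_cake.
Context {d' : measure_display} {T : measurableType d'}.
Variables (mu : {measure set T -> \bar R}) (W : T -> R) (X : T -> U).
Hypotheses (mW : measurable_fun setT W) (W0 : forall t, 0 <= W t).
Hypothesis mX : measurable_fun setT X.

Lemma weighted_integral_approx (phi : U -> R)
    (mphi : measurable_fun setT (EFin \o phi)) : (forall u, 0 <= phi u) ->
  (\int[mu]_t (W t * phi (X t))%:E =
   limn (fun n => \int[mu]_t (W t * nnsfun_approx measurableT mphi n (X t))%:E))%E.
Proof.
move=> phi0; rewrite -monotone_convergence//.
- apply: eq_integral => t _; apply/esym/cvg_lim => //.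
  under eq_fun do rewrite EFinM.
  rewrite EFinM; apply: cvgeZl => //.
  by apply: (cvg_nnsfun_approx measurableT mphi) => // u _; rewrite lee_fin.
- move=> n; apply/measurable_EFinP; apply: measurable_funM => //.
  by apply: measurableT_comp.
- by move=> n t _; rewrite lee_fin mulr_ge0.
- move=> t _ m n mn; rewrite lee_fin ler_wpM2l//.
  exact/lefP/nd_nnsfun_approx.
Qed.

Lemma weighted_integral_simple (f : {nnsfun U >-> R}) :
  (\int[mu]_t (W t * f (X t))%:E =
   \sum_(r \in range f) r%:E * \int[mu]_t (W t * \1_(f @^-1` [set r]) (X t))%:E)%E.
Proof.
have mI (r : R) : measurable_fun setT (fun t => \1_(f @^-1` [set r]) (X t) : R).
  by apply: (@measurableT_comp _ _ _ _ _ _ (\1_(f @^-1` [set r]) : U -> R) setT X).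
transitivity (\int[mu]_t (\sum_(r \in range f)
    (r * (W t * \1_(f @^-1` [set r]) (X t)))%:E))%E.
  apply: eq_integral => t _; rewrite fsumEFin//; congr EFin.
  rewrite fimfunE !fsbig_finite//= mulr_sumr.
  by apply: eq_bigr => r _; rewrite mulrCA.
have r0 r t : 0 <= r * (W t * \1_(f @^-1` [set r]) (X t)).
  rewrite mulrCA mulr_ge0// indicE; case: (_ \in _) / idP => [|_].
    by rewrite inE => <-; rewrite mulr1.
  by rewrite mulr0.
rewrite ge0_integral_fsum//.
- apply: eq_fsbigr => r; rewrite inE => -[u _ <-{r}].
  under eq_integral do rewrite EFinM.
  rewrite ge0_integralZl_EFin//.
  + by move=> t _; rewrite lee_fin mulr_ge0.
  + by apply/measurable_EFinP; apply: measurable_funM.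
- by move=> r; apply/measurable_EFinP; do 2 apply: measurable_funM => //.
- by move=> r t _; rewrite lee_fin.
Qed.

End layer_cake.

(** Both integrals are limits of the same combinations of the assumed equalities,
    by approximating [phi] with simple functions. The weights allow one variable to
    be treated at a time in a product; with weights 1 and a density, this is the
    change of variables for a law. *)
Lemma weighted_integral_eq
    {d1 d2 : measure_display} {T1 : measurableType d1} {T2 : measurableType d2}
    (mu1 : {measure set T1 -> \bar R}) (mu2 : {measure set T2 -> \bar R})
    (W1 : T1 -> R) (W2 : T2 -> R) (X1 : T1 -> U) (X2 : T2 -> U) :
    measurable_fun setT W1 -> measurable_fun setT W2 ->
    (forall t, 0 <= W1 t) -> (forall t, 0 <= W2 t) ->
    measurable_fun setT X1 -> measurable_fun setT X2 ->
    (forall B : set U, measurable B ->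
      \int[mu1]_t (W1 t * \1_B (X1 t))%:E =
      \int[mu2]_t (W2 t * \1_B (X2 t))%:E)%E ->
  forall phi : U -> R, measurable_fun setT phi -> (forall u, 0 <= phi u) ->
  (\int[mu1]_t (W1 t * phi (X1 t))%:E = \int[mu2]_t (W2 t * phi (X2 t))%:E)%E.
Proof.
move=> mW1 mW2 W10 W20 mX1 mX2 H phi mphi phi0.
have mphiE : measurable_fun setT (EFin \o phi) by exact/measurable_EFinP.
rewrite !(weighted_integral_approx _ _ _ _ mphiE)//; congr (limn _).
apply/funext => n; rewrite !weighted_integral_simple//.
by apply: eq_fsbigr => r _; rewrite H//.
Qed.

End weighted_integrals.

Section product_formula.
Context {d : measure_display} {T : measurableType d} {R : realType}.
Variable P : probability T R.
Context {I : finType} {d' : measure_display} {U : measurableType d'}.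
Variable X : I -> T -> U.
Hypothesis mX : forall i, measurable_fun setT (X i).
Hypothesis indep : mutually_independent P X.

Let product_formula_indic (B : I -> set U) : (forall i, measurable (B i)) ->
  (\int[P]_t (\prod_i \1_(B i) (X i t))%:E =
   \prod_i \int[P]_t (\1_(B i) (X i t) : R)%:E)%E.
Proof.
move=> mB.
have mXB i : measurable (X i @^-1` B i) by rewrite -[X in measurable X]setTI; exact: mX.
have intE i : (\int[P]_t (\1_(B i) (X i t) : R)%:E = P (X i @^-1` B i))%E.
  transitivity (\int[P]_t (\1_(X i @^-1` B i) t : R)%:E)%E.
    by apply: eq_integral => t _; rewrite !indicE.
  by rewrite integral_indic// setIT.
under [in RHS]eq_bigr do rewrite intE.
have := indep [set: I]%SET mB.
under [in X in _ = X -> _]eq_bigl do rewrite finset.in_setT.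
move=> <-.
set A := \bigcap_(i in _) _.
have mA : measurable A.
  apply: fin_bigcap_measurable; first exact: finite_finset.
  by move=> i _; exact: mXB.
transitivity (\int[P]_t (\1_A t : R)%:E)%E.
  apply: eq_integral => t _; congr EFin.
  rewrite [RHS]indicE; have [At|nAt] := boolP (t \in A).
    rewrite big1// => i _; rewrite indicE; move: At; rewrite inE => /(_ i).
    by rewrite /= finset.in_setT => /(_ isT) ?; rewrite mem_set.
  have [i nBi] : exists i, ~ B i (X i t).
    apply/existsNP => h; move/negP: nAt; apply; rewrite inE => i _; exact: h.
  by rewrite (bigD1 i)//= indicE memNset// mul0r.
by rewrite integral_indic// setIT.
Qed.

(** Independence is the case of indicator functions. They are replaced by the
    [f i] one index at a time, the product of the other factors serving as weight:
    the induction is on the set [J] of the indices already treated. *)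
Lemma ge0_integral_prod_indep (f : I -> U -> R) :
    (forall i, measurable_fun setT (f i)) -> (forall i u, 0 <= f i u) ->
    (forall i, \int[P]_t (f i (X i t))%:E < +oo)%E ->
  (\int[P]_t (\prod_i f i (X i t))%:E =
   \prod_i \int[P]_t (f i (X i t))%:E)%E.
Proof.
move=> mf f0 foo.
suff H (n : nat) (J : {set I}) : #|J| = n -> forall g : I -> U -> R,
    (forall i, measurable_fun setT (g i)) -> (forall i u, 0 <= g i u) ->
    (forall i, \int[P]_t (g i (X i t))%:E < +oo)%E ->
    (forall i, i \notin J ->
      exists2 B : set U, measurable B & g i = \1_B :> (U -> R)) ->
    (\int[P]_t (\prod_i g i (X i t))%:E = \prod_i \int[P]_t (g i (X i t))%:E)%E.
  by apply: (H _ [set: I]%SET erefl) => // i; rewrite finset.in_setT.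
elim: n J => [|n IH] J cJ g mg g0 goo gJ.
  have J0 i : i \notin J by rewrite (cards0_eq cJ) finset.in_set0.
  pose B i := sval (cid2 (gJ i (J0 i))).
  have mB i : measurable (B i) by rewrite /B; case: cid2.
  have gB i : g i = \1_(B i) by rewrite /B; case: cid2.
  under eq_integral do under eq_bigr do rewrite gB.
  by rewrite product_formula_indic//; apply: eq_bigr => i _; rewrite gB.
have [j jJ] : exists j, j \in J by apply/set0Pn; rewrite -cards_eq0 cJ.
pose c := fine (\prod_(i | i != j) \int[P]_t (g i (X i t))%:E)%E.
have Efin i : (\int[P]_t (g i (X i t))%:E \is a fin_num)%E.
  by rewrite ge0_fin_numE// integral_ge0// => t _; rewrite lee_fin.
have cE : (c%:E = \prod_(i | i != j) \int[P]_t (g i (X i t))%:E)%E.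
  by rewrite /c fineK//; apply: (big_ind (fun x => x \is a fin_num)) => //;
    exact: fin_numM.
have c0 : 0 <= c.
  by rewrite -lee_fin cE; apply: prode_ge0 => i _; apply: integral_ge0 => t _;
    rewrite lee_fin.
have mgX i : measurable_fun setT (fun t => g i (X i t)).
  exact: (measurableT_comp (mg i) (mX i)).
have := @weighted_integral_eq R _ U _ _ T T P P
   (fun t => \prod_(i | i != j) g i (X i t)) (cst c) (X j) (X j) _ _ _ _
   (mX j) (mX j) _ (g j) (mg j) (g0 j).
move=> H; rewrite [RHS](bigD1 j)//= muleC -cE.
transitivity (\int[P]_t ((\prod_(i | i != j) g i (X i t)) * g j (X j t))%:E)%E.
  by apply: eq_integral => t _; rewrite (bigD1 j)//= mulrC.
rewrite {}H//.
- under eq_integral do rewrite EFinM.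
  rewrite ge0_integralZl_EFin//; first by move=> t _; rewrite lee_fin.
  exact/measurable_EFinP.
- rewrite (_ : (fun t => _) =
      (fun t => \prod_i (if i != j then g i (X i t) else 1))); last first.
    by apply/funext => t; exact: big_mkcond.
  by apply: measurable_prod => i _; case: (i != j).
- by move=> t; apply: prodr_ge0 => i _.
- move=> B mB.
  pose g' i := if i == j then \1_B else g i.
  have g'j : g' j = \1_B by rewrite /g' eqxx.
  have g'n i : i != j -> g' i = g i by rewrite /g' => /negbTE ->.
  transitivity (\int[P]_t (\prod_i g' i (X i t))%:E)%E.
    apply: eq_integral => t _; rewrite [in RHS](bigD1 j)//= g'j mulrC.
    by congr (_ * _)%:E; apply: eq_bigr => i ij; rewrite g'n.
  have mBX : measurable_fun setT (fun t => \1_B (X j t) : R).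
    by apply: (@measurableT_comp _ _ _ _ _ _ (\1_B : U -> R) setT (X j)).
  rewrite (IH (J :\ j)).
  + under eq_integral do rewrite EFinM.
    rewrite (bigD1 j)//= g'j ge0_integralZl_EFin//; last first.
      exact/measurable_EFinP.
    rewrite cE muleC; congr (_ * _)%E.
    by apply: eq_bigr => i ij; rewrite g'n.
  + by move: cJ; rewrite (cardsD1 j) jJ add1n => -[].
  + by move=> i; rewrite /g'; case: ifP => // _; exact: measurable_indic.
  + by move=> i u; rewrite /g'; case: ifP.
  + move=> i; rewrite /g'; case: ifP => // /eqP ->.
    have := @integral_indic _ T R P setT measurableT (X j @^-1` B).
    rewrite setIT => h.
    transitivity (\int[P]_t (\1_(X j @^-1` B) t : R)%:E < +oo)%E.
      by congr (_ < _)%E; apply: eq_integral => t _; rewrite !indicE.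
    have mXB : measurable (X j @^-1` B) by rewrite -[X in measurable X]setTI; exact: mX.
    by rewrite h// (le_lt_trans (probability_le1 _ _))// ltry.
  + move=> i; rewrite finset.in_setD1 negb_and negbK => /orP[/eqP ->|iJ].
      by exists B.
    rewrite /g'; case: ifP => [_|_]; first by exists B.
    exact: gJ.
Qed.

End product_formula.

(** * Complex expectations of products *)

Section four_parts.
Variable R : rcfType.
Local Notation C := R[i].
Local Notation reC := (@complex.Re R).
Local Notation imC := (@complex.Im R).

Definition iroot : C := (0 +i* 1)%C.

(** The positive part of the component of [z] along [i ^ k], so that
    [z = sum_(k < 4) i ^ k z_k] with [z_k >= 0]: products of complex variables
    expand into products of nonnegative ones. *)
Definition quarter_part (k : 'I_4) (z : C) : R :=
  Num.max (reC (z * (- iroot) ^+ k)) 0.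

Lemma quarter_part_ge0 k z : 0 <= quarter_part k z.
Proof. by rewrite /quarter_part le_max lexx orbT. Qed.

Lemma quarter_partS (k : 'I_4) z : quarter_part k z =
  Num.max (nth 0 [:: reC z; imC z; - reC z; - imC z] k) 0.
Proof.
case: z => x y; rewrite /quarter_part; congr Num.max.
by case: k => [[|[|[|[|//]]]]] /= _; rewrite ?exprS ?expr0 ?mulr1 /iroot /=; ring.
Qed.

Lemma quarter_partE z : z = \sum_(k < 4) iroot ^+ k * (quarter_part k z)%:C%C.
Proof.
have maxB (a : R) : Num.max a 0 - Num.max (- a) 0 = a.
  have [a0|a0] := leP 0 a.
    by rewrite max_r ?oppr_le0// subr0.
  by rewrite max_l ?oppr_ge0 1?ltW// opprK add0r.
rewrite !big_ord_recr big_ord0 /= add0r !quarter_partS /=.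
case: z => x y /=; rewrite !exprS !expr0 !mulr1 /iroot.
move: (maxB x) (maxB y).
set a := Num.max x 0; set b := Num.max (- x) 0.
set a' := Num.max y 0; set b' := Num.max (- y) 0 => <- <-.
by apply/eqP; rewrite eq_complex /=; apply/andP; split; apply/eqP; ring.
Qed.

Lemma quarter_part_le k z : quarter_part k z <= `|reC z| + `|imC z|.
Proof.
rewrite quarter_partS ge_max addr_ge0 ?normr_ge0// andbT.
case: k => [[|[|[|[|//]]]]] /= _.
- by rewrite (le_trans (ler_norm _))// lerDl.
- by rewrite (le_trans (ler_norm _))// lerDr.
- by rewrite -normrN (le_trans (ler_norm _))// lerDl.
- by rewrite -(normrN (imC z)) (le_trans (ler_norm _))// lerDr.
Qed.

End four_parts.

Section complex_expectation.
Context {d : measure_display} {T : measurableType d} {R : realType}.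
Variable P : probability T R.
Local Notation C := R[i].
Local Notation reC := (@complex.Re R).
Local Notation imC := (@complex.Im R).
Implicit Types Z : T -> C.

(** Under this condition the complex expectation is linear. *)
Definition cintegrable Z :=
  P.-integrable setT (EFin \o (reC \o Z)) /\
  P.-integrable setT (EFin \o (imC \o Z)).

Let E (x : T -> R) := fine ('E_P[x])%E.

Let ED (x y : T -> R) : P.-integrable setT (EFin \o x) ->
  P.-integrable setT (EFin \o y) -> E (x \+ y) = E x + E y.
Proof.
move=> ix iy; rewrite /E unlock.
have -> : (\int[P]_w ((x \+ y) w)%:E = \int[P]_w ((x w)%:E + (y w)%:E))%E.
  by apply: eq_integral.
rewrite integralD//= fineD//; exact: integrable_fin_num.
Qed.

Let EZ (a : R) (x : T -> R) : P.-integrable setT (EFin \o x) ->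
  E (fun w => a * x w) = a * E x.
Proof.
move=> ix; rewrite /E unlock.
under eq_integral do rewrite EFinM.
rewrite integralZl//= fineM//; exact: integrable_fin_num.
Qed.

Let iD (x y : T -> R) : P.-integrable setT (EFin \o x) ->
  P.-integrable setT (EFin \o y) -> P.-integrable setT (EFin \o (x \+ y)).
Proof. by move=> ix iy; exact: (integrableD measurableT ix iy). Qed.

Let iZ (a : R) (x : T -> R) : P.-integrable setT (EFin \o x) ->
  P.-integrable setT (EFin \o (fun w => a * x w)).
Proof. by move=> ix; exact: (integrableZl measurableT a ix). Qed.

Let cexpE Z : cexpectation P Z = (E (reC \o Z) +i* E (imC \o Z))%C.
Proof. by []. Qed.

Lemma cexpectationD Z1 Z2 : cintegrable Z1 -> cintegrable Z2 ->
  cintegrable (Z1 \+ Z2) /\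
  cexpectation P (Z1 \+ Z2) = cexpectation P Z1 + cexpectation P Z2.
Proof.
move=> [r1 i1] [r2 i2].
have ReD : reC \o (Z1 \+ Z2) = (reC \o Z1) \+ (reC \o Z2).
  by apply/funext => w /=; rewrite raddfD.
have ImD : imC \o (Z1 \+ Z2) = (imC \o Z1) \+ (imC \o Z2).
  by apply/funext => w /=; rewrite raddfD.
split; first by split; rewrite ?ReD ?ImD; exact: iD.
by rewrite !cexpE ReD ImD !ED.
Qed.

Lemma cexpectationZ (a : C) Z : cintegrable Z ->
  cintegrable (fun w => a * Z w) /\
  cexpectation P (fun w => a * Z w) = a * cexpectation P Z.
Proof.
move=> [r i]; case: a => a b.
have ReZ : reC \o (fun w => (a +i* b)%C * Z w) =
    (fun w => a * (reC \o Z) w) \+ (fun w => (- b) * (imC \o Z) w).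
  by apply/funext => w /=; case: (Z w) => x y /=; rewrite mulNr.
have ImZ : imC \o (fun w => (a +i* b)%C * Z w) =
    (fun w => a * (imC \o Z) w) \+ (fun w => b * (reC \o Z) w).
  by apply/funext => w /=; case: (Z w) => x y /=.
split; first by split; rewrite ?ReZ ?ImZ; apply: iD; exact: iZ.
rewrite !cexpE ReZ ImZ !ED ?EZ//; [|exact: iZ..].
by apply/eqP; rewrite eq_complex/= mulNr !eqxx.
Qed.

Lemma cexpectation0 : cintegrable (fun=> 0) /\ cexpectation P (fun=> 0) = 0.
Proof.
split; first by split; exact: integrable0.
by rewrite /cexpectation /= expectation_cst.
Qed.

Lemma cexpectation_sum (K : finType) (a : K -> C) (Z : K -> T -> C) :
    (forall k, cintegrable (Z k)) ->
  cintegrable (fun w => \sum_k a k * Z k w) /\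
  cexpectation P (fun w => \sum_k a k * Z k w) =
    \sum_k a k * cexpectation P (Z k).
Proof.
move=> intZ.
pose S (s : seq K) (w : T) := \sum_(k <- s) a k * Z k w.
suff H s : cintegrable (S s) /\
    cexpectation P (S s) = \sum_(k <- s) a k * cexpectation P (Z k) by exact: H.
elim: s => [|k s [iS ES]].
  rewrite /S big_nil; under eq_fun do rewrite big_nil.
  exact: cexpectation0.
have [iaZ EaZ] := cexpectationZ (a k) (intZ k).
have [iaS EaS] := cexpectationD iaZ iS.
have -> : S (k :: s) = (fun w => a k * Z k w) \+ S s.
  by apply/funext => w; rewrite /S big_cons.
by rewrite big_cons; split=> //; rewrite EaS EaZ ES.
Qed.

End complex_expectation.

Section complex_product.
Context {d : measure_display} {T : measurableType d} {R : realType}.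
Variable P : probability T R.
Local Notation C := R[i].
Local Notation reC := (@complex.Re R).
Local Notation imC := (@complex.Im R).

Lemma cexpectation_real (x : T -> R) : P.-integrable setT (EFin \o x) ->
  cintegrable P (fun w => (x w)%:C%C) /\
  cexpectation P (fun w => (x w)%:C%C) = (fine (\int[P]_w (x w)%:E)%E)%:C%C.
Proof.
move=> ix; split.
  by split=> //; exact: (@integrable0 _ T R P setT).
rewrite /cexpectation /= expectation_cst /=.
by rewrite unlock.
Qed.

Lemma measurable_quarter_part {d' : measure_display} {U : measurableType d'}
    (f : U -> C) k : measurable_fun setT (reC \o f) ->
  measurable_fun setT (imC \o f) ->
  measurable_fun setT (fun u => quarter_part k (f u)).
Proof.
move=> mr mi.
rewrite (_ : (fun u => _) = (fun u => nth 0 [:: reC (f u); imC (f u);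
    - reC (f u); - imC (f u)] k) \max cst 0); last first.
  by apply/funext => u; rewrite quarter_partS.
apply: measurable_maxr => //.
case: k => [[|[|[|[|//]]]]] /= _ //.
  by apply: measurableT_comp mr.
by apply: measurableT_comp mi.
Qed.

Context {I : finType} {d' : measure_display} {U : measurableType d'}.
Variable X : I -> T -> U.
Hypothesis mX : forall i, measurable_fun setT (X i).
Hypothesis indep : mutually_independent P X.

(** Expand every factor into its four nonnegative parts, apply the product formula
    for nonnegative functions to each term, and recombine. *)
Lemma cexpectation_prod_indep (f : I -> U -> C) :
    (forall i, measurable_fun setT (reC \o f i)) ->
    (forall i, measurable_fun setT (imC \o f i)) ->
    (forall i, cintegrable P (f i \o X i)) ->
  cintegrable P (fun w => \prod_i f i (X i w)) /\
  cexpectation P (fun w => \prod_i f i (X i w)) =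
    \prod_i cexpectation P (f i \o X i).
Proof.
move=> mr mi intf.
pose g i k u := quarter_part k (f i u).
have mg i k : measurable_fun setT (g i k) by exact: measurable_quarter_part.
have g0 i k u : 0 <= g i k u by exact: quarter_part_ge0.
have mgX i k : measurable_fun setT (fun w => g i k (X i w)).
  exact: (measurableT_comp (mg i k) (mX i)).
have intg i k : P.-integrable setT (EFin \o (fun w => g i k (X i w))).
  have [ir im] := intf i.
  have irm := integrableD measurableT (integrable_abse ir) (integrable_abse im).
  apply: (le_integrable measurableT _ _ irm); first exact/measurable_EFinP.
  move=> w _ /=; rewrite ger0_norm// lee_fin.
  by rewrite (le_trans (quarter_part_le _ _))// ler_norm.
have goo i k : (\int[P]_w (g i k (X i w))%:E < +oo)%E.
  have := integrable_fin_num measurableT (intg i k).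
  by rewrite ge0_fin_numE// integral_ge0// => w _; rewrite lee_fin.
pose e i k := fine (\int[P]_w (g i k (X i w))%:E)%E.
have eE i k : ((e i k)%:E = \int[P]_w (g i k (X i w))%:E)%E.
  by rewrite fineK//; exact: (integrable_fin_num measurableT (intg i k)).
pose Z (q : {ffun I -> 'I_4}) w : C := (\prod_i g i (q i) (X i w))%:C%C.
have mZ (q : {ffun I -> 'I_4}) :
    measurable_fun setT (fun w => \prod_i g i (q i) (X i w)).
  by apply: measurable_prod => i _.
have EZ (q : {ffun I -> 'I_4}) :
    (\int[P]_w (\prod_i g i (q i) (X i w))%:E = (\prod_i e i (q i))%:E)%E.
  rewrite (ge0_integral_prod_indep mX indep (f := fun i => g i (q i)))//.
  rewrite (big_morph EFin EFinM (erefl _)).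
  by apply: eq_bigr => i _; rewrite eE.
have iZ (q : {ffun I -> 'I_4}) :
    P.-integrable setT (EFin \o (fun w => \prod_i g i (q i) (X i w))).
  apply/integrableP; split; first exact/measurable_EFinP.
  under eq_integral.
    move=> w _; rewrite /= ger0_norm; last by apply: prodr_ge0 => i _.
    over.
  by rewrite EZ ltry.
have [iS ES] := cexpectation_sum (fun q : {ffun I -> 'I_4} => \prod_i iroot R ^+ q i)
   (fun q => (cexpectation_real (iZ q)).1).
have fE w : \prod_i f i (X i w) = \sum_(q : {ffun I -> 'I_4})
    (\prod_i iroot R ^+ q i) * (\prod_i g i (q i) (X i w))%:C%C.
  under eq_bigr do rewrite (quarter_partE (f _ _)).
  rewrite bigA_distr_bigA; apply: eq_bigr => q _.
  by rewrite big_split /= rmorph_prod.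
under eq_fun do rewrite fE.
split=> //; rewrite {}ES.
transitivity (\prod_i \sum_(k < 4) iroot R ^+ k * (e i k)%:C%C).
  rewrite bigA_distr_bigA; apply: eq_bigr => q _.
  rewrite big_split /=; congr (_ * _).
  by rewrite (cexpectation_real (iZ q)).2 EZ /= rmorph_prod.
apply: eq_bigr => i _.
have [_ ES] := cexpectation_sum (fun k : 'I_4 => iroot R ^+ k)
   (fun k => (cexpectation_real (intg i k)).1).
transitivity (\sum_(k < 4) iroot R ^+ k *
    cexpectation P (fun w => (g i k (X i w))%:C%C)).
  by apply: eq_bigr => k _; rewrite (cexpectation_real (intg i k)).2.
rewrite -ES; congr cexpectation; apply/funext => w /=.
by rewrite [RHS]quarter_partE.
Qed.

End complex_product.

(** * Second moments of the coefficients for Ginibre matrices *)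

Section ginibre_second_moments.
Context {d : measure_display} {T : measurableType d} {R : realType}.
Variable P : probability T R.
Local Notation C := R[i].
Local Notation reC := (@complex.Re R).
Local Notation imC := (@complex.Im R).
Variables (N : nat) (G : T -> 'M[C]_N).
Hypothesis hG : ginibre P G.

Let X (ij : 'I_N * 'I_N) w : measurableTypeC R := G w ij.1 ij.2.

Let mX ij : measurable_fun setT (X ij).
Proof. by have [] := ginibre_gaussian hG ij.1 ij.2. Qed.

Let mre := @measurable_reC R.
Let mim := @measurable_imC R.

Let msq : measurable_fun setT (@sqnormC R : measurableTypeC R -> R).
Proof.
rewrite (_ : @sqnormC R = (fun z : measurableTypeC R => reC z ^+ 2) \+ (fun z => imC z ^+ 2))//.
by apply: measurable_funD; [exact: (measurable_funX 2 mre)|exact: (measurable_funX 2 mim)].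
Qed.

(** The variance hypothesis implies integrability: an infinite second moment would
    have finite part 0, which is not [N ^ -1]. *)
Lemma ginibre_entry_sqnorm ij :
  P.-integrable setT (EFin \o (fun w => sqnormC (G w ij.1 ij.2))) /\
  (\int[P]_w (sqnormC (G w ij.1 ij.2))%:E = (N%:R^-1)%:E)%E.
Proof.
have N0 : (0 < N)%N by case: N ij => [|//] [[]].
have := ginibre_variance hG ij.1 ij.2.
have -> : (N%:R^-1 : C) = (N%:R^-1 : R)%:C%C by rewrite fmorphV rmorph_nat.
move=> /(congr1 reC) /=.
rewrite unlock.
have -> : (fun x : T => (reC (`|G x ij.1 ij.2| ^+ 2))%:E) =
   (fun w => (sqnormC (G w ij.1 ij.2))%:E).
  by apply/funext => w; rewrite sqnormCE.
set I := (\int[P]_w _)%E => EI.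
have I0 : (0 <= I)%E by apply: integral_ge0 => w _; rewrite lee_fin sqnormC_ge0.
have Ifin : (I \is a fin_num)%E.
  move: I0 EI; case: I => [r|_ /= /esym/eqP|] //.
  by rewrite invr_eq0 pnatr_eq0 => /eqP N0'; rewrite N0' in N0.
have IE : (I = (N%:R^-1)%:E)%E by rewrite -EI fineK.
split=> //; apply/integrableP; split.
  by apply/measurable_EFinP; exact: (measurableT_comp msq (mX ij)).
under eq_integral do rewrite /= ger0_norm ?sqnormC_ge0//.
by rewrite -/I IE ltry.
Qed.

Lemma ginibre_entry_integrable ij : cintegrable P (fun w => G w ij.1 ij.2).
Proof.
have [isq _] := ginibre_entry_sqnorm ij.
have i1 : P.-integrable setT (EFin \o cst (1 : R)) :=
    finite_measure_integrable_cst P 1 measurableT.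
have i2 := integrableD measurableT i1 isq.
have dom (x y : R) : `|x| <= `|1 + (x ^+ 2 + y ^+ 2)|.
  rewrite (ger0_norm (_ : 0 <= 1 + _)) ?addr_ge0 ?sqr_ge0//.
  rewrite ler_norml; apply/andP; split; nra.
split; apply: (le_integrable measurableT _ _ i2).
- by apply/measurable_EFinP; exact: (measurableT_comp mre (mX ij)).
- by move=> w _ /=; rewrite -?EFinD lee_fin dom.
- by apply/measurable_EFinP; exact: (measurableT_comp mim (mX ij)).
- by move=> w _ /=; rewrite -?EFinD lee_fin /sqnormC (addrC (_ ^+ 2)) dom.
Qed.

(* The factor of a product of one monomial and a conjugate one at a given entry:
   b1 and b2 tell whether the entry occurs in the first and in the second. *)
Let cellf (b1 b2 : bool) (z : C) : C :=
  (if b1 then z else 1) * (if b2 then conjc z else 1).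

Let mcellf b1 b2 : measurable_fun setT (reC \o cellf b1 b2 : measurableTypeC R -> R)
  /\ measurable_fun setT (imC \o cellf b1 b2 : measurableTypeC R -> R).
Proof.
rewrite /cellf; case: b1 b2 => -[]; split.
- rewrite (_ : _ \o _ = @sqnormC R)//.
  by apply/funext => -[x y] /=; rewrite /sqnormC /=; ring.
- rewrite (_ : _ \o _ = cst 0)//.
  by apply/funext => -[x y] /=; ring.
- rewrite (_ : _ \o _ = reC)//.
  by apply/funext => z /=; rewrite mulr1.
- rewrite (_ : _ \o _ = imC)//.
  by apply/funext => z /=; rewrite mulr1.
- rewrite (_ : _ \o _ = reC)//.
  by apply/funext => z /=; rewrite mul1r; case: z.
- rewrite (_ : _ \o _ = (fun z : measurableTypeC R => - imC z)); last first.
    by apply/funext => z /=; rewrite mul1r; case: z.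
  exact: measurableT_comp mim.
- by rewrite (_ : _ \o _ = cst 1)//; apply/funext => z /=; ring.
- by rewrite (_ : _ \o _ = cst 0)//; apply/funext => z /=; ring.
Qed.

Let cellf_moment ij b1 b2 : cintegrable P (cellf b1 b2 \o X ij) /\
  cexpectation P (cellf b1 b2 \o X ij) =
    if b1 && b2 then N%:R^-1 else (~~ (b1 || b2))%:R.
Proof.
have [isq Esq] := ginibre_entry_sqnorm ij.
have [ir ii] := ginibre_entry_integrable ij.
case: b1 b2 => -[] /=.
- have -> : cellf true true \o X ij = fun w => (sqnormC (G w ij.1 ij.2))%:C%C.
    apply/funext => w; rewrite /cellf /= /X; case: (G w _ _) => x y.
    by apply/eqP; rewrite eq_complex /sqnormC /=; apply/andP; split; apply/eqP; ring.
  have [? ->] := cexpectation_real isq; split => //.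
  by rewrite Esq /= fmorphV rmorph_nat.
- have -> : cellf true false \o X ij = fun w => G w ij.1 ij.2.
    by apply/funext => w; rewrite /cellf /= mulr1.
  by split; [exact: ginibre_entry_integrable|exact: ginibre_centred].
- have -> : cellf false true \o X ij = fun w => conjc (G w ij.1 ij.2).
    by apply/funext => w; rewrite /cellf /= mul1r.
  have reE : reC \o (fun w => conjc (G w ij.1 ij.2)) = reC \o (fun w => G w ij.1 ij.2).
    by apply/funext => w /=; case: (G w _ _).
  have imE : imC \o (fun w => conjc (G w ij.1 ij.2)) =
      (fun w => - imC (G w ij.1 ij.2)).
    by apply/funext => w /=; case: (G w _ _).
  have iN : P.-integrable setT (EFin \o (fun w => - imC (G w ij.1 ij.2))).
    exact: (integrableN ii).
  split; first by split; rewrite ?reE ?imE.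
  have EN : (fine ('E_P[(fun w => (- imC (G w ij.1 ij.2))%R)]) =
      (- fine ('E_P[imC \o (fun w => G w ij.1 ij.2)]))%R)%E.
    rewrite unlock -fineN; congr fine.
    transitivity (\int[P]_w ((-1)%:E * (imC (G w ij.1 ij.2))%:E))%E.
      by apply: eq_integral => w _; rewrite -EFinM mulN1r.
    by rewrite (integralZl measurableT ii) EFinN mulN1e.
  have := ginibre_centred hG ij.1 ij.2.
  change (cexpectation P (fun w => G w ij.1 ij.2)) with
    (fine ('E_P[reC \o (fun w => G w ij.1 ij.2)])%E +i*
     fine ('E_P[imC \o (fun w => G w ij.1 ij.2)])%E)%C.
  move=> -[r0 i0].
  change (cexpectation P (fun w => (conjc (G w ij.1 ij.2)))) with
    (fine ('E_P[reC \o (fun w => conjc (G w ij.1 ij.2))])%E +i*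
     fine ('E_P[imC \o (fun w => conjc (G w ij.1 ij.2))])%E)%C.
  by rewrite reE imE EN r0 i0 oppr0.
- have -> : cellf false false \o X ij = fun w => (1 : R)%:C%C.
    by apply/funext => w; rewrite /cellf /= mulr1.
  have i1 : P.-integrable setT (EFin \o (cst (1 : R))).
    exact: finite_measure_integrable_cst.
  have [? ->] := cexpectation_real i1; split => //.
  rewrite (eq_integral (cst 1%E))// integral_cst// mul1e.
  exact: (congr1 (fun x => (fine x)%:C%C) (probability_setT P)).
Qed.

Let pp_mono (k : 'S_N * {set 'I_N}) w : C :=
  \prod_ij (if pp_cell k ij then G w ij.1 ij.2 else 1).

Let pp_mono_pair k k' :
  (fun w => pp_mono k w * conjc (pp_mono k' w)) =
  (fun w => \prod_ij cellf (pp_cell k ij) (pp_cell k' ij) (X ij w)).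
Proof.
apply/funext => w; rewrite rmorph_prod -big_split /=; apply: eq_bigr => ij _.
by rewrite /cellf; case: (pp_cell k' ij) => //; rewrite conjc1.
Qed.

Let pp_mono_moment k k' :
  cintegrable P (fun w => pp_mono k w * conjc (pp_mono k' w)) /\
  cexpectation P (fun w => pp_mono k w * conjc (pp_mono k' w)) =
  \prod_ij (if pp_cell k ij && pp_cell k' ij then N%:R^-1
            else (~~ (pp_cell k ij || pp_cell k' ij))%:R).
Proof.
rewrite pp_mono_pair.
have [|||? ->] := cexpectation_prod_indep mX (ginibre_independent hG)
  (f := fun ij => cellf (pp_cell k ij) (pp_cell k' ij)).
- by move=> ij; have [] := mcellf (pp_cell k ij) (pp_cell k' ij).
- by move=> ij; have [] := mcellf (pp_cell k ij) (pp_cell k' ij).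
- by move=> ij; have [] := cellf_moment ij (pp_cell k ij) (pp_cell k' ij).
split=> //; apply: eq_bigr => ij _.
by rewrite (cellf_moment ij _ _).2.
Qed.

Let pp_mono_orthogonal m k k' : partial_perm m k -> partial_perm m k' ->
  cexpectation P (fun w => pp_mono k w * conjc (pp_mono k' w)) =
    if k == k' then N%:R ^- (N - m) else 0.
Proof.
move=> kP k'P; rewrite (pp_mono_moment k k').2.
have [<-|kk'] := eqVneq k k'.
  rewrite (eq_bigr (fun ij => if pp_cell k ij then N%:R^-1 else 1)) => [|ij _].
    rewrite -big_mkcond prodr_const exprVn; congr (_ ^- _).
    exact: (card_pp_cell kP).
  by rewrite andbb orbb; case: (pp_cell k ij).
(* Some entry occurs in one monomial only, and contributes its mean, 0. *)
have [ij ijP] : exists ij, pp_cell k ij != pp_cell k' ij.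
  apply: contrapT => h; move/eqP: kk'; apply.
  apply: (pp_cell_inj kP k'P) => ij.
  by have [//|ne] := eqVneq (pp_cell k ij) (pp_cell k' ij); case: h; exists ij.
rewrite (bigD1 ij)//=; move: ijP.
by case: (pp_cell k ij); case: (pp_cell k' ij); rewrite //= mul0r.
Qed.

(** By orthogonality only the squared moduli of the terms remain. Each of them has
    mean [N ^ - (N - m)], and the number of terms is given by
    [card_partial_perm]. *)
Lemma ginibre_char_poly_coef m :
  P.-integrable setT (EFin \o (fun w => sqnormC (char_poly (G w))`_m)) /\
  (\int[P]_w (sqnormC (char_poly (G w))`_m)%:E =
    (('C(N, m) * (N - m)`!)%:R / N%:R ^+ (N - m))%:E)%E.
Proof.
pose a (k : 'S_N * {set 'I_N}) : C :=
  if partial_perm m k then (-1) ^+ k.1 * (-1) ^+ (N - m) else 0.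
have cE w : (char_poly (G w))`_m = \sum_k a k * pp_mono k w.
  rewrite char_poly_coef big_mkcond; apply: eq_bigr => k _.
  by rewrite /a; case: ifP; rewrite ?mul0r.
have sqE : (fun w => (sqnormC (char_poly (G w))`_m)%:C%C) = (fun w => \sum_kk
    (a kk.1 * conjc (a kk.2)) * (pp_mono kk.1 w * conjc (pp_mono kk.2 w))).
  apply/funext => w; have -> : (sqnormC (char_poly (G w))`_m)%:C%C =
      (char_poly (G w))`_m * conjc (char_poly (G w))`_m.
    case: (_`_m) => x y; apply/eqP; rewrite eq_complex /sqnormC /=.
    by apply/andP; split; apply/eqP; ring.
  rewrite cE rmorph_sum big_distrlr pair_big /=; apply: eq_bigr => kk _.
  by rewrite rmorphM mulrACA.
have [iS ES] := cexpectation_sum (fun kk => a kk.1 * conjc (a kk.2))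
   (fun kk => (pp_mono_moment kk.1 kk.2).1).
move: iS ES; rewrite -sqE => -[ir _] ES.
have int : P.-integrable setT (EFin \o (fun w => sqnormC (char_poly (G w))`_m)).
  by apply: eq_integrable ir.
split=> //.
have [_] := cexpectation_real int; rewrite {}ES => Esq.
rewrite -[LHS]fineK; last exact: (integrable_fin_num measurableT int).
congr EFin; apply: (@complexI R); rewrite -{}Esq.
rewrite -(pair_big xpredT xpredT (fun k k' => (a k * conjc (a k')) *
  cexpectation P (fun w => pp_mono k w * conjc (pp_mono k' w)))) /=.
rewrite (eq_bigr (fun k => if partial_perm m k then N%:R ^- (N - m) else 0)).
  rewrite -big_mkcond sumr_const card_partial_perm.
  by rewrite rmorphM fmorphV rmorphXn !rmorph_nat mulr_natl.
move=> k _; case: ifP => kP; last first.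
  by rewrite big1// => k' _; rewrite /a kP !mul0r.
rewrite (bigD1 k)//= (pp_mono_orthogonal kP kP) eqxx big1 ?addr0.
  rewrite /a kP rmorphM !rmorphXn rmorphN1 mulrACA -!exprMn mulrNN mulr1.
  by rewrite !expr1n !mul1r.
move=> k' k'k; case: (boolP (partial_perm m k')) => [k'P|/negbTE k'P].
  by rewrite (pp_mono_orthogonal kP k'P) eq_sym (negbTE k'k) mulr0.
by rewrite /a k'P conjc0 mulr0 mul0r.
Qed.

End ginibre_second_moments.

(** * Exponential moments and the trace *)

Section gaussian_mgf.
Context {d : measure_display} {T : measurableType d} {R : realType}.
Variable P : probability T R.

Lemma gaussian_integral (X : T -> R) : gaussian P X ->
  exists m s : R, 0 <= s /\
  forall phi : R -> R, measurable_fun setT phi -> (forall x, 0 <= phi x) ->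
  (\int[P]_w (phi (X w))%:E = if (s == 0)%R then (phi m)%:E else
    \int[lebesgue_measure]_x (phi x * normal_pdf m s x)%:E)%E.
Proof.
move=> [mX [m [s [s0 PX]]]]; exists m, s; split => // phi mphi phi0.
have indXE B : measurable B ->
    (\int[P]_w (1 * (\1_B (X w) : R))%:E = P (X @^-1` B))%E.
  move=> mB; have mXB : measurable (X @^-1` B).
    by rewrite -[X in measurable X]setTI; exact: mX.
  transitivity (\int[P]_w (\1_(X @^-1` B) w : R)%:E)%E.
    by apply: eq_integral => w _; rewrite mul1r.
  by rewrite integral_indic// setIT.
transitivity (\int[P]_w (1 * phi (X w))%:E)%E.
  by apply: eq_integral => w _; rewrite mul1r.
case: ifPn PX => s00 PX.
  rewrite (@weighted_integral_eq R _ _ _ _ T _ P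
    (\d_m : {measure set R -> \bar R}) (cst 1) (cst 1) X id)//.
    under eq_integral do rewrite mul1r.
    rewrite integral_dirac//; last exact/measurable_EFinP.
    by rewrite diracT mul1e.
  move=> B mB; rewrite indXE// PX//.
  under eq_integral do rewrite mul1r.
  rewrite integral_dirac//; last exact/measurable_EFinP/measurable_indic.
  by rewrite diracT mul1e.
rewrite (@weighted_integral_eq R _ _ _ _ T _ P
    lebesgue_measure (cst 1) (normal_pdf m s) X id)//.
- by apply: eq_integral => x _; rewrite mulrC.
- exact: measurable_normal_pdf.
- by move=> x; exact: normal_pdf_ge0.
move=> B mB; rewrite indXE// PX// /normal_prob [LHS]integral_mkcond.

apply: eq_integral => x _; rewrite /= patchE indicE.
by case: ifP => xB; rewrite ?mulr1// mulr0.
Qed.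

(** Completing the square: the exponential tilts the normal density into one with
    another mean. *)
Lemma integral_expR_normal_pdf (m s t : R) : s != 0 ->
  (\int[lebesgue_measure]_x (expR (t * x) * normal_pdf m s x)%:E =
   (expR (m * t + s ^+ 2 * t ^+ 2 / 2))%:E)%E.
Proof.
move=> s0.
transitivity (\int[lebesgue_measure]_x ((expR (m * t + s ^+ 2 * t ^+ 2 / 2))%:E *
    (normal_pdf (m + s ^+ 2 * t) s x)%:E))%E.
  apply: eq_integral => x _; rewrite -EFinM !normal_pdfE// /normal_fun.
  congr EFin; rewrite mulrCA [RHS]mulrCA -!expRD; congr (_ * expR _).
  by rewrite -[s ^+ 2 *+ 2]mulr_natr; field.
rewrite ge0_integralZl_EFin//.
- by rewrite integral_normal_pdf mule1.
- by move=> x _; rewrite lee_fin normal_pdf_ge0.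
- by apply/measurable_EFinP; exact: measurable_normal_pdf.
Qed.

(** The factor 3 makes the integrand half the normal density of standard deviation
    [s / 2]. *)
Lemma integral_gauss_normal_pdf (s : R) : s != 0 ->
  (\int[lebesgue_measure]_x (expR (- (3 / (2 * s ^+ 2) * x ^+ 2)) * normal_pdf 0 s x)%:E =
   (2^-1)%:E)%E.
Proof.
move=> s0; have s20 : s / 2 != 0 by rewrite mulf_neq0// invr_neq0.
transitivity (\int[lebesgue_measure]_x ((2^-1)%:E *
    (normal_pdf 0 (s / 2) x)%:E))%E.
  apply: eq_integral => x _; rewrite -EFinM !normal_pdfE// /normal_fun.
  have -> : normal_peak s = 2^-1 * normal_peak (s / 2).
    rewrite /normal_peak -invfM; congr (_^-1).
    have h2 : 2 = Num.sqrt (2 ^+ 2) :> R by rewrite sqrtr_sqr ger0_norm.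
    rewrite [X in _ = X * _]h2 -sqrtrM ?sqr_ge0//.
    by congr Num.sqrt; rewrite -[LHS]mulr_natr -[X in _ = _ * X]mulr_natr; field.
  congr EFin; rewrite mulrCA -expRD [RHS]mulrA; congr (_ * expR _).
  by rewrite -[s ^+ 2 *+ 2]mulr_natr -[_ ^+ 2 *+ 2]mulr_natr; field.
rewrite ge0_integralZl_EFin//.
- by rewrite integral_normal_pdf mule1.
- by move=> x _; rewrite lee_fin normal_pdf_ge0.
- by apply/measurable_EFinP; exact: measurable_normal_pdf.
Qed.

(** The parameters of the law are estimated through integrals of bounded or
    exponential functions. From [1 + t X <= expR (t X)] for every [t], the mean
    parameter is 0. From [1 - k X^2 <= expR (- k X^2)] with [k = 3 / (2 s^2)], where
    the right-hand side has mean 1/2, one gets [s^2 <= 3 v]. The moment generating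
    function at 1 is then [expR (s^2 / 2)]. *)
Lemma centred_gaussian_mgf_le (X : T -> R) (v : R) : gaussian P X ->
    P.-integrable setT (EFin \o X) -> (\int[P]_w (X w)%:E = 0)%E ->
    (\int[P]_w (X w ^+ 2)%:E <= v%:E)%E ->
  (\int[P]_w (expR (X w))%:E <= (expR (2 * v))%:E)%E.
Proof.
move=> gX iX X0 Xv; have [m [s [s0 XE]]] := gaussian_integral gX.
have [mX _] := gX.
have mexp (t : R) : measurable_fun setT (fun x : R => expR (t * x)).
  by apply: measurableT_comp => //; exact: measurable_funM.
have mgf t : (\int[P]_w (expR (t * X w))%:E =
    (expR (m * t + s ^+ 2 * t ^+ 2 / 2))%:E)%E.
  rewrite (XE (fun x => expR (t * x)))//.
  case: eqVneq => [->|s00]; last exact: integral_expR_normal_pdf.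
  by rewrite expr0n/= !mul0r addr0 mulrC.
have mge0 t : 0 <= m * t + s ^+ 2 * t ^+ 2 / 2.
  rewrite -(ler_expR 0) expR0 -lee_fin -mgf.
  have iexp : P.-integrable setT (EFin \o (fun w => expR (t * X w))).
    apply/integrableP; split.
      by apply/measurable_EFinP; exact: (measurableT_comp (mexp t) mX).
    under eq_integral do rewrite /= ger0_norm ?expR_ge0//.
    by rewrite mgf ltry.
  have i1 : P.-integrable setT (EFin \o cst (1 : R)) :=
    finite_measure_integrable_cst P 1 measurableT.
  have itX := integrableZl measurableT t iX.
  have <- : (\int[P]_w ((1 : R)%:E + t%:E * (X w)%:E) = 1%:E)%E.
    rewrite integralD// integralZl// X0 mule0 adde0.
    by rewrite (eq_integral (cst 1%E))// integral_cst// mul1e; exact: probability_setT.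
  apply: le_integral => //; first exact: integrableD.
  by move=> w _; rewrite -EFinM -EFinD lee_fin expR_ge1Dx.
have m0 : m = 0.
  (* Any t of sign opposite to m and of small size makes the exponent negative. *)
  have := mge0 (- m / (s ^+ 2 + 1)).
  have s1 : 0 < s ^+ 2 + 1 by rewrite ltr_wpDl// sqr_ge0.
  have -> : m * (- m / (s ^+ 2 + 1)) + s ^+ 2 * (- m / (s ^+ 2 + 1)) ^+ 2 / 2 =
     - (m ^+ 2 * (s ^+ 2 + 2) / (2 * (s ^+ 2 + 1) ^+ 2)).
    by field; rewrite gt_eqF.
  rewrite oppr_ge0 pmulr_lle0 ?invr_gt0 ?mulr_gt0 ?exprn_gt0//.
  rewrite pmulr_lle0; last by rewrite ltr_wpDl// sqr_ge0.
  by move=> m2; apply/eqP; rewrite -sqrf_eq0 eq_le m2 sqr_ge0.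
have v0 : 0 <= v.
  rewrite -lee_fin; apply: le_trans Xv; apply: integral_ge0 => w _.
  by rewrite lee_fin sqr_ge0.
have sv : s ^+ 2 <= 3 * v.
  have [->|s00] := eqVneq s 0; first by rewrite expr0n/= mulr_ge0.
  pose k := 3 / (2 * s ^+ 2).
  have s2 : 0 < s ^+ 2 by rewrite exprn_even_gt0.
  have k0 : 0 <= k by rewrite divr_ge0// mulr_ge0// ltW.
  have mphi : measurable_fun setT (fun x : R => expR (- (k * x ^+ 2))).
    apply: measurableT_comp => //; apply: measurableT_comp => //.
    by apply: measurable_funM => //; exact: measurable_funX.
  have := XE (fun x => expR (- (k * x ^+ 2))) mphi (fun x => expR_ge0 _).
  rewrite (negbTE s00) m0 integral_gauss_normal_pdf// => half.
  have mX2 : measurable_fun setT (fun w => X w ^+ 2) by exact: measurable_funX.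
  have : (1%:E <= (2^-1)%:E + k%:E * v%:E :> \bar R)%E.
    apply: (@le_trans _ _ (2^-1%:E + k%:E * \int[P]_w (X w ^+ 2)%:E))%E; last first.
      by rewrite leeD2l// lee_wpmul2l.
    rewrite -half -ge0_integralZl_EFin//; last 2 first.
    - by move=> w _; rewrite lee_fin sqr_ge0.
    - exact/measurable_EFinP.
    rewrite -ge0_integralD//; last 3 first.
    - by apply/measurable_EFinP; exact: (measurableT_comp mphi mX).
    - by move=> w _; rewrite -EFinM lee_fin mulr_ge0// sqr_ge0.
    - by apply: emeasurable_funM => //; exact/measurable_EFinP.
    have <- : (\int[P]_w (cst 1%E w) = 1%:E :> \bar R)%E.
      by rewrite integral_cst// mul1e; exact: probability_setT.
    apply: ge0_le_integral => //.
    - by apply: emeasurable_funD; first exact/measurable_EFinP/(measurableT_comp mphi mX);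
        apply: emeasurable_funM => //; exact/measurable_EFinP.
    - move=> w _; rewrite -EFinM -EFinD lee_fin.
      by rewrite -lerBlDr expR_ge1Dx.
  rewrite -EFinM -EFinD lee_fin /k => h.
  have : 2^-1 * s ^+ 2 <= 3 / 2 * v.
    have -> : 3 / 2 * v = (3 / (2 * s ^+ 2) * v) * s ^+ 2.
      by field; rewrite s00.
    by rewrite ler_pM2r//; lra.
  lra.
have := mgf 1; under eq_integral do rewrite mul1r.
by move=> ->; rewrite lee_fin ler_expR m0 mul0r add0r expr1n mulr1; lra.
Qed.

End gaussian_mgf.

Section ginibre_trace.
Context {d : measure_display} {T : measurableType d} {R : realType}.
Variable P : probability T R.
Local Notation C := R[i].
Local Notation reC := (@complex.Re R).
Local Notation imC := (@complex.Im R).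
Variables (N : nat) (G : T -> 'M[C]_N).
Hypotheses (hG : ginibre P G) (N0 : (0 < N)%N).

Let mre := @measurable_reC R.
Let mim := @measurable_imC R.

Let mX ij : measurable_fun setT (fun w => G w ij.1 ij.2 : measurableTypeC R).
Proof. by have [] := ginibre_gaussian hG ij.1 ij.2. Qed.

Lemma ginibre_entry_mgf (a b : R) ij : a ^+ 2 + b ^+ 2 = 1 ->
  (\int[P]_w (expR (a * reC (G w ij.1 ij.2) + b * imC (G w ij.1 ij.2)))%:E <=
    (expR (2 / N%:R))%:E)%E.
Proof.
move=> ab; have [ir ii] := ginibre_entry_integrable hG ij.
have [_ gY] := ginibre_gaussian hG ij.1 ij.2.
have := ginibre_centred hG ij.1 ij.2.
change (cexpectation P (fun w => G w ij.1 ij.2)) with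
  (fine ('E_P[reC \o (fun w => G w ij.1 ij.2)])%E +i*
   fine ('E_P[imC \o (fun w => G w ij.1 ij.2)])%E)%C.
rewrite unlock => -[r0 i0].
have {}r0 : (\int[P]_w (reC (G w ij.1 ij.2))%:E = 0)%E.
  rewrite -[LHS]fineK; first by congr EFin; exact: r0.
  exact: (integrable_fin_num measurableT ir).
have {}i0 : (\int[P]_w (imC (G w ij.1 ij.2))%:E = 0)%E.
  rewrite -[LHS]fineK; first by congr EFin; exact: i0.
  exact: (integrable_fin_num measurableT ii).
have [isq Esq] := ginibre_entry_sqnorm hG ij.
have iar := integrableZl measurableT a ir.
have ibi := integrableZl measurableT b ii.
apply: centred_gaussian_mgf_le (gY a b) _ _ _.
- exact: (integrableD measurableT iar ibi).
- transitivity (\int[P]_w (a%:E * (reC (G w ij.1 ij.2))%:E +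
      b%:E * (imC (G w ij.1 ij.2))%:E))%E.
    by apply: eq_integral.
  rewrite (integralD measurableT iar ibi).
  rewrite (integralZl measurableT ir) (integralZl measurableT ii).
  by rewrite /= r0 i0 !mule0 adde0.
- rewrite -Esq; apply: ge0_le_integral => //.
  + by move=> w _; rewrite lee_fin sqr_ge0.
  + apply/measurable_EFinP; apply: measurable_funX.
    apply: measurable_funD; apply: measurable_funM => //.
      exact: (measurableT_comp mre (mX ij)).
    exact: (measurableT_comp mim (mX ij)).
  + by have /integrableP[] := isq.
  + move=> w _; rewrite lee_fin /sqnormC.
    set x := reC _; set y := imC _.
    have : 0 <= (a * y - b * x) ^+ 2 by exact: sqr_ge0.
    have -> : x ^+ 2 + y ^+ 2 = (a ^+ 2 + b ^+ 2) * (x ^+ 2 + y ^+ 2).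
      by rewrite ab mul1r.
    nra.
Qed.

(** The trace is a sum of [N] independent diagonal entries, each contributing a
    factor [expR (2 / N)]. *)
Lemma ginibre_trace_mgf (a b : R) : a ^+ 2 + b ^+ 2 = 1 ->
  (\int[P]_w (expR (a * reC (\tr (G w)) + b * imC (\tr (G w))))%:E <=
    (expR 2)%:E)%E.
Proof.
move=> ab.
pose f (ij : 'I_N * 'I_N) (z : measurableTypeC R) : R :=
  if ij.1 == ij.2 then expR (a * reC z + b * imC z) else 1.
have mf ij : measurable_fun setT (f ij).
  rewrite /f; case: (ij.1 == ij.2) => //.
  by apply: measurableT_comp => //; apply: measurable_funD; apply: measurable_funM.
have f0 ij z : 0 <= f ij z by rewrite /f; case: ifP => // _; exact: expR_ge0.
have intf ij : (\int[P]_w (f ij (G w ij.1 ij.2))%:E <=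
    (if ij.1 == ij.2 then expR (2 / N%:R) else 1)%:E)%E.
  rewrite /f; case: ifP => _; first exact: ginibre_entry_mgf.
  by rewrite (eq_integral (cst 1%E))// integral_cst// mul1e; exact: probability_le1.
have intfoo ij : (\int[P]_w (f ij (G w ij.1 ij.2))%:E < +oo)%E.
  by apply: le_lt_trans (intf ij) _; rewrite ltry.
have diagE (g : 'I_N -> R) : \prod_(ij : 'I_N * 'I_N)
    (if ij.1 == ij.2 then g ij.1 else 1) = \prod_i g i.
  rewrite -(pair_big xpredT xpredT (fun i j => if i == j then g i else 1)) /=.
  apply: eq_bigr => i _; rewrite (bigD1 i)//= eqxx big1 ?mulr1// => j.
  by rewrite eq_sym => /negbTE ->.
have -> : (\int[P]_w (expR (a * reC (\tr (G w)) + b * imC (\tr (G w))))%:E =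
    \int[P]_w (\prod_ij f ij (G w ij.1 ij.2))%:E)%E.
  apply: eq_integral => w _; congr EFin.
  rewrite (eq_bigr (fun ij : 'I_N * 'I_N => if ij.1 == ij.2 then
    expR (a * reC (G w ij.1 ij.1) + b * imC (G w ij.1 ij.1)) else 1)).
    rewrite (diagE (fun i => expR (a * reC (G w i i) + b * imC (G w i i)))).
    rewrite -expR_sum; congr expR.
    by rewrite big_split /= -!mulr_sumr /mxtrace !raddf_sum.
  by move=> ij _; rewrite /f; case: eqP => [->|].
rewrite (ge0_integral_prod_indep mX (ginibre_independent hG))//.
have <- : \prod_(ij : 'I_N * 'I_N) (if ij.1 == ij.2 then expR (2 / N%:R) else 1) =
    expR 2 :> R.
  rewrite (diagE (fun=> expR (2 / N%:R))) prodr_const card_ord -expRM_natl.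
  by congr expR; rewrite mulrC divfK// pnatr_eq0 -lt0n.
rewrite (big_morph EFin EFinM (erefl _)).
suff : (0 <= \prod_ij \int[P]_w (f ij (G w ij.1 ij.2))%:E <=
    \prod_(ij : 'I_N * 'I_N) (if (ij.1 == ij.2)%R then expR (2 / N%:R) else 1)%:E)%E.
  by case/andP.
apply: (big_ind2 (fun x y : \bar R => 0 <= x <= y)%E) => [|x1 x2 y1 y2|ij _].
- by rewrite lexx lee01.
- move=> /andP[x0 x12] /andP[y0 y12]; rewrite mule_ge0//=.
  exact: lee_pmul.
- by rewrite intf andbT; apply: integral_ge0 => w _; rewrite lee_fin.
Qed.

(** For [x >= 0], [(x / 4) ^ 4 <= (1 + x / 4) ^ 4 <= expR x], and
    [256 = 4 ^ 4]. *)
Lemma expr4_le_expR (x : R) : x ^+ 4 <= 256 * (expR x + expR (- x)).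
Proof.
wlog x0 : x / 0 <= x => [h|].
  have [/h//|/ltW x0] := leP 0 x.
  have := h (- x); rewrite oppr_ge0 opprK (addrC (expR (- x))).
  by rewrite (_ : (- x) ^+ 4 = x ^+ 4); [exact|ring].
have x4 : 0 <= x / 4 by rewrite divr_ge0.
have : (1 + x / 4) ^+ 4 <= expR x.
  have -> : expR x = expR (x / 4) ^+ 4 by rewrite -expRM_natl; congr expR; field.
  by rewrite lerXn2r ?nnegrE ?expR_ge0 ?addr_ge0 ?expR_ge1Dx.
move=> h; have e0 := expR_ge0 (- x).
have : (x / 4) ^+ 4 <= (1 + x / 4) ^+ 4 by rewrite lerXn2r ?nnegrE ?lerDr ?addr_ge0.
have -> : x ^+ 4 = 256 * (x / 4) ^+ 4 by field.
move=> h'; rewrite ler_pM2l//; lra.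
Qed.

(** With [x] and [y] the real and imaginary parts,
    [(x^2 + y^2)^2 <= 2 (x^4 + y^4)] is at most [512 = 2 * 256] times the sum of the
    exponentials of [x], [-x], [y], [-y], of mean at most [4 expR 2]. *)
Lemma ginibre_trace_fourth_moment :
  (\int[P]_w ((sqnormC (\tr (G w))) ^+ 2)%:E <= (2048 * expR 2)%:E)%E.
Proof.
pose e a b w := expR (a * reC (\tr (G w)) + b * imC (\tr (G w))).
have mtr : measurable_fun setT (fun w => reC (\tr (G w))) /\
    measurable_fun setT (fun w => imC (\tr (G w))).
  rewrite /mxtrace; split.
    rewrite (_ : (fun w => _) = (fun w => \sum_i reC (G w i i))); last first.
      by apply/funext => w; rewrite raddf_sum.
    by apply: measurable_sum => i; exact: (measurableT_comp mre (mX (i, i))).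
  rewrite (_ : (fun w => _) = (fun w => \sum_i imC (G w i i))); last first.
    by apply/funext => w; rewrite raddf_sum.
  by apply: measurable_sum => i; exact: (measurableT_comp mim (mX (i, i))).
have me a b : measurable_fun setT (e a b).
  by apply: measurableT_comp => //; apply: measurable_funD;
    apply: measurable_funM => //; [exact: mtr.1|exact: mtr.2].
have e0 a b w : 0 <= e a b w by exact: expR_ge0.
pose l : seq (R * R) := [:: (1, 0); (- 1, 0); (0, 1); (0, - 1)].
pose S w := \sum_(ab <- l) e ab.1 ab.2 w.
apply: (@le_trans _ _ (\int[P]_w (512%:E * (S w)%:E))%E).
  apply: ge0_le_integral => //.
  - by move=> w _; rewrite lee_fin sqr_ge0.
  - apply/measurable_EFinP; apply: measurable_funX; apply: measurable_funD.
      exact: (measurable_funX 2 mtr.1).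
    exact: (measurable_funX 2 mtr.2).
  - by apply: emeasurable_funM => //; apply/measurable_EFinP; exact: measurable_sum.
  - move=> w _; rewrite -EFinM lee_fin /S /l !big_cons big_nil /e /=.
    rewrite !mul0r !mul1r !mulN1r !addr0 !add0r /sqnormC.
    have := expr4_le_expR (reC (\tr (G w))); have := expr4_le_expR (imC (\tr (G w))).
    set x := reC _; set y := imC _ => hy hx.
    have : (x ^+ 2 + y ^+ 2) ^+ 2 <= 2 * (x ^+ 4 + y ^+ 4).
      have := sqr_ge0 (x ^+ 2 - y ^+ 2); nra.
    lra.
rewrite ge0_integralZl_EFin//; last 2 first.
- by move=> w _; rewrite lee_fin; apply: sumr_ge0 => ab _.
- by apply/measurable_EFinP; exact: measurable_sum.
have -> : (\int[P]_w (S w)%:E = \sum_(ab <- l) \int[P]_w (e ab.1 ab.2 w)%:E)%E.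
  rewrite -ge0_integral_sum//.
  - by apply: eq_integral => w _; rewrite sumEFin.
  - by move=> ab; apply/measurable_EFinP.
  - by move=> ab w _; rewrite lee_fin.
have -> : ((2048 * expR 2)%:E = 512%:E * (expR 2 *+ 4)%:E :> \bar R)%E.
  by rewrite -EFinM -[_ *+ 4]mulr_natl; congr EFin; ring.
rewrite lee_wpmul2l//.
have -> : ((expR 2 *+ 4)%:E = (expR 2)%:E + ((expR 2)%:E + ((expR 2)%:E +
    ((expR 2)%:E + 0))) :> \bar R)%E.
  by rewrite adde0 -!EFinD; congr EFin; ring.
rewrite /l !big_cons big_nil /=; do ![apply: leeD => //]; apply: ginibre_trace_mgf.
- by rewrite expr1n expr0n/= addr0.
- by rewrite sqrrN expr1n expr0n/= addr0.
- by rewrite expr1n expr0n/= add0r.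
- by rewrite sqrrN expr1n expr0n/= add0r.
Qed.

End ginibre_trace.

(** * Almost sure smallness of the perturbation *)

Section summable_expectations.
Context {d : measure_display} {T : measurableType d} {R : realType}.
Variable mu : {measure set T -> \bar R}.

(** The sum of the series has a finite integral, so it is finite almost
    everywhere; where it is, the terms tend to 0. *)
Lemma ae_cvg0_summable_integral (Y : nat -> T -> R) (M : R) :
    (forall n, measurable_fun setT (Y n)) -> (forall n w, 0 <= Y n w) ->
    (forall n, \sum_(k < n) \int[mu]_w (Y k w)%:E <= M%:E)%E ->
  {ae mu, forall w, Y n w @[n --> \oo] --> (0 : R)}.
Proof.
move=> mY Y0 YM.
pose F w := (\sum_(0 <= n <oo) (Y n w)%:E)%E.
have mYE n : measurable_fun setT (fun w => (Y n w)%:E) by exact/measurable_EFinP.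
have YE0 n w : (0 <= (Y n w)%:E)%E by rewrite lee_fin.
have F0 w : (0 <= F w)%E by apply: nneseries_ge0 => n _ _.
have mF : measurable_fun setT F.
  by apply: ge0_emeasurable_sum => // n w _ _.
have iF : mu.-integrable setT F.
  apply/integrableP; split => //.
  under eq_integral do rewrite gee0_abs//.
  rewrite integral_nneseries//.
  apply: le_lt_trans (ltry M); apply: lime_le.
    apply: ereal_nondecreasing_is_cvgn => m n mn.
    by apply: lee_sum_nneg_natr => // k _ _; exact: integral_ge0.
  by apply: nearW => n; rewrite big_mkord; exact: YM.
have := integrable_ae measurableT iF.
apply: filterS => w /(_ I) Fw.
apply: cvg_series_cvg_0; apply: nondecreasing_is_cvgn.
  by apply/nondecreasing_seqP => n; rewrite /series /= big_nat_recr//= lerDl.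
exists (fine (F w)) => _ [n _ <-]; rewrite /series /=.
rewrite -lee_fin fineK// -sumEFin; apply: nneseries_lim_ge => k _ _.
exact: YE0.
Qed.

End summable_expectations.

Section quartic_root_weight.
Variable R : realType.

(** The parameter [s = N ^ (1/4)] of the weights: [s^2] is negligible against [N]
    while [1 / (s N)] is summable. *)
Definition row_weight (N : nat) : R := Num.sqrt (Num.sqrt N%:R).

Lemma row_weight_gt0 N : (0 < N)%N -> 0 < row_weight N.
Proof. by move=> N0; rewrite !sqrtr_gt0 ltr0n. Qed.

Lemma row_weight_expr4 N : row_weight N ^+ 4 = N%:R.
Proof. by rewrite (exprM _ 2 2) !sqr_sqrtr ?sqrtr_ge0 ?ler0n. Qed.

(** The term of index [N = b ^ 4] is [b ^ -5], at most the telescoping difference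
    [4 / a - 4 / b] with [a ^ 4 = N - 1]. *)
Lemma sum_inv_weight_le n : \sum_(k < n) (row_weight k.+1 * k.+1%:R)^-1 <= 5.
Proof.
case: n => [|n]; first by rewrite big_ord0.
suff : \sum_(k < n.+1) (row_weight k.+1 * k.+1%:R)^-1 <= 5 - 4 / row_weight n.+1.
  by move/le_trans; apply; rewrite gerBl divr_ge0// ltW// row_weight_gt0.
elim: n => [|n IH].
  by rewrite big_ord1 /row_weight !sqrtr1 mulr1 invr1; lra.
rewrite big_ord_recr /=; apply: le_trans (lerD IH (lexx _)) _.
have : row_weight n.+2 ^+ 4 = row_weight n.+1 ^+ 4 + 1.
  by rewrite !row_weight_expr4 -[in LHS]natr1.
rewrite -(row_weight_expr4 n.+2).
move: (row_weight_gt0 (ltn0Sn n)) (row_weight_gt0 (ltn0Sn n.+1)).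
move: (row_weight n.+1) (row_weight n.+2) => a b a0 b0 ab.
have leab : a <= b.
  rewrite leNgt; apply/negP => ba.
  have : b ^+ 4 < a ^+ 4 by rewrite ltr_pXn2r// nnegrE ltW.
  lra.
suff : (b * b ^+ 4)^-1 <= 4 / a - 4 / b by lra.
have -> : 4 / a - 4 / b = 4 * (b - a) / (a * b) by field; rewrite !gt_eqF.
rewrite -[leLHS]mul1r ler_pdivrMr ?mulr_gt0 ?exprn_gt0//.
rewrite mulrAC ler_pdivlMr ?mulr_gt0// mul1r.
(* b - a >= 1 / (4 b ^ 3), as 1 = b ^ 4 - a ^ 4 is b - a times a cubic sum. *)
have e : 1 = (b - a) * ((b + a) * (b ^+ 2 + a ^+ 2)).
  by rewrite -[LHS](addrK (a ^+ 4)) [1 + _]addrC -ab; ring.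
have h : (b + a) * (b ^+ 2 + a ^+ 2) <= 4 * b ^+ 3.
  have a2 : a ^+ 2 <= b ^+ 2 by rewrite ler_pXn2r// nnegrE ltW.
  have -> : 4 * b ^+ 3 = (b + b) * (b ^+ 2 + b ^+ 2) by ring.
  apply: ler_pM; rewrite ?addr_ge0 ?sqr_ge0 ?(ltW a0) ?(ltW b0)//.
  - by rewrite lerD2l.
  - by rewrite lerD2l.
have h1 : 1 <= (b - a) * (4 * b ^+ 3) by rewrite {1}e ler_wpM2l// subr_ge0.
apply: (@le_trans _ _ (b ^+ 2)).
  by rewrite expr2 ler_wpM2r// ltW.
rewrite -[leLHS]mul1r.
have -> : 4 * (b - a) * (b * b ^+ 4) = (b - a) * (4 * b ^+ 3) * b ^+ 2 by ring.
by rewrite ler_wpM2r// sqr_ge0.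
Qed.

Lemma cvg_inv_row_weight : (row_weight n.+1)^-1 @[n --> \oo] --> (0 : R).
Proof.
have -> : (fun n => (row_weight n.+1)^-1) =
    (fun n => Num.sqrt (Num.sqrt (harmonic n : R))).
  by apply/funext => n; rewrite /row_weight -!sqrtrV ?sqrtr_ge0.
rewrite -{1}sqrtr0 -{1}sqrtr0.
apply: continuous_cvg; first exact: sqrt_continuous.
apply: continuous_cvg; first exact: sqrt_continuous.
exact: cvg_harmonic.
Qed.

Lemma cvg_row_weight_cost :
  ((row_weight n.+1 ^+ 2 + row_weight n.+1) / n.+1%:R) @[n --> \oo] --> (0 : R).
Proof.
have -> : (fun n => (row_weight n.+1 ^+ 2 + row_weight n.+1) / n.+1%:R) =
    (fun n => (row_weight n.+1)^-1 * (row_weight n.+1)^-1 +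
       (row_weight n.+1)^-1 * ((row_weight n.+1)^-1 * (row_weight n.+1)^-1)).
  apply/funext => n; rewrite -[in LHS]row_weight_expr4.
  by have := row_weight_gt0 (ltn0Sn n); move: (row_weight _) => a a0; field; rewrite gt_eqF.
rewrite [X in _ --> X](_ : _ = 0 * 0 + 0 * (0 * 0)); last by rewrite !mul0r addr0.
have u0 := cvg_inv_row_weight.
by apply: cvgD; [exact: cvgM|apply: cvgM => //; exact: cvgM].
Qed.

End quartic_root_weight.

Section last_row.
Context {d : measure_display} {T : measurableType d} {R : realType}.
Variable P : probability T R.
Local Notation C := R[i].

(** The part of [last_row_norm] without the last coefficient, whose expectation
    would not be small: it is [1] for every [N]. *)
Definition lower_row_norm (n : nat) (s : R) (c : nat -> C) : R :=
  \sum_(j < n) sqnormC (c j) *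
    ((j`!%:R / n.+1%:R ^+ j) / (n`!%:R / n.+1%:R ^+ n) / (1 + s * (n - j)%:R) ^+ 2).

Lemma last_row_normS n (s : R) (c : nat -> C) :
  last_row_norm n.+1 s c = lower_row_norm n s c + sqnormC (c n).
Proof.
rewrite /last_row_norm big_ord_recr /=; congr (_ + _).
rewrite subnn mulr0 addr0 expr1n divr1 divff ?mulr1//.
Qed.

Lemma lower_row_norm_ge0 n (s : R) c : 0 <= s -> 0 <= lower_row_norm n s c.
Proof.
move=> s0; apply: sumr_ge0 => j _; apply: mulr_ge0; first exact: sqnormC_ge0.
by rewrite divr_ge0 ?sqr_ge0// divr_ge0// divr_ge0// exprn_ge0.
Qed.

Section matrix.
Variables (n : nat) (G : T -> 'M[C]_n.+1).
Hypothesis hG : ginibre P G.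

Let c (j : nat) (w : T) := (char_poly (G w))`_j.

Lemma measurable_ginibre_coef_sqnorm j :
  measurable_fun setT (fun w => sqnormC (c j w)).
Proof.
have [/integrableP[+ _] _] := ginibre_char_poly_coef hG j.
by move/measurable_EFinP.
Qed.

Lemma measurable_ginibre_lower_row (s : R) :
  measurable_fun setT (fun w => lower_row_norm n s (fun j => c j w)).
Proof.
apply: measurable_sum => j; apply: measurable_funM => //.
exact: measurable_ginibre_coef_sqnorm.
Qed.

(** The factorials in [E |c_j|^2] cancel those of the basis norms, which leaves the
    sum of the squared weights over [l = n - j >= 1]. *)
Lemma ginibre_lower_row_expectation (s : R) : 0 < s ->
  (\int[P]_w (lower_row_norm n s (fun j => c j w))%:E <= s^-1%:E)%E.
Proof.
move=> s0; pose k (j : nat) : R :=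
  (j`!%:R / n.+1%:R ^+ j) / (n`!%:R / n.+1%:R ^+ n) / (1 + s * (n - j)%:R) ^+ 2.
have k0 j : 0 <= k j.
  by rewrite divr_ge0 ?sqr_ge0// divr_ge0// divr_ge0// exprn_ge0.
have Ek (j : 'I_n) : (\int[P]_w (sqnormC (c j w) * k j)%:E =
    ((1 + s * (n - j)%:R) ^- 2)%:E)%E.
  have [ic Ec] := ginibre_char_poly_coef hG j.
  under eq_integral do rewrite EFinM.
  rewrite integralZr// [X in (X * _)%E]Ec -EFinM; congr EFin.
  rewrite /k mulrA -[RHS]mul1r; congr (_ / _).
  have jn : (j <= n)%N by exact: ltnW.
  have /(congr1 (fun m : nat => m%:R : R)) := bin_fact (leqW jn).
  rewrite (factS n) !natrM subSn// [in _ ^+ (n - j).+1]exprS.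
  have NR : (n.+1%:R : R) != 0 by rewrite pnatr_eq0.
  have nf : (n`!%:R : R) != 0 by rewrite pnatr_eq0 -lt0n fact_gt0.
  have ne : (n.+1%:R : R) ^+ n = n.+1%:R ^+ j * n.+1%:R ^+ (n - j) by rewrite -exprD subnKC.
  rewrite ne; set b := 'C(_, _)%:R; set f := ((n - j).+1`!)%:R; set g := (j`!)%:R.
  move: (expf_neq0 j NR) (expf_neq0 (n - j) NR) (NR) nf.
  move: (n`!%:R : R) (n.+1%:R : R) (n.+1%:R ^+ j) (n.+1%:R ^+ (n - j)) => h m u v u0 v0 m0 h0 bf.
  apply: (mulIf (mulf_neq0 m0 h0)); rewrite mul1r -[in RHS]bf.
  by field; rewrite u0 v0 m0 h0.
rewrite /lower_row_norm.
under eq_integral do rewrite -sumEFin.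
rewrite ge0_integral_sum//; last 2 first.
- move=> j; apply/measurable_EFinP; apply: measurable_funM => //.
  exact: measurable_ginibre_coef_sqnorm.
- by move=> j w _; rewrite lee_fin mulr_ge0 ?sqnormC_ge0 ?k0.
rewrite (eq_bigr _ (fun j _ => Ek j)) sumEFin lee_fin.
rewrite (reindex_inj rev_ord_inj) /=.
under eq_bigr do rewrite subKn//.
have := sum_sqr_slope_le n.+1 (ltW s0).
rewrite big_ord_recl /= mulr0 addr0 divr1 lerD2l.
under eq_bigr do rewrite exprMn exprVn.
rewrite -mulr_sumr expr2 -mulrA ger_pMr// => h.
by rewrite -[leRHS]mul1r ler_pdivlMr// mulrC.
Qed.

End matrix.
End last_row.

(** * Integrals against the zero measure and the semicircle law *)

Lemma prod_XsubC_perm_eq (F : idomainType) (r s : seq F) :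
  \prod_(a <- r) ('X - a%:P) = \prod_(a <- s) ('X - a%:P) -> perm_eq r s.
Proof.
elim: r s => [|a r IH] s.
  move=> /(congr1 (fun p : {poly F} => size p)).
  by rewrite !size_prod_XsubC /= => -[/esym/size0nil ->].
move=> rs; have sa : a \in s.
  by rewrite -root_prod_XsubC -rs root_prod_XsubC in_cons eqxx.
have ps := perm_to_rem sa; rewrite perm_sym in ps.
apply: perm_trans ps; rewrite perm_cons; apply: IH.
have a0 : 'X - a%:P != 0 by rewrite polyXsubC_eq0.
apply: (mulfI a0); move: rs; rewrite big_cons => ->.
by rewrite (perm_big _ (perm_to_rem sa)) big_cons.
Qed.

Section integrals.
Variable R : realType.
Local Notation C := R[i].

(** Integrals are computed for nonnegative functions first; adding the bound [M]
    reduces to them. *)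
Lemma bounded_integral_shift (m : {measure set (measurableTypeC R) -> \bar R})
    (f : C^o -> R) (M l : R) : continuous f -> (forall z, `|f z| <= M) ->
    m setT = 1%E -> (\int[m]_z (f z + M)%:E = (l + M)%:E)%E ->
  (\int[m]_z (f z)%:E = l%:E)%E.
Proof.
move=> cf fM m1 fl.
have mf := continuous_measurable_funC cf.
have iM : m.-integrable setT (EFin \o cst M).
  apply/integrableP; split; first exact/measurable_EFinP.
  rewrite (eq_integral (cst `|M%:E|%E))// integral_cst//= m1 mule1.
  by rewrite ltry.
have ifM : m.-integrable setT (EFin \o (fun z => f z)).
  apply: (le_integrable measurableT _ _ iM); first exact/measurable_EFinP.
  by move=> z _ /=; rewrite lee_fin (le_trans (fM z))// ler_norm.
move: fl; under eq_integral do rewrite EFinD.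
have mM : (\int[m]_z M%:E = M%:E)%E.
  by rewrite (eq_integral (cst M%:E))// integral_cst//= m1 mule1.
rewrite integralD//= mM EFinD.
have := integrable_fin_num measurableT ifM.
rewrite -[X in (X \is a fin_num)%E -> _]/(\int[m]_z (f z)%:E)%E.
by move: (\int[m]_z (f z)%:E)%E => [r _ [] /addIr ->| |]//.
Qed.

Lemma zero_measure_integral (N : nat) (q : {poly C}) (z : 'I_N -> C)
    (f : C^o -> R) : (0 < N)%N -> q = \prod_i ('X - (z i)%:P) ->
    continuous f -> (exists M : R, forall z, `|f z| <= M) ->
  (\int[zero_measure q]_u (f u)%:E = (N%:R^-1 * \sum_i f (z i))%:E)%E.
Proof.
move=> N0 qz cf [M fM].
have NR : (0 : R) < N%:R by rewrite ltr0n.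
have qm : q \is monic by rewrite qz monic_prod_XsubC.
have sq : size q = N.+1.
  by rewrite qz size_prod_XsubC /index_enum unlock -enumT -cardT card_ord.
have pz : perm_eq (zeros q) [seq z i | i <- index_enum 'I_N].
  apply: prod_XsubC_perm_eq; rewrite big_map -qz.
  rewrite /zeros; case: closed_field_poly_normal => r /= qr.
  by rewrite [RHS]qr (monicP qm) scale1r.
have ge0E (g : C -> R) : measurable_fun setT (g : measurableTypeC R -> R) ->
    (forall u, 0 <= g u) ->
    (\int[zero_measure q]_u (g u)%:E = (N%:R^-1 * \sum_i g (z i))%:E)%E.
  move=> mg g0; have mgE : measurable_fun setT (EFin \o g : measurableTypeC R -> \bar R).
    exact/measurable_EFinP.
  rewrite /zero_measure ge0_integral_mscale//; last by move=> u _; rewrite lee_fin.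
  rewrite ge0_integral_measure_sum//; last by move=> u _; rewrite lee_fin.
  rewrite EFinM; congr (_ * _)%E; first by rewrite /= sq.
  under eq_bigr do rewrite integral_dirac// diracT mul1e.
  rewrite sumEFin; congr EFin.
  rewrite -(big_mkord xpredT (fun k => g (zeros q)`_k)).
  rewrite -(big_nth 0 xpredT g) (perm_big _ pz) /=.
  by rewrite big_map.
have mf := continuous_measurable_funC cf.
apply: (bounded_integral_shift cf fM).
  have := ge0E (cst 1) (measurable_cst _) (fun=> ler01).
  rewrite /= sumr_const card_ord mulVf ?gt_eqF// => <-.
  by rewrite (eq_integral (cst 1%E))// integral_cst// mul1e.
rewrite (ge0E (fun u => f u + M)).
- rewrite big_split sumr_const card_ord mulrDr -[M *+ N]mulr_natl mulrA mulVf ?gt_eqF//.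
  by rewrite mul1r.
- by apply: measurable_funD.
- by move=> u; rewrite -lerBlDr sub0r; have := fM u; rewrite ler_norml => /andP[].
Qed.

(** The image of the density under the inclusion of the real line: the two
    integrals agree on indicator functions, hence on nonnegative functions. *)
Lemma semicircleC_integral (f : C^o -> R) : continuous f ->
    (exists M : R, forall z, `|f z| <= M) ->
  (\int[@semicircleC R]_u (f u)%:E = (semicircle_mean (fun x => f x%:C%C))%:E)%E.
Proof.
move=> cf [M fM].
have crf := continuous_comp_real cf.
have ge0E (g : C -> R) : measurable_fun setT (g : measurableTypeC R -> R) ->
    continuous (fun x : R => g x%:C%C) -> (forall u, 0 <= g u) ->
    (\int[@semicircleC R]_u (g u)%:E = (semicircle_mean (fun x => g x%:C%C))%:E)%E.
  move=> mg cg g0.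
  transitivity (\int[@semicircleC R]_u (cst 1 u * g u)%:E)%E.
    by apply: eq_integral => u _; rewrite mul1r.
  rewrite (@weighted_integral_eq R _ _ _ _ _ _ (@semicircleC R) lebesgue_measure
    (cst 1) semicircle_pdf id (@real_to_C R))//.
  - transitivity (\int[lebesgue_measure]_(x in `[(- 2)%R : R, 2%R])
        ((2 * pi)^-1 * (Num.sqrt (4 - x ^+ 2) * g x%:C%C))%:E)%E.
      rewrite [RHS]integral_mkcond; apply: eq_integral => x _.
      rewrite /= patchE /semicircle_pdf indicE; case: ifP => xI.
        by rewrite mulr1 -mulrA mulrCA mulrA.
      by rewrite mulr0 mul0r.
    have icg : lebesgue_measure.-integrable `[(- 2)%R : R, 2%R]
        (EFin \o (fun x => Num.sqrt (4 - x ^+ 2) * g x%:C%C)).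
      exact: semicircle_arc_integrable.
    rewrite /semicircle_mean /Rintegral.
    under eq_integral do rewrite EFinM.
    by rewrite (integralZl _ icg)// EFinM fineK//; exact: integrable_fin_num.
  - exact: measurable_semicircle_pdf.
  - exact: semicircle_pdf_ge0.
  - exact: measurable_real_to_C.
  move=> B mB.
  have mRB : measurable (@real_to_C R @^-1` B).
    by rewrite -[X in measurable X]setTI; exact: measurable_real_to_C.
  transitivity (@semicircleC R B).
    rewrite -[B in RHS]setIT -integral_indic//.
    by apply: eq_integral => u _; rewrite mul1r.
  rewrite /semicircleC /pushforward /semicircle /= integral_mkcond.
  apply: eq_integral => t _; rewrite patchE indicE /=.
  rewrite (_ : (t \in _) = (real_to_C t \in B)).
    by case: ifP => _; rewrite ?mulr1 ?mulr0.
  by apply/idP/idP; rewrite !inE.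
have mf := continuous_measurable_funC cf.
apply: (bounded_integral_shift cf fM).
  have := ge0E (cst 1) (measurable_cst _) (fun x => cvg_cst _) (fun=> ler01).
  rewrite semicircle_mean1 => <-.
  by rewrite (eq_integral (cst 1%E))// integral_cst// mul1e.
rewrite (ge0E (fun u => f u + M)).
- have cM : continuous (fun x : R => M * (fun=> 1) x).
    by move=> x; exact: cvg_cst.
  have -> : (fun x : R => f x%:C%C + M) = (fun x => f x%:C%C) \+ (fun x => M * (fun=> 1) x).
    by apply/funext => x /=; rewrite mulr1.
  rewrite semicircle_meanD// semicircle_meanZ ?semicircle_mean1 ?mulr1//.
  by move=> x; exact: cvg_cst.
- by apply: measurable_funD.
- by move=> x; apply: cvgD; [exact: crf|exact: cvg_cst].
- by move=> u; rewrite -lerBlDr sub0r; have := fM u; rewrite ler_norml => /andP[].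
Qed.

End integrals.

(** * Almost sure convergence *)

Section almost_sure.
Context {d : measure_display} {T : measurableType d} {R : realType}.
Variable P : probability T R.
Local Notation C := R[i].

(** The last coefficient is minus the trace. Its contribution to the cost is squared
    in order to be summable: [E (|tr G|^2 / N)^2 <= K / N^2], while
    [|tr G|^2 / N] only has expectation [1 / N]. *)
Lemma ginibre_last_row_expectation (n : nat) (G : T -> 'M[C]_n.+1)
    (s := row_weight R n.+1) : ginibre P G ->
  (\int[P]_w (n.+1%:R^-1 * lower_row_norm n s (fun j => (char_poly (G w))`_j) +
      (n.+1%:R^-1 * sqnormC (char_poly (G w))`_n) ^+ 2)%:E <=
    ((1 + 2048 * expR 2) * (s * n.+1%:R)^-1)%:E)%E.
Proof.
move=> hG.
have s0 : 0 < s := row_weight_gt0 R (ltn0Sn n).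
have NR : (0 : R) < n.+1%:R by rewrite ltr0n.
have mc := measurable_ginibre_coef_sqnorm hG n.
have ml := measurable_ginibre_lower_row hG s.
have mx2 : measurable_fun setT (fun w => (sqnormC (char_poly (G w))`_n) ^+ 2).
  exact: measurable_funX.
under eq_integral do rewrite exprMn EFinD.
rewrite ge0_integralD//; last 4 first.
- by move=> w _; rewrite lee_fin mulr_ge0 ?invr_ge0// lower_row_norm_ge0// ltW.
- by apply/measurable_EFinP; apply: measurable_funM.
- by move=> w _; rewrite lee_fin mulr_ge0 ?sqr_ge0.
- by apply/measurable_EFinP; apply: measurable_funM.
under eq_integral do rewrite EFinM.
rewrite ge0_integralZl_EFin ?invr_ge0//; last 2 first.
- by move=> w _; rewrite lee_fin lower_row_norm_ge0// ltW.
- exact/measurable_EFinP.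
under [X in (_ + X)%E]eq_integral do rewrite EFinM.
rewrite ge0_integralZl_EFin ?sqr_ge0//; last 2 first.
- by move=> w _; rewrite lee_fin sqr_ge0.
- exact/measurable_EFinP.
rewrite mulrDl EFinD mul1r; apply: leeD.
  rewrite invfM mulrC EFinM; apply: lee_wpmul2l; first by rewrite lee_fin invr_ge0.
  exact: ginibre_lower_row_expectation.
have -> : (\int[P]_w (sqnormC (char_poly (G w))`_n ^+ 2)%:E =
    \int[P]_w (sqnormC (\tr (G w)) ^+ 2)%:E)%E.
  by apply: eq_integral => w _; rewrite -[X in _`_X]/(n.+1.-1) char_poly_trace// sqnormCN.
apply: le_trans (lee_wpmul2l _ (ginibre_trace_fourth_moment hG (ltn0Sn n))) _.
  by rewrite lee_fin sqr_ge0.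
rewrite -EFinM lee_fin mulrC.
have K0 : 0 <= 2048 * expR 2 :> R by apply: mulr_ge0; [exact: ler0n|exact: expR_ge0].
move: (2048 * expR 2) K0 => K K0; apply: ler_wpM2l => //.
rewrite expr2 invfM ler_wpM2r ?invr_ge0// lef_pV2 ?posrE//.
have s1 : 1 <= s.
  rewrite leNgt; apply/negP => s1.
  have : s ^+ 4 < 1 by rewrite exprn_ilt1// ltW.
  by rewrite row_weight_expr4 ltNge ler1n.
by rewrite -(row_weight_expr4 R n.+1) -/s -[leLHS]expr1 ler_weXn2l.
Qed.

(** If [A + B ^ 2] tends to 0 with [A] and [B] nonnegative, then so does [A + B],
    which is at most [A + B ^ 2] plus its square root. *)
Lemma ginibre_last_row_ae (G : forall N : nat, T -> 'M[C]_N) :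
    (forall N, (0 < N)%N -> ginibre P (G N)) ->
  {ae P, forall w, (n.+1%:R^-1 * last_row_norm n.+1 (row_weight R n.+1)
    (fun j => (char_poly (G n.+1 w))`_j)) @[n --> \oo] --> (0 : R)}.
Proof.
move=> hG; pose s n := row_weight R n.+1.
have s0 n : 0 < s n := row_weight_gt0 R (ltn0Sn n).
pose A n w := n.+1%:R^-1 * lower_row_norm n (s n) (fun j => (char_poly (G n.+1 w))`_j).
pose B n w := n.+1%:R^-1 * sqnormC (char_poly (G n.+1 w))`_n.
have A0 n w : 0 <= A n w by rewrite mulr_ge0 ?invr_ge0// lower_row_norm_ge0// ltW.
have B0 n w : 0 <= B n w by rewrite mulr_ge0 ?invr_ge0// sqnormC_ge0.
have mA n : measurable_fun setT (A n).
  by apply: measurable_funM => //; exact: measurable_ginibre_lower_row (hG _ _) _.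
have mB n : measurable_fun setT (B n).
  by apply: measurable_funM => //; exact: measurable_ginibre_coef_sqnorm (hG _ _) _.
have Y0 : {ae P, forall w, A n w + B n w ^+ 2 @[n --> \oo] --> (0 : R)}.
  apply: (ae_cvg0_summable_integral (M := (1 + 2048 * expR 2) * 5)).
- by move=> n /=; apply: measurable_funD => //; exact: measurable_funX.
- by move=> n w; rewrite addr_ge0 ?sqr_ge0.
- move=> n; apply: le_trans (_ : (\sum_(k < n) ((1 + 2048 * expR 2) * (s k * k.+1%:R)^-1)%:E)%E <= _)%E.
    by apply: lee_sum => k _; exact: ginibre_last_row_expectation (hG _ _).
  rewrite sumEFin lee_fin -mulr_sumr; apply: ler_wpM2l; last exact: sum_inv_weight_le.
  apply: addr_ge0; first exact: ler01.
  by apply: mulr_ge0; [exact: ler0n|exact: expR_ge0].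
apply: filterS Y0 => w Yw.
have -> : (fun n => n.+1%:R^-1 * last_row_norm n.+1 (row_weight R n.+1)
    (fun j => (char_poly (G n.+1 w))`_j)) = (fun n => A n w + B n w).
  by apply/funext => n; rewrite last_row_normS mulrDr.
have Yw2 : (A n w + B n w ^+ 2) + Num.sqrt (A n w + B n w ^+ 2) @[n --> \oo] --> (0 : R).
  rewrite -[X in _ --> X]addr0; apply: cvgD => //.
  by rewrite -[X in _ --> X]sqrtr0; apply: continuous_cvg => //; exact: sqrt_continuous.
apply: (squeeze_cvgr _ (cvg_cst 0) Yw2).
apply: nearW => n; rewrite addr_ge0//= lerD//.
  by rewrite lerDl sqr_ge0.
rewrite -[leLHS](ger0_norm (B0 n w)) -sqrtr_sqr ler_wsqrtr// lerDr//.
Qed.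

End almost_sure.

Theorem corollary1p3 (R : realType) (d : measure_display)
    (T : measurableType d) (P : probability T R)
    (G : forall N : nat, T -> 'M[R[i]]_N)
    (hG : forall N : nat, (0 < N)%N -> ginibre P (G N)) :
  let p (N : nat) (w : T) : {poly R[i]} := char_poly (G N w) in
  let q (N : nat) (w : T) : {poly R[i]} := heat N (- 1) (p N w) in
  {ae P, forall w : T,
    weak_cvg (fun N => zero_measure (q N w)) (@semicircleC R)}.
Proof.
move=> p q; have := ginibre_last_row_ae hG; apply: filterS => w rw f cf fb.
pose c N (j : nat) := (p N w)`_j; pose s := row_weight R.
have qE N : q N w = hermite R N N + \sum_(j < N) c N j *: hermite R N j.
  rewrite /q heat_hermite size_char_poly big_ord_recr addrC /=; congr (_ + _).
  have := char_poly_monic (G N w); rewrite monicE /lead_coef size_char_poly => /eqP ->.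
  by rewrite scale1r.
pose eps N := 12 * (2 * (s N ^+ 2 + s N) + last_row_norm N (s N) (c N)) / N%:R.
have cpl N : exists zxp : ('I_N -> R[i]) * ('I_N -> R) * ('I_N -> 'I_N -> R),
  let: (z, x, m) := zxp in
  [/\ (0 < N)%N -> q N w = \prod_i ('X - (z i)%:P),
      (0 < N)%N -> hermite R N N = \prod_i ('X - (x i)%:C%C%:P),
      [/\ forall i j, 0 <= m i j, forall i, \sum_j m i j = 1 &
          forall j, \sum_i m i j = 1] &
      \sum_i \sum_j m i j * sqnormC (z i - (x j)%:C%C) <= N%:R * eps N].
  have [->|N0] := posnP N.
    (* Any value does for N = 0, where the sums and the conditions are empty. *)
    exists ((fun=> 0), (fun=> 0), (fun _ _ => 0)); split => //; last by rewrite big_ord0 mul0r.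
    by split=> //; case.
  have [z [x [m [qz hx m1 le]]]] :=
    hermite_coupling (c N) N0 (ltW (row_weight_gt0 R N0)).
  exists (z, x, m); split => //; first by rewrite qE.
  by rewrite /eps mulrCA divff ?mulr1// pnatr_eq0 -lt0n.
pose zxp N := sval (cid (cpl N)).
have zxpP N := svalP (cid (cpl N)).
pose z N := (zxp N).1.1; pose x N := (zxp N).1.2; pose m N := (zxp N).2.
have {}zxpP N : [/\ (0 < N)%N -> q N w = \prod_i ('X - (z N i)%:P),
      (0 < N)%N -> hermite R N N = \prod_i ('X - (x N i)%:C%C%:P),
      [/\ forall i j, 0 <= m N i j, forall i, \sum_j m N i j = 1 &
          forall j, \sum_i m N i j = 1] &
      \sum_i \sum_j m N i j * sqnormC (z N i - (x N j)%:C%C) <= N%:R * eps N].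
  by rewrite /z /x /m; have := zxpP N; rewrite -/(zxp N); case: (zxp N) => [[]].
have eps0 : eps N @[N --> \oo] --> (0 : R).
  suff : eps n.+1 @[n --> \oo] --> (0 : R) by rewrite cvg_shiftS.
  have -> : (fun n => eps n.+1) = (fun n => 24 * ((s n.+1 ^+ 2 + s n.+1) / n.+1%:R) +
      12 * (n.+1%:R^-1 * last_row_norm n.+1 (s n.+1) (c n.+1))).
    by apply/funext => n; rewrite /eps; ring.
  have e0 : (24 * 0 + 12 * 0 : R) = 0 by rewrite !mulr0 addr0.
  rewrite -[X in _ --> X]e0.
  apply: cvgD; apply: cvgM; try exact: cvg_cst.
    exact: cvg_row_weight_cost.
  exact: rw.
have limq := cvg_coupled_zeros
  (fun N N0 => let: And4 _ hx _ _ := zxpP N in hx N0)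
  (fun N => let: And4 _ _ (And3 h _ _) _ := zxpP N in h)
  (fun N => let: And4 _ _ (And3 _ h _) _ := zxpP N in h)
  (fun N => let: And4 _ _ (And3 _ _ h) _ := zxpP N in h)
  (fun N => let: And4 _ _ _ h := zxpP N in h) eps0 cf fb.
rewrite semicircleC_integral//.
have limE : (N%:R^-1 * \sum_i f (z N i))%:E @[N --> \oo] -->
    (semicircle_mean (fun x => f x%:C%C))%:E.
  by apply: cvg_EFin => //; exact: nearW.
apply: cvg_trans limE; apply: near_eq_cvg; near=> N.
have N0 : (0 < N)%N by near: N; exists 1%N.
by case: (zxpP N) => qz _ _ _; rewrite (zero_measure_integral N0 (qz N0)).
Unshelve. all: by end_near. Qed.
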